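(* Let $\mathcal{D}$ be a holomorphic distribution of complex hyperplanes in $\mathbb{C}^3$ (i.e., locally $\mathcal{D}=\ker\omega$ for a nowhere-vanishing holomorphic $1$-form $\omega$). Suppose that for every point $p\in\mathbb{C}^3$ and every neighborhood $U$ of $p$, there exists a point $q\in U$ that cannot be reached from $p$ by a holomorphic curve in $U$ admissible for $\mathcal{D}$. Then $\mathcal{D}$ is integrable.
   Context: A holomorphic curve $\gamma$ (a holomorphic map from a domain in $\mathbb{C}$ into $\mathbb{C}^3$) is called admissible for $\mathcal{D}$ if at each point its complex tangent vector lies in the corresponding plane of $\mathcal{D}$, i.e., $\omega(\gamma'(t))=0$ for all $t$. A point $q$ is reachable from $p$ if there is an admissible holomorphic curve passing through both $p$ and $q$. The distribution $\mathcal{D}$ is integrable if $\mathbb{C}^3$ is locally foliated by complex hypersurfaces whose tangent planes coincide with the planes of $\mathcal{D}$. *)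

(* Defs.v *)
From HB Require Import structures.
From mathcomp Require Import all_boot all_order all_algebra.
From mathcomp Require Import all_classical all_reals all_analysis.
From mathcomp.real_closed Require Import complex.
Import Order.TTheory GRing.Theory Num.Theory.
Import numFieldNormedType.Exports.
Local Open Scope classical_set_scope.
Local Open Scope ring_scope.

Set Implicit Arguments.
Unset Strict Implicit.
Unset Printing Implicit Defensive.

Definition Cl (R : realType) : normedModType R[i] := (R[i])^o.
Definition C3 (R : realType) : normedModType R[i] := 'rV[R[i]]_3.

Definition holo_on (R : realType) (V : set (C3 R)) (f : C3 R -> Cl R) :=
  open V /\ forall q, V q -> differentiable f q.

(* D : C^3 -> (set of vectors) is a holomorphic distribution of complex
   hyperplanes: locally D = ker omega, omega = sum_i a_i dz_i with the a_i
   holomorphic and nowhere simultaneously vanishing. *)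
Definition hol_hyperplane_distribution (R : realType)
    (D : C3 R -> set (C3 R)) :=
  forall p : C3 R, exists V : set (C3 R), V p /\
    exists a : 'I_3 -> C3 R -> Cl R,
      (forall i, holo_on V (a i)) /\
      forall q, V q ->
        (exists i, a i q != 0) /\
        D q = [set v : C3 R | \sum_(i < 3) (a i q : R[i]) * v ord0 i = 0].

Definition cdomain (R : realType) (O : set (Cl R)) :=
  open O /\ connected O /\ O !=set0.

Definition admissible_curve (R : realType) (D : C3 R -> set (C3 R))
    (O : set (Cl R)) (g : Cl R -> C3 R) :=
  cdomain O /\
  (forall t, O t -> derivable g t 1) /\
  (forall t, O t -> D (g t) (derive1 g t)).

Definition reachable_in (R : realType) (D : C3 R -> set (C3 R))
    (U : set (C3 R)) (p q : C3 R) :=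
  exists (O : set (Cl R)) (g : Cl R -> C3 R),
    admissible_curve D O g /\
    (forall t, O t -> U (g t)) /\
    exists t1 t2, O t1 /\ O t2 /\ g t1 = p /\ g t2 = q.

(* D is integrable: near every point, C^3 is foliated by complex
   hypersurfaces (the level sets of a holomorphic submersion F) whose tangent
   planes ker dF coincide with D. *)
Definition integrable_distribution (R : realType) (D : C3 R -> set (C3 R)) :=
  forall p : C3 R, exists V : set (C3 R), V p /\
    exists F : C3 R -> Cl R,
      holo_on V F /\
      forall q, V q ->
        (exists v, 'd F q v != 0) /\
        D q = [set v : C3 R | 'd F q v = 0].

(* Main.v *)
Require Import Defs.
From HB Require Import structures.
From mathcomp Require Import all_boot all_order all_algebra.
From mathcomp Require Import all_classical all_reals all_analysis.
From mathcomp.real_closed Require Import complex.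
From mathcomp Require Import ring lra.
Import Order.TTheory GRing.Theory Num.Theory.
Import numFieldNormedType.Exports.
Local Open Scope classical_set_scope.
Local Open Scope ring_scope.

Set Implicit Arguments.
Unset Strict Implicit.
Unset Printing Implicit Defensive.

(* If [q] is reachable from [p] inside [B] then it is reachable inside the set [U] of all
   points so reachable; hence it suffices that [U] be a neighbourhood of [p] for some [p].

   After a permutation of the coordinates D is [dz = A dx + B dy] near a given point. The flow
   of [d/dx + A d/dz] provides coordinates (x, y, w) in which D becomes [dw = G dy]. If
   [dG/dx = 0] then [dw = G(y, w) dy] is an ordinary differential equation, and its leaves give
   a first integral. Otherwise (u, y, w), with [u = G], are coordinates near some point, D is
   the contact structure [dw = u dy], and explicit polynomial Legendrian curves join the base
   point to every nearby point.

   The holomorphic flow and implicit function theorems are contraction arguments resting on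
   Cauchy estimates. The kernel [f(z) / z^2] is integrated over a triangle centred at 0: by
   Goursat's lemma the integral is unchanged when the triangle is replaced by its medial
   triangle, its image under [z |-> - z / 2], and so it equals a nonzero constant times f'(0). *)

(** In the coordinates (x, y, w) the plane field is the kernel of omega = dw - G dy, and the wedge
    product of omega with d omega is - (dG/dx) times the volume form dw dx dy. So dG/dx is exactly
    the Frobenius obstruction. It may vanish at the given point and be nonzero only at nearby ones;
    this is why the connecting curves start at another point, and why the hypothesis is used at that
    other point.

    The definitions give complex differentiability at each point, with no continuity of the
    derivative. The analysis therefore aims at one estimate, [holo_quad]: a quadratic Taylor
    remainder whose constant depends only on a radius and a bound of the function. Being uniform, it
    can be integrated and passed to the limit; this is how derivatives, integrals with parameters
    and limits of contraction iterates are shown to be holomorphic. *)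

Section Modulus.
Context {R : realType}.
Local Notation K := R[i].
Implicit Types (z u : K) (r : R).

(** [|z|] is itself an element of [R[i]]. Its real part is used instead, so that estimates live in
    the ordered field [R], where [lra] and [nra] apply. *)
Definition na (z : K) : R := complex.Re `|z|.

Lemma naE z : `|z| = (na z)%:C%C.
Proof. by rewrite /na RRe_real // ger0_real. Qed.

Lemma na_ge0 z : 0 <= na z.
Proof. by rewrite -ler0c -naE normr_ge0. Qed.

Lemma na0 : na 0 = 0. Proof. by rewrite /na normr0. Qed.
Lemma na1 : na 1 = 1. Proof. by rewrite /na normr1. Qed.

Lemma na_eq0 z : (na z == 0) = (z == 0).
Proof. by rewrite -[RHS]normr_eq0 naE (inj_eq (@complexI _)). Qed.

Lemma naM z u : na (z * u) = na z * na u.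
Proof. by apply: complexI; rewrite rmorphM /= -!naE normrM. Qed.

Lemma naN z : na (- z) = na z.
Proof. by rewrite /na normrN. Qed.

Lemma naV z : na z^-1 = (na z)^-1.
Proof. by apply: complexI; rewrite fmorphV /= -!naE normfV. Qed.

Lemma naC r : na r%:C%C = `|r|.
Proof. by apply: complexI; rewrite -naE normc_def /= expr0n addr0 sqrtr_sqr. Qed.

Lemma na_nat n : na n%:R = n%:R.
Proof. by rewrite -(rmorph_nat (real_complex R)) naC normr_nat. Qed.

Lemma naD z u : na (z + u) <= na z + na u.
Proof. by rewrite -lecR rmorphD /= -!naE ler_normD. Qed.

Lemma naB z u : na (z - u) <= na z + na u.
Proof. by rewrite (le_trans (naD _ _))// naN. Qed.

Lemma naBC z u : na (z - u) = na (u - z).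
Proof. by rewrite -naN opprB. Qed.

Lemma na_tri z1 z2 z3 : na (z1 - z3) <= na (z1 - z2) + na (z2 - z3).
Proof. by rewrite (le_trans _ (naD _ _))// addrA subrK. Qed.

Lemma na_Re z : `|complex.Re z| <= na z.
Proof. by rewrite -lecR -naE normc_ge_Re. Qed.

Lemma na_Im z : `|complex.Im z| <= na z.
Proof.
rewrite -lecR -naE normc_def lecR -sqrtr_sqr; apply: ler_wsqrtr.
by rewrite lerDr sqr_ge0.
Qed.

Lemma na_le_ReIm z : na z <= `|complex.Re z| + `|complex.Im z|.
Proof.
rewrite {1}(complexE z) (le_trans (naD _ _))// naM !naC.
suff -> : na 'i%C = 1 by rewrite mul1r.
by apply: complexI; rewrite -naE normc_def /= expr0n add0r expr1n sqrtr1.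
Qed.

Lemma na_small z : (forall e, 0 < e -> na z <= e) -> z = 0.
Proof.
move=> h; apply/eqP; rewrite -na_eq0 eq_le na_ge0 andbT.
by apply/ler_addgt0Pr => e e0; rewrite add0r h.
Qed.

End Modulus.

(** * Integration of complex-valued functions over [0, 1] *)

Section DyadicIntegral.
Context {R : realType}.
Local Notation K := R[i].
Implicit Types (g h : R -> K) (e : R) (c v : K).

(* Midpoint sums on [0, 1] with [2 ^ n] nodes, in recursive form: splitting the
   interval in two halves is then definitional. *)
Fixpoint midsum (n : nat) (g : R -> K) : K :=
  if n is m.+1 then (midsum m (fun t => g (t / 2)) + midsum m (fun t => g ((1 + t) / 2))) / 2
  else g (1 / 2).

Definition ucont g := forall e, 0 < e -> exists2 d, 0 < d &
  forall s t, 0 <= s <= 1 -> 0 <= t <= 1 -> `|s - t| <= d -> na (g s - g t) <= e.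

Lemma midsum_bound n g c e : (forall t, 0 <= t <= 1 -> na (g t - c) <= e) ->
  na (midsum n g - c) <= e.
Proof.
elim: n g => [|n IH] g H /=; first by apply: H; lra.
set a := midsum _ _; set b := midsum _ _.
have Ha : na (a - c) <= e by apply: IH => t ?; apply: H; lra.
have Hb : na (b - c) <= e by apply: IH => t ?; apply: H; lra.
have -> : (a + b) / 2 - c = ((a - c) + (b - c)) / 2 by field.
rewrite naM naV na_nat.
have := naD (a - c) (b - c); lra.
Qed.

(** Cutting [0, 1] in halves doubles the distance allowed between arguments, so [N] cuts reduce to
    [N = 0], where an average of values of [g] is compared with the value at 1/2. *)
Lemma midsum_cauchy N k g e :
  (forall s t, 0 <= s <= 1 -> 0 <= t <= 1 -> `|s - t| <= 2^-1 ^+ N ->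
    na (g s - g t) <= e) ->
  na (midsum (N + k) g - midsum N g) <= e.
Proof.
elim: N g => [|N IH] g H /=.
  apply: midsum_bound => t ht; apply: H => //; first by lra.
  by rewrite expr0 ler_norml; lra.
set a := midsum _ _; set b := midsum _ _; set a' := midsum _ _; set b' := midsum _ _.
have Ha : na (a - a') <= e.
  apply: IH => s t ? ? st; apply: H; try lra.
  by rewrite -mulrBl normrM exprSr ler_pM// ger0_norm; lra.
have Hb : na (b - b') <= e.
  apply: IH => s t ? ? st; apply: H; try lra.
  rewrite -mulrBl normrM exprSr ler_pM//; last by rewrite ger0_norm; lra.
  by rewrite (_ : 1 + s - (1 + t) = s - t)//; lra.
have -> : (a + b) / 2 - (a' + b') / 2 = ((a - a') + (b - b')) / 2 by field.
rewrite naM naV na_nat.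
have := naD (a - a') (b - b'); lra.
Qed.

Lemma half_pow_lt (d : R) : 0 < d -> exists N, 2^-1 ^+ N < d :> R.
Proof.
move=> d0; pose N := Num.truncn d^-1; exists N.+1.
have hN : d^-1 < N.+1%:R.
  by have := truncn_itv (ltW _) ; move=> /(_ _ d^-1); rewrite invr_gt0 d0 => /(_ isT)/andP[].
have h2 : (N.+1%:R : R) < 2 ^+ N.+1 by rewrite -natrX ltr_nat ltn_expl.
by rewrite exprVn invf_plt ?posrE ?exprn_gt0// (lt_trans hN).
Qed.

Lemma ucont_cauchy g : ucont g -> forall e, 0 < e ->
  exists N, forall n m, (N <= n)%N -> (N <= m)%N -> na (midsum n g - midsum m g) <= e.
Proof.
move=> ug e e0; have [|d d0 H] := ug (e / 2); first by lra.
have [N hN] := half_pow_lt d0.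
have HN n : (N <= n)%N -> na (midsum n g - midsum N g) <= e / 2.
  move=> Nn; rewrite -(subnKC Nn); apply: midsum_cauchy => s t hs ht st.
  by apply: H => //; apply: le_trans st (ltW hN).
exists N => n m /HN hn /HN hm.
rewrite (le_trans (na_tri _ (midsum N g) _))// (naBC (midsum N g)); lra.
Qed.

(** The limits are taken on real and imaginary parts because completeness is that of [R]. Without
    convergence [limn] carries no information, hence the [ucont] hypotheses below. *)
Definition int01 g : K :=
  Complex (limn (fun n => complex.Re (midsum n g))) (limn (fun n => complex.Im (midsum n g))).

Lemma real_cauchy_approx (u : nat -> R) :
  (forall e, 0 < e -> exists N, forall n m, (N <= n)%N -> (N <= m)%N ->
     `|u n - u m| <= e) ->
  forall e, 0 < e -> exists N, forall n, (N <= n)%N -> `|u n - limn u| <= e.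
Proof.
move=> H e e0.
have /cvgrPdist_le /(_ e e0) [N _ HN] : cvgn u.
  apply/cauchy_cvgP/cauchy_exP => eps eps0.
  have [|N HN] := H (eps / 2); first by lra.
  exists (u N); exists N => // n /= Nn; rewrite /ball /=.
  by rewrite (le_lt_trans (HN _ _ _ _))//; lra.
by exists N => n Nn; rewrite distrC; apply: HN.
Qed.

Lemma complex_cauchy_approx (u : nat -> K) :
  (forall e, 0 < e -> exists N, forall n m, (N <= n)%N -> (N <= m)%N ->
     na (u n - u m) <= e) ->
  forall e, 0 < e -> exists N, forall n, (N <= n)%N ->
    na (u n - Complex (limn (fun n => complex.Re (u n)))
                      (limn (fun n => complex.Im (u n)))) <= e.
Proof.
move=> H e e0.
have ReB z z' : complex.Re (z - z') = complex.Re z - complex.Re z' :> R.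
  by case: z z' => [? ?] [? ?].
have ImB z z' : complex.Im (z - z') = complex.Im z - complex.Im z' :> R.
  by case: z z' => [? ?] [? ?].
have [||N1 H1] := @real_cauchy_approx (fun n => complex.Re (u n)) _ (e / 2).
- move=> e' /H [N HN]; exists N => n m hn hm.
  by rewrite -ReB (le_trans (na_Re _))// HN.
- by lra.
have [||N2 H2] := @real_cauchy_approx (fun n => complex.Im (u n)) _ (e / 2).
- move=> e' /H [N HN]; exists N => n m hn hm.
  by rewrite -ImB (le_trans (na_Im _))// HN.
- by lra.
exists (maxn N1 N2) => n; rewrite geq_max => /andP[/H1 h1 /H2 h2].
rewrite (le_trans (na_le_ReIm _))// ReB ImB /=; lra.
Qed.

Lemma int01_approx g : ucont g -> forall e, 0 < e ->
  exists N, forall n, (N <= n)%N -> na (midsum n g - int01 g) <= e.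
Proof. by move=> /ucont_cauchy; apply: complex_cauchy_approx. Qed.

Lemma int01_eq g v : ucont g ->
  (forall e, 0 < e -> exists N, forall n, (N <= n)%N -> na (midsum n g - v) <= e) ->
  int01 g = v.
Proof.
move=> ug H; apply/eqP; rewrite -subr_eq0; apply/eqP/na_small => e e0.
have [|N1 H1] := H (e / 2); first by lra.
have [|N2 H2] := @int01_approx _ ug (e / 2); first by lra.
have := H1 _ (leq_maxl N1 N2); have := H2 _ (leq_maxr N1 N2).
rewrite (naBC _ (int01 g)) => h2 h1.
rewrite (le_trans (na_tri _ (midsum (maxn N1 N2) g) _))//; lra.
Qed.

Lemma ucontD g h : ucont g -> ucont h -> ucont (fun t => g t + h t).
Proof.
move=> ug uh e e0; have [|d1 d10 H1] := ug (e / 2); first by lra.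
have [|d2 d20 H2] := uh (e / 2); first by lra.
exists (Num.min d1 d2); first by rewrite lt_min d10.
move=> s t hs ht; rewrite le_min => /andP[/H1 h1 /H2 h2].
have {}h1 := h1 hs ht; have {}h2 := h2 hs ht.
rewrite (_ : _ - _ = (g s - g t) + (h s - h t)); last by ring.
rewrite (le_trans (naD _ _))//; lra.
Qed.

Lemma ucontZ c g : ucont g -> ucont (fun t => c * g t).
Proof.
move=> ug e e0; have h : 0 < na c + 1 by have := na_ge0 c; lra.
have [|d d0 H] := ug (e / (na c + 1)); first by rewrite divr_gt0.
exists d => // s t hs ht st; rewrite -mulrBr naM.
have := H s t hs ht st; rewrite ler_pdivlMr// => H'.
rewrite (le_trans _ H')// mulrC ler_wpM2l ?na_ge0//; lra.
Qed.

Lemma ucont_cst c : ucont (fun=> c).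
Proof. by move=> e e0; exists 1 => // s t _ _ _; rewrite subrr na0 ltW. Qed.

Lemma eq_ucont g h : (forall t, 0 <= t <= 1 -> g t = h t) -> ucont g -> ucont h.
Proof.
move=> gh ug e e0; have [d d0 H] := ug e e0; exists d => // s t hs ht st.
by rewrite -!gh// H.
Qed.

Lemma midsumD n g h : midsum n (fun t => g t + h t) = midsum n g + midsum n h.
Proof. by elim: n g h => [|n IH] g h //=; rewrite !IH; ring. Qed.

Lemma midsumZ n c g : midsum n (fun t => c * g t) = c * midsum n g.
Proof. by elim: n g => [|n IH] g //=; rewrite !IH; ring. Qed.

(** The nodes are symmetric about 1/2. This gives the orientation rule [seg_int_rev]. *)
Lemma midsum_rev n g : midsum n (fun t => g (1 - t)) = midsum n g.
Proof.
elim: n g => [|n IH] g /=; first by congr g; field.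
rewrite addrC -(IH (fun t => g (t / 2))) -(IH (fun t => g ((1 + t) / 2))).
by congr ((midsum n _ + midsum n _) / 2); apply/funext => t; congr g; field.
Qed.

Lemma eq_midsum n g h : (forall t, 0 <= t <= 1 -> g t = h t) -> midsum n g = midsum n h.
Proof.
elim: n g h => [|n IH] g h H /=; first by apply: H; lra.
by congr ((_ + _) / 2); apply: IH => t ht; apply: H; lra.
Qed.

Lemma int01D g h : ucont g -> ucont h ->
  int01 (fun t => g t + h t) = int01 g + int01 h.
Proof.
move=> ug uh; apply: int01_eq; first exact: ucontD.
move=> e e0; have [|N1 H1] := @int01_approx _ ug (e / 2); first by lra.
have [|N2 H2] := @int01_approx _ uh (e / 2); first by lra.
exists (maxn N1 N2) => n; rewrite geq_max => /andP[/H1 h1 /H2 h2].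
rewrite midsumD (_ : _ - _ = (midsum n g - int01 g) + (midsum n h - int01 h)); last by ring.
rewrite (le_trans (naD _ _))//; lra.
Qed.

Lemma int01Z c g : ucont g -> int01 (fun t => c * g t) = c * int01 g.
Proof.
move=> ug; apply: int01_eq; first exact: ucontZ.
move=> e e0; have h : 0 < na c + 1 by have := na_ge0 c; lra.
have [|N H] := @int01_approx _ ug (e / (na c + 1)); first by rewrite divr_gt0.
exists N => n /H; rewrite ler_pdivlMr// => H'; rewrite midsumZ -mulrBr naM.
rewrite (le_trans _ H')// mulrC ler_wpM2l ?na_ge0//; lra.
Qed.

Lemma eq_int01 g h : (forall t, 0 <= t <= 1 -> g t = h t) -> int01 g = int01 h.
Proof.
move=> gh; rewrite /int01.
by congr (Complex (limn _) (limn _)); apply/funext => n; rewrite (eq_midsum _ gh).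
Qed.

Lemma int01_bound g c e : ucont g -> (forall t, 0 <= t <= 1 -> na (g t - c) <= e) ->
  na (int01 g - c) <= e.
Proof.
move=> ug H; apply/ler_addgt0Pr => e' e'0.
have [N HN] := int01_approx ug e'0.
rewrite (le_trans (na_tri _ (midsum N g) _))// addrC lerD ?midsum_bound//.
by rewrite naBC HN.
Qed.

Lemma int01_cst c : int01 (fun=> c) = c.
Proof.
apply/eqP; rewrite -subr_eq0; apply/eqP/na_small => e e0.
by apply: int01_bound (ucont_cst c) _ => t _; rewrite subrr na0 ltW.
Qed.

Lemma int01_rev g : int01 (fun t => g (1 - t)) = int01 g.
Proof.
rewrite /int01.
by congr (Complex (limn _) (limn _)); apply/funext => n; rewrite midsum_rev.
Qed.

Lemma ucont_comp g (a b : R) : (forall t, 0 <= t <= 1 -> 0 <= a + b * t <= 1) ->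
  ucont g -> ucont (fun t => g (a + b * t)).
Proof.
move=> hab ug e e0; have [d d0 H] := ug e e0.
have b0 : 0 < `|b| + 1 by rewrite ltr_wpDl.
exists (d / (`|b| + 1)); first by rewrite divr_gt0.
move=> s t hs ht st; apply: H; rewrite ?hab//.
rewrite (_ : _ - _ = b * (s - t)); last by ring.
rewrite normrM; move: st; rewrite ler_pdivlMr// => st.
by rewrite (le_trans _ st)// mulrC ler_wpM2l//; lra.
Qed.

Lemma int01_half g : ucont g ->
  int01 g = (int01 (fun t => g (t / 2)) + int01 (fun t => g ((1 + t) / 2))) / 2.
Proof.
move=> ug.
have u1 : ucont (fun t => g (t / 2)).
  apply: eq_ucont (@ucont_comp g 0 2^-1 _ ug) => t ht; last by lra.
  by congr g; field.
have u2 : ucont (fun t => g ((1 + t) / 2)).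
  apply: eq_ucont (@ucont_comp g 2^-1 2^-1 _ ug) => t ht; last by lra.
  by congr g; field.
apply: int01_eq => // e e0.
have [N1 H1] := int01_approx u1 e0; have [N2 H2] := int01_approx u2 e0.
(* The sum of depth [n.+1] over [0, 1] is by definition the mean of the sums of depth [n] over the
   two halves. *)
exists (maxn N1 N2).+1 => -[//|n]; rewrite ltnS geq_max => /andP[/H1 h1 /H2 h2] /=.
set a := midsum _ _ in h1 *; set b := midsum _ _ in h2 *.
set a' := int01 _ in h1 *; set b' := int01 _ in h2 *.
have -> : (a + b) / 2 - (a' + b') / 2 = ((a - a') + (b - b')) / 2 by field.
rewrite naM naV na_nat.
have := naD (a - a') (b - b'); lra.
Qed.

Lemma ucont_id : ucont (fun t => t%:C%C).
Proof.
by move=> e e0; exists e => // s t _ _ st; rewrite -rmorphB naC.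
Qed.

(** The substitution t -> 1 - t turns the integral I into 1 - I. *)
Lemma int01_id : int01 (fun t => t%:C%C) = 2^-1.
Proof.
have h : int01 (fun t => t%:C%C) = 1 - int01 (fun t => t%:C%C).
  rewrite -[LHS]int01_rev (@eq_int01 _ (fun t => 1 + (-1) * t%:C%C)); last first.
    by move=> t _; rewrite rmorphB rmorph1 mulN1r.
  rewrite int01D ?int01Z ?int01_cst ?mulN1r//; [exact: ucont_id|exact: ucont_cst|].
  by apply: ucontZ; exact: ucont_id.
have h2 : int01 (fun t => t%:C%C) * 2 = 1 by rewrite mulr_natr mulr2n {1}h subrK.
by rewrite -[LHS](mulfK (_ : 2 != 0)) ?h2 ?mul1r.
Qed.

End DyadicIntegral.

(** * Integrals along complex segments and Goursat's lemma *)

Section SegmentIntegral.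
Context {R : realType}.
Local Notation K := R[i].
Implicit Types (f g : K -> K) (a b c d z w : K) (e r t : R).

(** Heine-Cantor: compactness of [0, 1], in its near-covering form, makes one [d] serve all
    points. *)
Lemma heine (g : R -> K) :
  (forall t, 0 <= t <= 1 -> forall e, 0 < e -> exists2 d, 0 < d &
    forall s, 0 <= s <= 1 -> `|s - t| <= d -> na (g s - g t) <= e) -> ucont g.
Proof.
move=> H e e0.
have /compact_near_coveringP cpt := @segment_compact R 0 1.
pose P (d t : R) := 0 <= t <= 1 -> forall s, 0 <= s <= 1 -> `|s - t| <= d ->
  na (g s - g t) <= e.
have : \forall d \near 0^'+, `[0, 1]%classic `<=` P d.
  apply: cpt => t /=; rewrite in_itv /= => ht.
  have [|d d0 Hd] := H t ht (e / 2); first by lra.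
  (* Half of the radius at [t] is spent on moving the centre to [t'], the other half on moving from
     [t'] to [s]. *)
  exists (ball t (d / 2), [set x | x <= d / 2]) => /=.
    split; first by apply: nbhsx_ballx; lra.
    by apply: nbhs_right_le; lra.
  move=> [t' d'] /= [+ d'd] ht' s hs st; rewrite /ball /= => tt'.
  have h1 : na (g s - g t) <= e / 2.
    apply: Hd => //; have := ler_distD t' s t; rewrite (distrC t') => ?.
    by lra.
  have h2 : na (g t' - g t) <= e / 2.
    by apply: Hd => //; rewrite distrC; lra.
  by have := na_tri (g s) (g t) (g t'); rewrite (naBC (g t)); lra.
move=> [d /= d0 Hd]; exists (d / 2); first by lra.
move=> s t hs ht st; apply: (Hd (d / 2)) => //=; try lra.
by rewrite sub0r normrN gtr0_norm; lra.
Qed.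

(** Written without division, so that [h = 0] need not be excluded; [cderivP] identifies it with
    [is_derive]. *)
Definition cderiv f z d := forall e, 0 < e -> exists2 r, 0 < r &
  forall h, na h <= r -> na (f (z + h) - f z - d * h) <= e * na h.

Definition ccont f z := forall e, 0 < e -> exists2 r, 0 < r &
  forall h, na h <= r -> na (f (z + h) - f z) <= e.

Lemma cderiv_ccont f z d : cderiv f z d -> ccont f z.
Proof.
move=> H e e0; have [r r0 Hr] := H 1 ltr01.
have d0 := na_ge0 d.
exists (Num.min r (e / (1 + na d))); first by rewrite lt_min r0 divr_gt0//; lra.
move=> h; rewrite le_min => /andP[/Hr h1]; rewrite ler_pdivlMr; last by lra.
move=> h2; rewrite -[X in na X](subrK (d * h)).
rewrite (le_trans (naD _ _))// naM; move: h1 h2; rewrite mul1r.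
by move=> h1; rewrite mulrDr mulr1 => h2; rewrite (le_trans _ h2)// lerD// mulrC.
Qed.

Definition seg a b (t : R) : K := a + t%:C%C * (b - a).

Lemma segE a b s t : seg a b s - seg a b t = (s - t)%:C%C * (b - a).
Proof. by rewrite /seg rmorphB; ring. Qed.

Lemma ucont_seg f a b : (forall t, 0 <= t <= 1 -> ccont f (seg a b t)) ->
  ucont (fun t => f (seg a b t)).
Proof.
move=> H; apply: heine => t ht e e0; have [r r0 Hr] := H t ht e e0.
have b0 : 0 < na (b - a) + 1 by rewrite ltr_wpDl ?na_ge0.
exists (r / (na (b - a) + 1)); first by rewrite divr_gt0.
move=> s hs; rewrite ler_pdivlMr// => st.
have := Hr (seg a b s - seg a b t); rewrite [_ + (_ - _)]addrC subrK; apply.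
by rewrite segE naM naC (le_trans _ st)// ler_wpM2l// lerDl.
Qed.

Definition seg_int f a b : K := (b - a) * int01 (fun t => f (seg a b t)).

Lemma seg_int_rev f a b : seg_int f b a = - seg_int f a b.
Proof.
rewrite /seg_int -int01_rev -mulNr opprB; congr (_ * int01 _).
by apply/funext => t; congr f; rewrite /seg rmorphB rmorph1; ring.
Qed.

Lemma seg_int_half f a b : ucont (fun t => f (seg a b t)) ->
  seg_int f a b = seg_int f a ((a + b) / 2) + seg_int f ((a + b) / 2) b.
Proof.
move=> u; rewrite /seg_int int01_half//.
have half : (2^-1 : R)%:C%C = 2^-1 :> K by rewrite fmorphV rmorph_nat.
have -> : (fun t => f (seg a b (t / 2))) = (fun t => f (seg a ((a + b) / 2) t)).
  by apply/funext => t; congr f; rewrite /seg rmorphM /= half; field.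
have -> : (fun t => f (seg a b ((1 + t) / 2))) = (fun t => f (seg ((a + b) / 2) b t)).
  by apply/funext => t; congr f; rewrite /seg rmorphM rmorphD rmorph1 /= half; field.
by field.
Qed.

Lemma seg_int_bound f a b M : ucont (fun t => f (seg a b t)) ->
  (forall t, 0 <= t <= 1 -> na (f (seg a b t)) <= M) ->
  na (seg_int f a b) <= na (b - a) * M.
Proof.
move=> u H; rewrite /seg_int naM ler_wpM2l ?na_ge0// -[int01 _]subr0.
by apply: int01_bound => // t ht; rewrite subr0 H.
Qed.

Lemma seg_intD f g a b : ucont (fun t => f (seg a b t)) -> ucont (fun t => g (seg a b t)) ->
  seg_int (fun z => f z + g z) a b = seg_int f a b + seg_int g a b.
Proof. by move=> uf ug; rewrite /seg_int (int01D uf ug) mulrDr. Qed.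

Lemma seg_intZ f c a b : ucont (fun t => f (seg a b t)) ->
  seg_int (fun z => c * f z) a b = c * seg_int f a b.
Proof. by move=> uf; rewrite /seg_int (int01Z _ uf); ring. Qed.

Lemma ucont_affine a b c d : ucont (fun t => c + d * seg a b t).
Proof.
apply: ucontD; first exact: ucont_cst.
apply: ucontZ; apply: ucontD; first exact: ucont_cst.
by apply: (@eq_ucont _ (fun t => (b - a) * t%:C%C)) => [t _|]; rewrite 1?mulrC//; apply: ucontZ ucont_id.
Qed.

Lemma seg_int_affine c d a b :
  seg_int (fun z => c + d * z) a b = (b - a) * (c + d * ((a + b) / 2)).
Proof.
rewrite /seg_int; congr (_ * _).
have -> : (fun t => c + d * seg a b t) = (fun t => (c + d * a) + (d * (b - a)) * t%:C%C).
  by apply/funext => t; rewrite /seg; ring.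
rewrite int01D ?int01Z ?int01_cst ?int01_id; first by field.
- exact: ucont_id.
- exact: ucont_cst.
- by apply: ucontZ; exact: ucont_id.
Qed.

Definition tri_int f a b c : K := seg_int f a b + seg_int f b c + seg_int f c a.

Lemma tri_int_affine c d x y z : tri_int (fun z => c + d * z) x y z = 0.
Proof. by rewrite /tri_int !seg_int_affine; field. Qed.

(** The three inner sides are traversed once in each direction and cancel. *)
Lemma tri_int_subdivide f a b c : ucont (fun t => f (seg a b t)) ->
  ucont (fun t => f (seg b c t)) -> ucont (fun t => f (seg c a t)) ->
  tri_int f a b c = tri_int f a ((a + b) / 2) ((c + a) / 2) + tri_int f ((a + b) / 2) b ((b + c) / 2)
    + tri_int f ((c + a) / 2) ((b + c) / 2) c
    + tri_int f ((a + b) / 2) ((b + c) / 2) ((c + a) / 2).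
Proof.
move=> u1 u2 u3; rewrite /tri_int (seg_int_half u1) (seg_int_half u2) (seg_int_half u3).
rewrite (seg_int_rev f ((c + a) / 2) ((a + b) / 2)) (seg_int_rev f ((a + b) / 2) ((b + c) / 2)).
rewrite (seg_int_rev f ((b + c) / 2) ((c + a) / 2)).
by ring.
Qed.

Definition tri_perim a b c : R := na (b - a) + na (c - b) + na (a - c).

(** The explicit rate serves twice: for the shrinking triangles of [goursat] and for the iterates of
    [contraction_fixpoint]. *)
Lemma geometric_limit (u : nat -> K) (C : R) :
  (forall n, na (u n.+1 - u n) <= C * 2^-1 ^+ n) ->
  exists c, forall n, na (u n - c) <= 2 * C * 2^-1 ^+ n.
Proof.
move=> H; have C0 : 0 <= C by have := H 0%N; rewrite expr0 mulr1; apply: le_trans; exact: na_ge0.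
have Hk n k : na (u (n + k)%N - u n) <= 2 * C * (2^-1 ^+ n - 2^-1 ^+ (n + k)).
  elim: k => [|k IH]; first by rewrite addn0 !subrr na0 mulr0.
  rewrite addnS (le_trans (na_tri _ (u (n + k)%N) _))//.
  by have := H (n + k)%N; rewrite exprSr; lra.
have Hn n m : (n <= m)%N -> na (u m - u n) <= 2 * C * 2^-1 ^+ n.
  move=> nm; rewrite -(subnKC nm) (le_trans (Hk _ _))// ler_wpM2l//; first by lra.
  by rewrite gerBl exprn_ge0// invr_ge0.
have cau e : 0 < e -> exists N, forall n m, (N <= n)%N -> (N <= m)%N -> na (u n - u m) <= e.
  move=> e0; have [N hN] : exists N, 2^-1 ^+ N < e / (4 * C + 1).
    by apply: half_pow_lt; rewrite divr_gt0//; lra.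
  exists N => n m /Hn h1 /Hn h2.
  rewrite (le_trans (na_tri _ (u N) _))// (naBC (u N)).
  move: hN; rewrite ltr_pdivlMr; last by lra.
  have : 0 <= 2^-1 ^+ N :> R by rewrite exprn_ge0// invr_ge0.
  by nra.
have lim := complex_cauchy_approx cau.
set c := Complex _ _ in lim; exists c => n.
apply/ler_addgt0Pr => e /lim[N HN].
have := HN _ (leq_maxl N n); have := Hn _ _ (leq_maxr N n).
by have := na_tri (u n) (u (maxn N n)) c; rewrite (naBC (u n) (u _)); lra.
Qed.

Lemma na_seg_dist a b t w e : 0 <= t <= 1 -> na (a - w) <= e -> na (b - w) <= e ->
  na (seg a b t - w) <= e.
Proof.
move=> /andP[t0 t1] ha hb.
have -> : seg a b t - w = (1 - t)%:C%C * (a - w) + t%:C%C * (b - w).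
  by rewrite /seg rmorphB rmorph1; ring.
rewrite (le_trans (naD _ _))// !naM !naC !ger0_norm ?subr_ge0//.
by nra.
Qed.

Definition cclosed (S : K -> Prop) :=
  forall z, (forall e, 0 < e -> exists2 w, S w & na (w - z) <= e) -> S z.
Definition cconvex (S : K -> Prop) :=
  forall a b t, S a -> S b -> 0 <= t <= 1 -> S (seg a b t).

Lemma cconvex_mid S a b : cconvex S -> S a -> S b -> S ((a + b) / 2).
Proof.
move=> cS Sa Sb; have := @cS a b 2^-1 Sa Sb.
by rewrite /seg fmorphV rmorph_nat (_ : a + _ = (a + b) / 2); [apply; lra|field].
Qed.

Lemma goursat (S : K -> Prop) f a b c : cclosed S -> cconvex S ->
  (forall z, S z -> exists d, cderiv f z d) -> S a -> S b -> S c -> tri_int f a b c = 0.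
Proof.
move=> clS cvS hf Sa Sb Sc.
have uf x y : S x -> S y -> ucont (fun t => f (seg x y t)).
  by move=> Sx Sy; apply: ucont_seg => t ht; have [|d /cderiv_ccont//] := hf (seg x y t); apply: cvS.
apply/eqP/contraT => T0.
have nT0 : 0 < na (tri_int f a b c) by rewrite lt_def na_eq0 T0 na_ge0.
pose L (x : K * K * K) := tri_perim x.1.1 x.1.2 x.2.
have L_ge0 x : 0 <= L x by rewrite /L /tri_perim !addr_ge0 ?na_ge0.
pose TT (x : K * K * K) := tri_int f x.1.1 x.1.2 x.2.
(* Invariant of the subdivision: e L^2 < |T|. Halving the perimeter divides e L^2 by 4, while |T| is
   at most the sum of the moduli for the four subtriangles, so one of them inherits the strict
   inequality. *)
have [e e0 He] : exists2 e, 0 < e & e * L (a, b, c) ^+ 2 < na (TT (a, b, c)).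
  exists (na (tri_int f a b c) / (L (a, b, c) ^+ 2 + 1)).
    by rewrite divr_gt0// ltr_wpDl// sqr_ge0.
  rewrite mulrAC ltr_pdivrMr ?ltr_wpDl ?sqr_ge0// ltr_pM2l// ltrDl//.
pose P x := [/\ S x.1.1, S x.1.2, S x.2 & e * L x ^+ 2 < na (TT x)].
(* [choice] requires a successor for every triple; outside [P] the triple itself is returned. *)
have step x : exists y, P x -> [/\ P y, L y = L x / 2 & na (y.1.1 - x.1.1) <= L x].
  have [[Sx1 Sx2 Sx3 hx]|nP] := pselect (P x); last by exists x.
  case: x => -[x y] z /= in Sx1 Sx2 Sx3 hx *.
  have nh (u v : K) : na ((u - v) / 2) = na (u - v) / 2 by rewrite naM naV na_nat.
  have Lh (u v w u' v' w' : K) : v - u = (v' - u') / 2 -> w - v = (w' - v') / 2 ->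
      u - w = (u' - w') / 2 -> L (u, v, w) = L (u', v', w') / 2.
    by move=> h1 h2 h3; rewrite /L /tri_perim /= h1 h2 h3 !nh; field.
  have Lh' (u v w u' v' w' : K) : v - u = (u' - v') / 2 -> w - v = (v' - w') / 2 ->
      u - w = (w' - u') / 2 -> L (u, v, w) = L (u', v', w') / 2.
    move=> h1 h2 h3; rewrite /L /tri_perim /= h1 h2 h3 !nh.
    by rewrite (naBC u' v') (naBC v' w') (naBC w' u'); field.
  have xy := cconvex_mid cvS Sx1 Sx2; have yz := cconvex_mid cvS Sx2 Sx3.
  have zx := cconvex_mid cvS Sx3 Sx1.
  have L1 : L (x, (x + y) / 2, (z + x) / 2) = L (x, y, z) / 2 by apply: Lh; field.
  have L2 : L ((x + y) / 2, y, (y + z) / 2) = L (x, y, z) / 2 by apply: Lh; field.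
  have L3 : L ((z + x) / 2, (y + z) / 2, z) = L (x, y, z) / 2 by apply: Lh; field.
  (* The sides of the medial triangle are parallel to the original ones with opposite orientation,
     hence [Lh']. *)
  have L4 : L ((x + y) / 2, (y + z) / 2, (z + x) / 2) = L (x, y, z) / 2.
    have h : L ((x + y) / 2, (y + z) / 2, (z + x) / 2) = L (z, x, y) / 2 by apply: Lh'; field.
    by rewrite h /L /tri_perim /=; field.
  have d1 : na ((x + y) / 2 - x) <= L (x, y, z).
    rewrite (_ : _ - _ = (y - x) / 2); last by field.
    by rewrite nh /L /tri_perim /=; have := na_ge0 (y - x); have := na_ge0 (z - y);
       have := na_ge0 (x - z); lra.
  have d2 : na ((z + x) / 2 - x) <= L (x, y, z).
    rewrite (_ : _ - _ = (z - x) / 2); last by field.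
    by rewrite nh (naBC z x) /L /tri_perim /=; have := na_ge0 (y - x); have := na_ge0 (z - y);
       have := na_ge0 (x - z); lra.
  have [h|h1] := ltP (e * (L (x, y, z) / 2) ^+ 2) (na (TT (x, (x + y) / 2, (z + x) / 2))).
    by exists (x, (x + y) / 2, (z + x) / 2); split => //; rewrite ?subrr ?na0// -L1 in h *.
  have [h|h2] := ltP (e * (L (x, y, z) / 2) ^+ 2) (na (TT ((x + y) / 2, y, (y + z) / 2))).
    by exists ((x + y) / 2, y, (y + z) / 2); split => //; rewrite -L2 in h.
  have [h|h3] := ltP (e * (L (x, y, z) / 2) ^+ 2) (na (TT ((z + x) / 2, (y + z) / 2, z))).
    by exists ((z + x) / 2, (y + z) / 2, z); split => //; rewrite -L3 in h.
  have [h|h4] := ltP (e * (L (x, y, z) / 2) ^+ 2)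
                 (na (TT ((x + y) / 2, (y + z) / 2, (z + x) / 2))).
    by exists ((x + y) / 2, (y + z) / 2, (z + x) / 2); split => //; rewrite -L4 in h.
  exfalso; move: hx; rewrite /TT /= tri_int_subdivide; try exact: uf.
  rewrite /TT /= in h1 h2 h3 h4; set t1 := tri_int _ _ _ _ in h1 *.
  set t2 := tri_int _ _ _ _ in h2 *; set t3 := tri_int _ _ _ _ in h3 *; set t4 := tri_int _ _ _ _ in h4 *.
  have := naD (t1 + t2 + t3) t4; have := naD (t1 + t2) t3; have := naD t1 t2.
  move: h1 h2 h3 h4; rewrite expr_div_n; lra.
have [nx Hnx] := choice step.
pose u n := iter n nx (a, b, c).
have Pu n : P (u n) by elim: n => [|n /Hnx[]//]; split.
have Lu n : L (u n) = L (a, b, c) * 2^-1 ^+ n.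
  elim: n => [|n IH]; first by rewrite expr0 mulr1.
  by have [_ -> _] := Hnx _ (Pu n); rewrite IH exprSr mulrA.
have [p Hp] : exists p, forall n, na ((u n).1.1 - p) <= 2 * L (a, b, c) * 2^-1 ^+ n.
  by apply: geometric_limit => n; rewrite -Lu; have [] := Hnx _ (Pu n).
have Hp' n : na ((u n).1.1 - p) <= 2 * L (u n) by rewrite Lu mulrA.
have smallL e' : 0 < e' -> exists n, L (u n) <= e'.
  move=> e'0; have [|n hn] := @half_pow_lt R (e' / (L (a, b, c) + 1)).
    by rewrite divr_gt0// ltr_wpDl.
  exists n; rewrite Lu; move: hn; rewrite ltr_pdivlMr ?ltr_wpDl// => hn.
  by rewrite (le_trans _ (ltW hn))// mulrC ler_wpM2l ?exprn_ge0 ?invr_ge0// lerDl.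
have Sp : S p.
  apply: clS => e' e'0; have [|n hn] := smallL (e' / 2); first by lra.
  by exists (u n).1.1; [by case: (Pu n)|rewrite (le_trans (Hp' n))//; lra].
have [d Hd] := hf p Sp; have [|r r0 Hr] := Hd (e / 3); first by lra.
have [|n hn] := smallL (r / 3); first by lra.
have := Pu n; have := Hp' n; move: hn; case: (u n) => -[x y] z hn /= px [/= Sx Sy Sz].
(* The first-order expansion of [f] at the limit point is subtracted. Affine functions integrate to
   0, and within distance 3 L of [p] the rest is at most (e / 3) (3 L) = e L, so the integral is at
   most e L^2, against the invariant. *)
pose g w := f w + (- (f p - d * p) + (- d) * w).
have fg w : f w = (f p - d * p + d * w) + g w by rewrite /g; ring.
have ug v w : S v -> S w -> ucont (fun t => g (seg v w t)).
  by move=> Sv Sw; apply: ucontD; [exact: uf|exact: ucont_affine].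
have perim : L (x, y, z) = na (y - x) + na (z - y) + na (x - z) by [].
have py : na (y - p) <= 3 * L (x, y, z).
  by have := na_tri y x p; have := na_ge0 (z - y); have := na_ge0 (x - z); lra.
have pz : na (z - p) <= 3 * L (x, y, z).
  have := na_tri z x p; rewrite (naBC z x).
  by have := na_ge0 (z - y); have := na_ge0 (y - x); lra.
have {}px : na (x - p) <= 3 * L (x, y, z) by have := L_ge0 (x, y, z); lra.
have gb v w : S v -> S w -> na (v - p) <= 3 * L (x, y, z) -> na (w - p) <= 3 * L (x, y, z) ->
    na (seg_int g v w) <= na (w - v) * (e * L (x, y, z)).
  move=> Sv Sw pv pw; apply: seg_int_bound; first exact: ug.
  move=> t ht; have h := na_seg_dist ht pv pw.
  have := Hr (seg v w t - p); rewrite addrCA subrr addr0.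
  have -> : f (seg v w t) - f p - d * (seg v w t - p) = g (seg v w t) by rewrite /g; ring.
  have hr : na (seg v w t - p) <= r by lra.
  by move=> /(_ hr) h'; rewrite (le_trans h')// -mulrA ler_pM2l//; lra.
suff : na (tri_int f x y z) <= e * L (x, y, z) ^+ 2 by rewrite /TT /= in px *; lra.
have -> : tri_int f x y z = tri_int g x y z.
  have efg : f = fun w => (f p - d * p + d * w) + g w by apply/funext.
  have aux v w : S v -> S w -> seg_int f v w = seg_int (fun w => f p - d * p + d * w) v w + seg_int g v w.
    move=> Sv Sw; rewrite -seg_intD; [|exact: ucont_affine|exact: ug].
    by rewrite -efg.
  rewrite /tri_int !aux// -[RHS]add0r -(tri_int_affine (f p - d * p) d x y z) /tri_int; ring.
have := gb x y Sx Sy px py; have := gb y z Sy Sz py pz; have := gb z x Sz Sx pz px.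
rewrite /tri_int; have := naD (seg_int g x y + seg_int g y z) (seg_int g z x); have := naD (seg_int g x y) (seg_int g y z).
have -> : e * L (x, y, z) ^+ 2 = (na (y - x) + na (z - y) + na (x - z)) * (e * L (x, y, z)).
  by rewrite -perim; ring.
lra.
Qed.

End SegmentIntegral.

(** * Comparison of [cderiv] with the topological derivative on [Cl] *)

Section DeriveBridge.
Context {R : realType}.
Local Notation K := R[i].
Implicit Types (f g : Cl R -> Cl R) (z d : K) (e r : R).

Lemma pos_complex (e : K) : 0 < e -> exists2 r : R, 0 < r & e = r%:C%C.
Proof.
move=> e0; exists (complex.Re e); last by rewrite RRe_real// gtr0_real.
by rewrite -ltcR RRe_real// gtr0_real.
Qed.

Lemma posC (r : R) : (0 < r%:C%C :> K) = (0 < r).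
Proof. by rewrite -(ltcR 0 r). Qed.

Lemma leC (z : K) (r : R) : (`|z| <= r%:C%C) = (na z <= r).
Proof. by rewrite naE lecR. Qed.

Lemma ltC (z : K) (r : R) : (`|z| < r%:C%C) = (na z < r).
Proof. by rewrite naE ltcR. Qed.

(** Closed discs of real radius replace the open balls, whose radii lie in [R[i]]. *)
Lemma nbhs_naP z (P : set (Cl R)) :
  nbhs (z : Cl R) P <-> exists2 r, 0 < r & forall w, na (w - z) <= r -> P w.
Proof.
split=> [/nbhs_ballP[e /= /pos_complex[r r0 ->] H]|[r r0 H]].
  exists (r / 2); first by lra.
  by move=> w h; apply: H; rewrite /ball /= distrC ltC; lra.
apply/nbhs_ballP; exists r%:C%C; rewrite /= ?posC//.
by move=> w; rewrite /ball /= distrC ltC => /ltW; apply: H.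
Qed.

Lemma dnbhs_naP (P : set (Cl R)) :
  (0^' : set_system (Cl R)) P <-> exists2 r, 0 < r & forall w, na w <= r -> w != 0 -> P w.
Proof.
rewrite /dnbhs /within /=; split=> [/nbhs_naP[r r0 H]|[r r0 H]].
  by exists r => // w h w0; apply: H => //; rewrite subr0.
by apply/nbhs_naP; exists r => // w; rewrite subr0; apply: H.
Qed.

Lemma cderivE f z d h : h != 0 ->
  na (d - h^-1 *: (f (h *: (1 : Cl R) + z) - f z)) * na h = na (f (z + h) - f z - d * h).
Proof.
move=> h0; rewrite -naM naBC mulrBl /GRing.scale /= mulr1 (addrC h z).
by congr (na (_ - _)); rewrite mulrAC mulVf// mul1r.
Qed.

Lemma cderivP f z d : cderiv f z d <-> is_derive (z : Cl R) (1 : Cl R) f d.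
Proof.
split=> [H|[df <-] e e0].
  suff h : (fun h : (K : numFieldType) => h^-1 *: (f (h *: (1 : Cl R) + z) - f z)) @ 0^' --> (d : Cl R).
    by split; [exact: cvgP h|exact: cvg_lim h].
  apply/cvgrPdist_le => _ /pos_complex[e e0 ->].
  have [r r0 Hr] := H _ e0.
  apply/dnbhs_naP; exists r => // h hr h0; rewrite leC.
  rewrite -(ler_pM2r (_ : 0 < na h)); last by rewrite lt_def na_ge0 na_eq0 h0.
  by rewrite cderivE// Hr.
have /cvgrPdist_le /(_ e%:C%C) : (fun h : (K : numFieldType) => h^-1 *: (f (h *: (1 : Cl R) + z) - f z)) @ 0^' --> 'D_(1 : Cl R) f z by exact: df.
rewrite posC => /(_ e0)/dnbhs_naP[r r0 Hr]; exists r => // h hr.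
have [->|h0] := eqVneq h 0; first by rewrite addr0 mulr0 !subrr na0 mulr0.
have := Hr h hr h0; rewrite leC => h1.
by rewrite -cderivE// ler_wpM2r// na_ge0.
Qed.

Lemma cderiv_eq (f g : K -> K) z d d' : cderiv f z d -> (exists2 r, 0 < r & forall h, na h <= r -> g (z + h) = f (z + h)) ->
  d' = d -> cderiv g z d'.
Proof.
move=> H [r r0 fg] -> e e0; have [r1 r10 Hr] := H e e0.
exists (Num.min r r1); first by rewrite lt_min r0.
have fz : g z = f z by have := fg 0; rewrite na0 addr0; apply; exact: ltW.
by move=> h; rewrite le_min => /andP[h1 h2]; rewrite fg// fz Hr.
Qed.

Lemma cderivM (f g : K -> K) z d d' : cderiv f z d -> cderiv g z d' ->
  cderiv (fun w => f w * g w) z (d * g z + f z * d').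
Proof.
move=> hf hg; have {}hf := proj1 (cderivP f z d) hf; have {}hg := proj1 (cderivP g z d') hg.
set F : K -> K := fun w => f w * g w.
suff H : is_derive (z : Cl R) (1 : Cl R) (F : Cl R -> Cl R) (d * g z + f z * d' : K) by exact: (proj2 (cderivP F z (d * g z + f z * d')) H).
have := @is_deriveM _ (Cl R) f g z 1 d d' hf hg.
by rewrite /GRing.scale /= addrC (mulrC (g z)).
Qed.

Lemma cderivD (f g : K -> K) z d d' : cderiv f z d -> cderiv g z d' -> cderiv (fun w => f w + g w) z (d + d').
Proof.
move=> hf hg; have {}hf := proj1 (cderivP f z d) hf; have {}hg := proj1 (cderivP g z d') hg.
apply: (proj2 (cderivP (fun w => f w + g w) z _)).
Qed.

Lemma cderiv_cst (c : K) z : cderiv (fun=> c) z 0.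
Proof. by apply/cderivP; exact: is_derive_cst. Qed.

Lemma cderiv_id z : cderiv (fun w : K => w) z 1.
Proof. by apply/cderivP; exact: is_derive_id. Qed.

Lemma cderivV z : z != 0 -> exists d, cderiv (fun w : K => w^-1) z d.
Proof.
move=> z0; exists ('D_(1 : Cl R) (fun w : Cl R => w^-1) z); apply/cderivP; apply: derivableP.
by apply: derivableV => //; exact: derivable_id.
Qed.

End DeriveBridge.

(** * The kernel [f z / z^2] on triangles centred at 0 *)

Section CenteredTriangle.
Context {R : realType}.
Local Notation K := R[i].
Local Notation re := (@complex.Re R).
Local Notation im := (@complex.Im R).
Implicit Types (f g : K -> K) (z w : K) (l e r t M p q : R).

Lemma reD z w : re (z + w) = re z + re w. Proof. by case: z w => [? ?] []. Qed.
Lemma imD z w : im (z + w) = im z + im w. Proof. by case: z w => [? ?] []. Qed.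
Lemma reN z : re (- z) = - re z. Proof. by case: z. Qed.
Lemma imN z : im (- z) = - im z. Proof. by case: z. Qed.
Lemma reZ r z : re (r%:C%C * z) = r * re z.
Proof. by case: z => ? ? /=; rewrite mul0r subr0. Qed.
Lemma imZ r z : im (r%:C%C * z) = r * im z.
Proof. by case: z => ? ? /=; rewrite mul0r addr0. Qed.
Lemma halfC : 2^-1 = (2^-1 : R)%:C%C :> K. Proof. by rewrite fmorphV rmorph_nat. Qed.
Lemma re_half z : re (z / 2) = re z / 2.
Proof. by rewrite halfC mulrC reZ mulrC. Qed.
Lemma im_half z : im (z / 2) = im z / 2.
Proof. by rewrite halfC mulrC imZ mulrC. Qed.

(* Convex regions avoiding the pole at 0, to which Goursat's lemma still applies. *)
Definition half_disc p q d M z := d <= p * re z + q * im z /\ na z <= M.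

Lemma half_disc_closed p q d M : cclosed (half_disc p q d M).
Proof.
move=> z H; split; apply/ler_addgt0Pr => e e0.
  have c0 : 0 < `|p| + `|q| + 1 by rewrite ltr_wpDl// addr_ge0.
  have [|w [h _] wz] := H (e / (`|p| + `|q| + 1)); first by rewrite divr_gt0.
  have h1 : `|re (w - z)| * (`|p| + `|q| + 1) <= e.
    by rewrite -ler_pdivlMr// (le_trans (na_Re _)).
  have h2 : `|im (w - z)| * (`|p| + `|q| + 1) <= e.
    by rewrite -ler_pdivlMr// (le_trans (na_Im _)).
  have h3 : na (w - z) * (`|p| + `|q| + 1) <= e by rewrite -ler_pdivlMr.
  have a1 : `|p * re (w - z)| <= `|p| * na (w - z) by rewrite normrM ler_wpM2l ?na_Re.
  have a2 : `|q * im (w - z)| <= `|q| * na (w - z) by rewrite normrM ler_wpM2l ?na_Im.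
  move: a1 a2; rewrite !ler_norml reD imD reN imN => /andP[_ a1] /andP[_ a2].
  by have := na_ge0 (w - z); lra.
have [w [_ h] wz] := H e e0.
by have := na_tri z w 0; rewrite !subr0 naBC; lra.
Qed.

Lemma half_disc_convex p q d M : cconvex (half_disc p q d M).
Proof.
move=> a b t [ha na1] [hb nb1] ht; split; last first.
  by have := @na_seg_dist _ a b t 0 M ht; rewrite !subr0; apply.
by rewrite /seg !(reD, imD, reZ, imZ, reN, imN); move: ht ha hb => /andP[]; nra.
Qed.

Lemma half_disc_neq0 p q d M z : 0 < d -> half_disc p q d M z -> z != 0.
Proof.
by move=> d0 [h _]; apply: contraTneq h => ->; rewrite /= !mulr0 addr0 -ltNge.
Qed.

Definition tA l : K := Complex l 0.
Definition tB l : K := Complex 0 l.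
Definition tC l : K := Complex (- l) (- l).
(* The centroid is [0], so the medial triangle of [ctri_int f l] is the one of parameter [- l / 2]. *)
Definition ctri_int f l := tri_int f (tA l) (tB l) (tC l).

Lemma na_Complex (x y : R) : na (Complex x y) <= `|x| + `|y|.
Proof. exact: na_le_ReIm. Qed.

Lemma na_tA l : na (tA l) <= 2 * `|l|.
Proof. by rewrite (le_trans (na_Complex _ _))// normr0; have := normr_ge0 l; lra. Qed.
Lemma na_tB l : na (tB l) <= 2 * `|l|.
Proof. by rewrite (le_trans (na_Complex _ _))// normr0; have := normr_ge0 l; lra. Qed.
Lemma na_tC l : na (tC l) <= 2 * `|l|.
Proof. by rewrite (le_trans (na_Complex _ _))// !normrN; lra. Qed.

(** The sides lie on the lines x + y = l, - 2 x + y = l and x - 2 y = l. Multiplying by [l] gives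
    half-planes valid for both signs of [l]; negative values occur because the medial triangle has
    parameter [- l / 2]. *)
Lemma edgeAB l t : 0 <= t <= 1 -> half_disc l l (l ^+ 2) (2 * `|l|) (seg (tA l) (tB l) t).
Proof.
by apply: half_disc_convex; split; rewrite ?na_tA ?na_tB//= ?mulr0 ?addr0 ?add0r ?expr2.
Qed.
Lemma edgeBC l t : 0 <= t <= 1 ->
  half_disc (- 2 * l) l (l ^+ 2) (2 * `|l|) (seg (tB l) (tC l) t).
Proof. by apply: half_disc_convex; split; rewrite ?na_tC ?na_tB//=; nra. Qed.
Lemma edgeCA l t : 0 <= t <= 1 ->
  half_disc l (- 2 * l) (l ^+ 2) (2 * `|l|) (seg (tC l) (tA l) t).
Proof. by apply: half_disc_convex; split; rewrite ?na_tC ?na_tA//=; nra. Qed.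

Definition ucont_edges f l := [/\ ucont (fun t => f (seg (tA l) (tB l) t)),
  ucont (fun t => f (seg (tB l) (tC l) t)) & ucont (fun t => f (seg (tC l) (tA l) t))].

Lemma ucont_edges_cderiv f l : l != 0 ->
  (forall z, z != 0 -> na z <= 2 * `|l| -> exists d, cderiv f z d) -> ucont_edges f l.
Proof.
move=> l0 H; have l2 : 0 < l ^+ 2 by rewrite exprn_even_gt0//= l0.
have ctz p q z : half_disc p q (l ^+ 2) (2 * `|l|) z -> ccont f z.
  move=> h; have [|d /cderiv_ccont//] := H z (half_disc_neq0 l2 h).
  by case: h.
by split; apply: ucont_seg => t ht;
  [apply: ctz (edgeAB l ht)|apply: ctz (edgeBC l ht)|apply: ctz (edgeCA l ht)].
Qed.

(** Each corner triangle lies in the half-plane cut off by the line through its two midpoints, away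
    from 0. Goursat's lemma applies to it, and only the medial triangle remains. *)
Lemma ctri_int_medial f l : l != 0 ->
  (forall z, z != 0 -> na z <= 2 * `|l| -> exists d, cderiv f z d) ->
  ctri_int f l = ctri_int f (- (l / 2)).
Proof.
move=> l0 H; have l2 : 0 < l ^+ 2 by rewrite exprn_even_gt0//= l0.
have [u1 u2 u3] := ucont_edges_cderiv l0 H.
have corner p q a b c : half_disc p q (l ^+ 2 / 2) (2 * `|l|) a ->
   half_disc p q (l ^+ 2 / 2) (2 * `|l|) b ->
   half_disc p q (l ^+ 2 / 2) (2 * `|l|) c -> tri_int f a b c = 0.
  apply: goursat; [exact: half_disc_closed|exact: half_disc_convex|].
  by move=> z h; apply: H; [apply: half_disc_neq0 h; lra|case: h].
have mid x y : na x <= 2 * `|l| -> na y <= 2 * `|l| -> na ((x + y) / 2) <= 2 * `|l|.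
  by move=> hx hy; rewrite naM naV na_nat; have := naD x y; lra.
have [hA hB hC] := And3 (na_tA l) (na_tB l) (na_tC l).
rewrite /ctri_int tri_int_subdivide//.
rewrite (corner (2 * l) (- l)); last first.
- by split; [rewrite re_half im_half reD imD /=; nra|exact: mid].
- by split; [rewrite re_half im_half reD imD /=; nra|exact: mid].
- by split=> //=; nra.
rewrite (corner (- l) (2 * l)); last first.
- by split; [rewrite re_half im_half reD imD /=; nra|exact: mid].
- by split=> //=; nra.
- by split; [rewrite re_half im_half reD imD /=; nra|exact: mid].
rewrite (corner (- l) (- l)); last first.
- by split=> //=; nra.
- by split; [rewrite re_half im_half reD imD /=; nra|exact: mid].
- by split; [rewrite re_half im_half reD imD /=; nra|exact: mid].
have cE z (x y : R) : re z = x -> im z = y -> z = Complex x y by case: z => ? ? /= -> ->.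
have -> : (tA l + tB l) / 2 = tC (- (l / 2)).
  by apply: cE; rewrite ?(re_half, im_half, reD, imD) /=; field.
have -> : (tB l + tC l) / 2 = tA (- (l / 2)).
  by apply: cE; rewrite ?(re_half, im_half, reD, imD) /=; field.
have -> : (tC l + tA l) / 2 = tB (- (l / 2)).
  by apply: cE; rewrite ?(re_half, im_half, reD, imD) /=; field.
by rewrite /tri_int; ring.
Qed.

(** From l^2 <= (|p| + |q|) |z|. The bound 3 |l| covers the coefficients of all three sides, which
    thus stay at distance |l| / 3 from 0. *)
Lemma half_disc_lower p q l z : l != 0 -> `|p| + `|q| <= 3 * `|l| ->
  half_disc p q (l ^+ 2) (2 * `|l|) z -> `|l| / 3 <= na z.
Proof.
move=> l0 pq [h _]; have l1 : 0 < `|l| by rewrite normr_gt0.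
have h1 : p * re z <= `|p| * na z.
  by rewrite (le_trans (ler_norm _))// normrM ler_wpM2l// na_Re.
have h2 : q * im z <= `|q| * na z.
  by rewrite (le_trans (ler_norm _))// normrM ler_wpM2l// na_Im.
have : `|l| ^+ 2 <= 3 * `|l| * na z.
  have : (`|p| + `|q|) * na z <= 3 * `|l| * na z by rewrite ler_wpM2r// na_ge0.
  by rewrite real_normK ?num_real//; lra.
by rewrite expr2 mulrAC ler_pM2r//; lra.
Qed.

(** 8 = 2 + 3 + 3 adds the side lengths in units of |l|, each estimated by the moduli of its real
    and imaginary parts. *)
Lemma ctri_int_bound f l M : l != 0 -> ucont_edges f l ->
  (forall z, `|l| / 3 <= na z -> na z <= 2 * `|l| -> na (f z) <= M) ->
  na (ctri_int f l) <= 8 * `|l| * M.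
Proof.
move=> l0 [u1 u2 u3] H; have l1 : 0 < `|l| by rewrite normr_gt0.
have lowAB t : 0 <= t <= 1 -> `|l| / 3 <= na (seg (tA l) (tB l) t).
  by move=> /(edgeAB l); apply: half_disc_lower => //; lra.
have lowBC t : 0 <= t <= 1 -> `|l| / 3 <= na (seg (tB l) (tC l) t).
  by move=> /(edgeBC l); apply: half_disc_lower => //; rewrite normrM normrN (normr_nat _ 2); lra.
have lowCA t : 0 <= t <= 1 -> `|l| / 3 <= na (seg (tC l) (tA l) t).
  by move=> /(edgeCA l); apply: half_disc_lower => //; rewrite normrM normrN (normr_nat _ 2); lra.
have M0 : 0 <= M.
  have := H _ (lowAB 0 _) (edgeAB l _).2; rewrite lexx ler01 => /(_ isT isT).
  by apply: le_trans; exact: na_ge0.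
have e1 : na (seg_int f (tA l) (tB l)) <= 2 * `|l| * M.
  rewrite (le_trans (@seg_int_bound _ _ _ _ M _ _))//.
    by move=> t ht; apply: H; [exact: lowAB|case: (edgeAB l ht)].
  by rewrite ler_wpM2r// (le_trans (na_le_ReIm _))//= sub0r subr0 normrN; lra.
have e2 : na (seg_int f (tB l) (tC l)) <= 3 * `|l| * M.
  rewrite (le_trans (@seg_int_bound _ _ _ _ M _ _))//.
    by move=> t ht; apply: H; [exact: lowBC|case: (edgeBC l ht)].
  rewrite ler_wpM2r// (le_trans (na_le_ReIm _))//= subr0 -opprD !normrN.
  by have := ler_normD l l; lra.
have e3 : na (seg_int f (tC l) (tA l)) <= 3 * `|l| * M.
  rewrite (le_trans (@seg_int_bound _ _ _ _ M _ _))//.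
    by move=> t ht; apply: H; [exact: lowCA|case: (edgeCA l ht)].
  rewrite ler_wpM2r// (le_trans (na_le_ReIm _))//= opprK add0r.
  by have := ler_normD l l; lra.
rewrite /ctri_int /tri_int; have := naD (seg_int f (tA l) (tB l) + seg_int f (tB l) (tC l)) (seg_int f (tC l) (tA l)).
by have := naD (seg_int f (tA l) (tB l)) (seg_int f (tB l) (tC l)); lra.
Qed.

(** Passing to medial triangles shrinks the contour to 0 without changing the integral, while its
    length times the supremum of |f| tends to 0 as soon as f(z) = o(1 / |z|). *)
Lemma ctri_int_zero f l : l != 0 ->
  (forall z, z != 0 -> na z <= 2 * `|l| -> exists d, cderiv f z d) ->
  (forall e, 0 < e -> exists2 r, 0 < r & forall z, z != 0 -> na z <= r -> na (f z) * na z <= e) ->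
  ctri_int f l = 0.
Proof.
move=> l0 H small.
pose x n : R := iter n (fun l => - (l / 2)) l.
have x0 n : x n != 0.
  by elim: n => [//|n IH]; rewrite /x /= oppr_eq0 mulf_neq0// invr_eq0.
have nx n : `|x n| = `|l| * 2^-1 ^+ n.
  elim: n => [|n IH]; first by rewrite expr0 mulr1.
  by rewrite /x /= -/(x n) normrN normrM IH exprSr mulrA (@ger0_norm _ 2^-1).
have xle n : `|x n| <= `|l|.
  by rewrite nx ler_piMr//; apply: exprn_ile1; lra.
have Hn n z : z != 0 -> na z <= 2 * `|x n| -> exists d, cderiv f z d.
  by move=> z0 h; apply: H => //; have := xle n; lra.
have TCn n : ctri_int f l = ctri_int f (x n).
  by elim: n => [//|n ->]; rewrite (ctri_int_medial (x0 n) (@Hn n)).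
apply: na_small => e e0; have [|r r0 Hr] := small (e / 24); first by lra.
have [|n hn] := @half_pow_lt R (r / (2 * `|l|)).
  by rewrite divr_gt0// mulr_gt0// normr_gt0.
have xr : 2 * `|x n| <= r.
  move: hn; rewrite ltr_pdivlMr ?mulr_gt0 ?normr_gt0// => hn.
  by rewrite nx; lra.
have xn0 : 0 < `|x n| by rewrite normr_gt0.
(* On the contour |z| >= |x n| / 3, so the bound is 8 |x n| (e / 24) / (|x n| / 3) = e. *)
rewrite (TCn n) (le_trans (ctri_int_bound (x0 n) (ucont_edges_cderiv (x0 n) (@Hn n)) (M := e / 24 / (`|x n| / 3)) _))//.
  move=> z h1 h2; have z0 : 0 < na z by lra.
  have := Hr z; rewrite -na_eq0 gt_eqF// => /(_ isT (le_trans h2 xr)) h3.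
  rewrite ler_pdivlMr; last by lra.
  by rewrite (le_trans _ h3)// ler_wpM2l ?na_ge0.
by rewrite [leLHS](_ : _ = e)//; field; rewrite gt_eqF.
Qed.

Lemma int01_im_ge (g : R -> K) d : ucont g -> (forall t, 0 <= t <= 1 -> d <= im (g t)) ->
  d <= im (int01 g).
Proof.
move=> ug H; apply/ler_addgt0Pr => e e0.
have [N HN] := int01_approx ug e0.
have h : d <= im (midsum N g).
  elim: (N) g {ug HN} H => [|n IH] g H /=; first by apply: H; lra.
  rewrite im_half imD.
  have h1 : d <= im (midsum n (fun t => g (t / 2))) by apply: IH => t ht; apply: H; lra.
  have h2 : d <= im (midsum n (fun t => g ((1 + t) / 2))) by apply: IH => t ht; apply: H; lra.
  by lra.
have := HN N (leqnn N); have := na_Im (midsum N g - int01 g).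
by rewrite imD imN ler_norml => /andP[_ h1] h2; lra.
Qed.

(** This plays the part of 2 pi i. Its value is not computed: being nonzero is enough. *)
Definition c0 : K := ctri_int (fun z => z^-1) 1.

(** On a side of direction (u, v), the imaginary part of (b - a) / z is (v x - u y) / |z|^2. The
    numerator is constantly 1 and |z|^2 <= 2, so each side contributes at least 1/2. *)
Lemma c0_neq0 : c0 != 0.
Proof.
have hV z : z != 0 -> na z <= 2 * `|1 : R| -> exists d, cderiv (fun z => z^-1 : K) z d.
  by move=> /cderivV.
have [u1 u2 u3] := ucont_edges_cderiv (oner_neq0 R) hV.
have key a b : ucont (fun t => (seg a b t)^-1) ->
   (forall t, 0 <= t <= 1 -> 2^-1 <= im ((b - a) * (seg a b t)^-1)) ->
   2^-1 <= im (seg_int (fun z => z^-1) a b).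
  move=> u H; rewrite /seg_int -int01Z//; apply: int01_im_ge => //.
  exact: ucontZ.
have quot (x y u v : R) : im (Complex u v * (Complex x y)^-1) = (v * x - u * y) / (x ^+ 2 + y ^+ 2).
  by rewrite /=; ring.
have quot_ge (x y u v : R) : v * x - u * y = 1 -> x ^+ 2 + y ^+ 2 <= 2 ->
    2^-1 <= im (Complex u v * (Complex x y)^-1).
  move=> h1 h2; rewrite quot h1 div1r lef_pV2 ?posrE//.
  rewrite lt_def addr_ge0 ?sqr_ge0// andbT; apply/eqP => h3.
  have /eqP : x ^+ 2 = 0 by have := sqr_ge0 x; have := sqr_ge0 y; lra.
  have /eqP : y ^+ 2 = 0 by have := sqr_ge0 x; have := sqr_ge0 y; lra.
  rewrite !sqrf_eq0 => /eqP y0 /eqP x0; move: h1; rewrite x0 y0; lra.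
have cE (z : K) (x y : R) : re z = x -> im z = y -> z = Complex x y by case: z => ? ? /= -> ->.
have h1 : 2^-1 <= im (seg_int (fun z => z^-1) (tA 1) (tB 1)).
  apply: key => // t ht.
  rewrite (@cE (seg _ _ t) (1 - t) t); [|rewrite /seg /=; ring..].
  by rewrite (@cE (tB 1 - _) (-1) 1) /=; [apply: quot_ge; nra|ring..].
have h2 : 2^-1 <= im (seg_int (fun z => z^-1) (tB 1) (tC 1)).
  apply: key => // t ht.
  rewrite (@cE (seg _ _ t) (- t) (1 - 2 * t)); [|rewrite /seg /=; ring..].
  by rewrite (@cE (tC 1 - _) (-1) (-2)) /=; [apply: quot_ge; nra|ring..].
have h3 : 2^-1 <= im (seg_int (fun z => z^-1) (tC 1) (tA 1)).
  apply: key => // t ht.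
  rewrite (@cE (seg _ _ t) (-1 + 2 * t) (-1 + t)); [|rewrite /seg /=; ring..].
  by rewrite (@cE (tA 1 - _) 2 1) /=; [apply: quot_ge; nra|ring..].
have : 0 < im c0 by rewrite /c0 /ctri_int /tri_int !imD; lra.
by apply: contraTneq => ->; rewrite /= ltxx.
Qed.

Lemma seg_scale (c a b : K) t : seg (c * a) (c * b) t = c * seg a b t.
Proof. by rewrite /seg; ring. Qed.

Lemma seg_int_scale f (c a b : K) : seg_int f (c * a) (c * b) = c * seg_int (fun z => f (c * z)) a b.
Proof.
rewrite /seg_int -mulrBr -mulrA; congr (_ * (_ * int01 _)).
by apply/funext => t; rewrite seg_scale.
Qed.

Lemma ctri_int_scale f l r : ctri_int f (l * r) = l%:C%C * ctri_int (fun z => f (l%:C%C * z)) r.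
Proof.
have -> : ctri_int f (l * r) = tri_int f (l%:C%C * tA r) (l%:C%C * tB r) (l%:C%C * tC r).
  by rewrite /ctri_int; congr tri_int; apply/eqP; rewrite eq_complex /=; apply/andP; split; apply/eqP; ring.
by rewrite /ctri_int /tri_int !seg_int_scale !mulrDr.
Qed.

Lemma realC_neq0 l : l != 0 -> l%:C%C != 0 :> K.
Proof. by move=> l0; rewrite (inj_eq (@complexI _) l 0). Qed.

Lemma ctri_intD f g l : ucont_edges f l -> ucont_edges g l ->
  ctri_int (fun z => f z + g z) l = ctri_int f l + ctri_int g l.
Proof. by move=> [? ? ?] [? ? ?]; rewrite /ctri_int /tri_int !seg_intD//; ring. Qed.

Lemma ctri_intZ (c : K) f l : ucont_edges f l -> ctri_int (fun z => c * f z) l = c * ctri_int f l.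
Proof. by move=> [? ? ?]; rewrite /ctri_int /tri_int !seg_intZ//; ring. Qed.

Lemma ucont_edgesD f g l : ucont_edges f l -> ucont_edges g l -> ucont_edges (fun z => f z + g z) l.
Proof. by move=> [? ? ?] [? ? ?]; split; exact: ucontD. Qed.

Lemma ucont_edgesZ (c : K) f l : ucont_edges f l -> ucont_edges (fun z => c * f z) l.
Proof. by move=> [? ? ?]; split; exact: ucontZ. Qed.

Lemma cderiv_invsqr z : z != 0 -> exists d, cderiv (fun z => z^-1 * z^-1 : K) z d.
Proof. by move=> /cderivV[d hz]; eexists; exact: (cderivM hz hz). Qed.

Lemma ucont_edges_inv l : l != 0 -> ucont_edges (fun z => z^-1) l.
Proof. by move=> l0; apply: ucont_edges_cderiv => // z /cderivV. Qed.

Lemma ucont_edges_invsqr l : l != 0 -> ucont_edges (fun z => z^-1 * z^-1) l.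
Proof. by move=> l0; apply: ucont_edges_cderiv => // z /cderiv_invsqr. Qed.

Lemma ctri_int_inv l : l != 0 -> ctri_int (fun z => z^-1) l = c0.
Proof.
move=> l0; rewrite -[l]mulr1 ctri_int_scale.
have -> : (fun z => (l%:C%C * z)^-1) = (fun z => (l%:C%C)^-1 * z^-1).
  by apply/funext => z; rewrite invfM.
rewrite ctri_intZ; last by apply: ucont_edges_inv; rewrite oner_neq0.
by rewrite mulrA mulfV ?realC_neq0// mul1r.
Qed.

(** This kernel is not o(1 / |z|), so [ctri_int_zero] does not apply. Scaling by -1/2 multiplies the
    integral X by (-1/2) 4 = -2, whereas passing to the medial triangle preserves it: X = -2 X. *)
Lemma ctri_int_invsqr l : l != 0 -> ctri_int (fun z => z^-1 * z^-1) l = 0.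
Proof.
move=> l0; set X := ctri_int _ _.
have h : X = - 2 * X.
  rewrite {1}/X ctri_int_medial//; last by move=> z /cderiv_invsqr.
  have -> : - (l / 2) = (- 2^-1) * l by ring.
  rewrite ctri_int_scale.
  have -> : (fun z => ((- 2^-1 : R)%:C%C * z)^-1 * ((- 2^-1 : R)%:C%C * z)^-1) =
            (fun z => 4 * (z^-1 * z^-1)) :> (K -> K).
    by apply/funext => z; rewrite invfM rmorphN /= -halfC invrN invrK; ring.
  rewrite ctri_intZ; last exact: ucont_edges_invsqr.
  by rewrite -/X rmorphN /= -halfC; field.
have : 3 * X = 0 by have := subrr X; rewrite {2}h => <-; ring.
by move/eqP; rewrite mulf_eq0 pnatr_eq0 /= => /eqP.
Qed.

(** Subtracting f(0) / z^2 and d / z leaves (f(z) - f(0) - d z) / z^2 = o(1 / |z|), whose integral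
    is 0. The subtracted terms integrate to 0 and to d c0. *)
Lemma derivative_formula f l d : l != 0 ->
  (forall z, na z <= 2 * `|l| -> exists d, cderiv f z d) -> cderiv f 0 d ->
  ctri_int (fun z => f z * (z^-1 * z^-1)) l = d * c0.
Proof.
move=> l0 H H0.
have h1 z : z != 0 -> na z <= 2 * `|l| -> exists d, cderiv (fun z => f z * (z^-1 * z^-1)) z d.
  by move=> /cderiv_invsqr[d1 hd1] /H[d2 hd2]; eexists; exact: (cderivM hd2 hd1).
have u1 := ucont_edges_cderiv l0 h1.
pose phi z := f z * (z^-1 * z^-1) + ((- f 0) * (z^-1 * z^-1) + (- d) * z^-1).
have u2 : ucont_edges (fun z => (- f 0) * (z^-1 * z^-1)) l.
  by apply: ucont_edgesZ; exact: ucont_edges_invsqr.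
have u3 : ucont_edges (fun z => (- d) * z^-1) l by apply: ucont_edgesZ; exact: ucont_edges_inv.
have : ctri_int phi l = 0.
  apply: ctri_int_zero => //.
    move=> z z0 hz; have [d1 hd1] := h1 z z0 hz.
    have [d2 hd2] := cderiv_invsqr z0; have [d3 hd3] := cderivV z0.
    by eexists; exact: (cderivD hd1 (cderivD (cderivM (cderiv_cst _ _) hd2) (cderivM (cderiv_cst _ _) hd3))).
  move=> e e0; have [r r0 Hr] := H0 e e0; exists r => // z z0 hz.
  have nz0 : 0 < na z by rewrite lt_def na_eq0 z0 na_ge0.
  have := Hr z hz; rewrite add0r.
  have -> : f z - f 0 - d * z = phi z * z * z by rewrite /phi; field.
  by rewrite !naM ler_pM2r.
rewrite /phi ctri_intD// ?ctri_intD//; last exact: ucont_edgesD.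
rewrite !ctri_intZ ?ctri_int_invsqr ?ctri_int_inv//; [|exact: ucont_edges_inv|exact: ucont_edges_invsqr].
rewrite mulr0 add0r mulNr => /eqP; rewrite subr_eq0 => /eqP ->; ring.
Qed.

End CenteredTriangle.

(** * Norm, gradients and partial derivatives on [C3] *)

Section ThreeSpace.
Context {R : realType}.
Local Notation K := R[i].
Local Notation V := (C3 R).
Implicit Types (u v h p q : V) (f g : V -> K) (e r : R) (a b : 'I_3 -> K).

Definition nv (v : V) : R := complex.Re `|v|.

Lemma nvE v : `|v| = (nv v)%:C%C.
Proof. by rewrite /nv RRe_real // ger0_real. Qed.

Lemma nv_ge0 v : 0 <= nv v.
Proof. by rewrite -ler0c -nvE normr_ge0. Qed.

Lemma nv0 : nv 0 = 0. Proof. by rewrite /nv normr0. Qed.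

Lemma nvD u v : nv (u + v) <= nv u + nv v.
Proof. by rewrite -lecR rmorphD /= -!nvE ler_normD. Qed.

Lemma nvN v : nv (- v) = nv v. Proof. by rewrite /nv normrN. Qed.

Lemma nvBC u v : nv (u - v) = nv (v - u).
Proof. by rewrite -nvN opprB. Qed.

Lemma nv_tri u v w : nv (u - w) <= nv (u - v) + nv (v - w).
Proof. by rewrite (le_trans _ (nvD _ _))// addrA subrK. Qed.

Lemma nvZ (c : K) v : nv (c *: v) = na c * nv v.
Proof. by apply: complexI; rewrite rmorphM /= -!nvE -naE normrZ. Qed.

(** The norm is compared with the coordinates through its balls, which are products of discs. *)
Lemma nv_lt v e : 0 < e -> nv v < e <-> forall i, na (v ord0 i) < e.
Proof.
move=> e0; rewrite -ltcR -nvE.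
have -> : (`|v| < e%:C%C) = `[< ball (0 : V) e%:C%C v >].
  by apply/idP/asboolP; rewrite -ball_normE /ball_ /= sub0r normrN.
split=> [/asboolP[_ H] i|H]; last apply/asboolP; last split.
- by have := H ord0 i; rewrite -ball_normE /ball_ /= mxE sub0r normrN ltC.
- by rewrite posC.
- move=> i j; rewrite (ord1 i) -ball_normE /ball_ /= mxE sub0r normrN ltC; exact: H.
Qed.

Lemma nv_coord v i : na (v ord0 i) <= nv v.
Proof.
apply/ler_addgt0Pr => e e0; apply: ltW.
by apply: (proj1 (@nv_lt v (nv v + e) _) _ i); have := nv_ge0 v; lra.
Qed.

Lemma nv_le v e : 0 <= e -> (forall i, na (v ord0 i) <= e) -> nv v <= e.
Proof.
move=> e0 H; apply/ler_addgt0Pr => e' e'0; apply: ltW.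
apply: (proj2 (@nv_lt v (e + e') _) _); first by lra.
by move=> i; have := H i; lra.
Qed.

Lemma nbhs_nvP p (P : set V) :
  nbhs p P <-> exists2 r, 0 < r & forall q, nv (q - p) <= r -> P q.
Proof.
split=> [/nbhs_ballP[e /= /pos_complex[r r0 ->] H]|[r r0 H]].
  exists (r / 2); first by lra.
  move=> w h; apply: H; rewrite -ball_normE /ball_ /= distrC nvE ltcR; lra.
apply/nbhs_ballP; exists r%:C%C; rewrite /= ?posC//.
by move=> w; rewrite -ball_normE /ball_ /= distrC nvE ltcR => /ltW; apply: H.
Qed.

Definition lin3 a v : K := \sum_i a i * v ord0 i.

Lemma lin3_linear a : linear (lin3 a : V -> Cl R).
Proof.
move=> c u v; rewrite /lin3 /GRing.scale /= mulr_sumr -big_split /=.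
by apply: eq_bigr => i _; rewrite !mxE; ring.
Qed.

HB.instance Definition _ a := GRing.isLinear.Build K V (Cl R) _ (lin3 a) (lin3_linear a).

Lemma na_sum n (F : 'I_n -> K) : na (\sum_i F i) <= \sum_i na (F i).
Proof.
elim/big_ind2: _ => [|x x' y y' h1 h2|//]; first by rewrite na0.
by rewrite (le_trans (naD _ _))// lerD.
Qed.

Lemma lin3_bound a v : na (lin3 a v) <= (\sum_i na (a i)) * nv v.
Proof.
rewrite (le_trans (na_sum _))// mulr_suml ler_sum// => i _.
by rewrite naM ler_wpM2l ?na_ge0 ?nv_coord.
Qed.

Lemma lin3_continuous a : continuous (lin3 a : V -> Cl R).
Proof.
move=> p; apply/(@cvgrPdist_le _ _ _ (nbhs (p : V)) (nbhs_filter p)) => _ /pos_complex[e e0 ->].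
have c0 : 0 < \sum_i na (a i) + 1 by rewrite ltr_wpDl// sumr_ge0// => i _; exact: na_ge0.
apply/nbhs_nvP; exists (e / (\sum_i na (a i) + 1)); first by rewrite divr_gt0.
move=> q; rewrite ler_pdivlMr// => h; rewrite leC -[lin3 a p - _]raddfB /=.
rewrite (le_trans (lin3_bound _ _))// (le_trans _ h)// mulrC nvBC ler_wpM2l ?nv_ge0//; lra.
Qed.

(** A first-order expansion with an explicit gradient. [hgrad_diff] and [diff_hgrad] pass to and
    from the differential used in the statement. *)
Definition hgrad f q a := forall e, 0 < e -> exists2 r, 0 < r &
  forall h, nv h <= r -> na (f (q + h) - f q - lin3 a h) <= e * nv h.

Lemma hgrad_locally f q a : hgrad f q a ->
  (f : V -> Cl R) \o shift q = cst (f q : Cl R) + (lin3 a : V -> Cl R) +o_ 0 id.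
Proof.
move=> H; apply/eqaddoP => _ /pos_complex[e e0 ->].
have [r r0 Hr] := H e e0; apply/nbhs_nvP; exists r => // h; rewrite subr0 => /Hr.
rewrite nvE -rmorphM /= leC.
by rewrite /cst /= !fctE /= opprD addrA (addrC h q).
Qed.

Lemma hgrad_diff f q a : hgrad f q a -> is_diff q (f : V -> Cl R) (lin3 a : V -> Cl R).
Proof.
move=> /hgrad_locally H.
have h : 'd (f : V -> Cl R) q = (lin3 a : V -> Cl R) :> (V -> Cl R) by apply: diff_unique => //; exact: lin3_continuous.
apply: DiffDef => //; apply/diff_locallyP; split; last by rewrite h.
by rewrite h; exact: lin3_continuous.
Qed.

Definition ej (j : 'I_3) : V := delta_mx ord0 j.
Definition pd (j : 'I_3) f q : K := 'd (f : V -> Cl R) q (ej j).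
Definition dfr f q := differentiable (f : V -> Cl R) q.

Lemma lin3_ej a j : lin3 a (ej j) = a j.
Proof.
rewrite /lin3 (bigD1 j)//= big1 ?addr0; first by rewrite mxE !eqxx mulr1.
by move=> i ij; rewrite mxE eqxx (negbTE ij) mulr0.
Qed.

Lemma V_sum v : v = \sum_j v ord0 j *: ej j.
Proof. exact: row_sum_delta. Qed.

Lemma nv_ej j : nv (ej j) <= 1.
Proof.
by apply: nv_le => // i; rewrite mxE eqxx /=; case: eqP; rewrite ?na0 ?na1.
Qed.

Lemma hgrad_pd f q a j : hgrad f q a -> pd j f q = a j.
Proof. by move=> /hgrad_diff H; rewrite /pd diff_val lin3_ej. Qed.

Lemma diff_lin3 f q h : dfr f q -> 'd (f : V -> Cl R) q h = lin3 (fun j => pd j f q) h.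
Proof.
move=> df; rewrite {1}(V_sum h) linear_sum; apply: eq_bigr => j _ /=.
by rewrite linearZ /= /GRing.scale /= mulrC.
Qed.

Lemma hgrad_dfr f q a : hgrad f q a -> dfr f q.
Proof. by move=> /hgrad_diff H; exact: (@ex_diff _ _ _ _ _ _ _ H). Qed.

Lemma diff_hgrad f q : dfr f q -> hgrad f q (fun j => pd j f q).
Proof.
move=> df e e0; have /diff_locally/eqaddoP := df.
move=> /(_ e%:C%C); rewrite posC => /(_ e0)/nbhs_nvP[r r0 Hr]; exists r => // h hr.
have := Hr h; rewrite subr0 => /(_ hr).
by rewrite nvE -rmorphM /= leC /cst /= !fctE /= opprD addrA (addrC h q) diff_lin3.
Qed.

Lemma hgrad_line f q v (s : K) a : hgrad f (q + s *: v) a ->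
  cderiv (fun z => f (q + z *: v)) s (lin3 a v).
Proof.
move=> H e e0; have c0 : 0 < nv v + 1 by rewrite ltr_wpDl ?nv_ge0.
have [|r r0 Hr] := H (e / (nv v + 1)); first by rewrite divr_gt0.
exists (r / (nv v + 1)); first by rewrite divr_gt0.
move=> h; rewrite ler_pdivlMr// => hr.
have hv : nv (h *: v) <= na h * (nv v + 1) by rewrite nvZ ler_wpM2l ?na_ge0//; lra.
have := Hr (h *: v) (le_trans hv hr).
have -> : q + (s + h) *: v = q + s *: v + h *: v by rewrite scalerDl addrA.
rewrite (_ : lin3 a (h *: v) = lin3 a v * h); last first.
  by rewrite linearZ /= /GRing.scale /= mulrC.
move=> /le_trans; apply; rewrite mulrAC ler_pdivrMr//.
by rewrite -mulrA ler_wpM2l ?(ltW e0).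
Qed.

Lemma hgrad_ccont f q v (s : K) a : hgrad f (q + s *: v) a -> ccont (fun z => f (q + z *: v)) s.
Proof. by move=> /hgrad_line/cderiv_ccont. Qed.

Lemma dfr_ctn f q : dfr f q -> forall e, 0 < e ->
  exists2 r, 0 < r & forall p, nv (p - q) <= r -> na (f p - f q) <= e.
Proof.
move=> /differentiable_continuous/cvgrPdist_le H e e0.
have := H e%:C%C; rewrite posC => /(_ e0)/nbhs_nvP[r r0 Hr]; exists r => // p /Hr.
by rewrite leC naBC.
Qed.

End ThreeSpace.

(** * Rules for gradients *)

Section GradientCalculus.
Context {R : realType}.
Local Notation K := R[i].
Local Notation V := (C3 R).
Implicit Types (u v h p q : V) (f g : V -> K) (e r : R) (a b : 'I_3 -> K) (c : K).

Lemma lin3D a b v : lin3 (fun j => a j + b j) v = lin3 a v + lin3 b v.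
Proof. by rewrite /lin3 -big_split; apply: eq_bigr => j _; rewrite mulrDl. Qed.

Lemma lin3Z c a v : lin3 (fun j => c * a j) v = c * lin3 a v.
Proof. by rewrite /lin3 mulr_sumr; apply: eq_bigr => j _; rewrite mulrA. Qed.

(** A fixed factor in the error is absorbed by rescaling [e], which lets the rules below be proved
    up to a constant. *)
Lemma hgrad_C f q a (C : R) : (forall e, 0 < e -> exists2 r, 0 < r &
  forall h, nv h <= r -> na (f (q + h) - f q - lin3 a h) <= C * (e * nv h)) -> hgrad f q a.
Proof.
move=> H e e0; have C0 : 0 < `|C| + 1 by rewrite ltr_wpDl.
have [|r r0 Hr] := H (e / (`|C| + 1)); first by rewrite divr_gt0.
exists r => // h /Hr/le_trans; apply.
have h0 := nv_ge0 h; rewrite [leLHS](_ : _ = C / (`|C| + 1) * (e * nv h)); last by ring.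
rewrite ler_piMl ?mulr_ge0 ?(ltW e0)// ler_pdivrMr// mul1r.
by have := ler_norm C; lra.
Qed.

Lemma hgrad_lip f q a : hgrad f q a -> exists L, 0 < L /\ exists2 r, 0 < r &
  forall h, nv h <= r -> na (f (q + h) - f q) <= L * nv h.
Proof.
move=> /(_ 1 ltr01)[r r0 Hr]; exists (\sum_j na (a j) + 1); split.
  by rewrite ltr_wpDl// sumr_ge0// => j _; exact: na_ge0.
exists r => // h /Hr; rewrite mul1r => h1.
have := naD (f (q + h) - f q - lin3 a h) (lin3 a h); rewrite subrK.
by have := lin3_bound a h; rewrite mulrDl mul1r; lra.
Qed.

Lemma hgradD f g q a b : hgrad f q a -> hgrad g q b ->
  hgrad (fun x => f x + g x) q (fun j => a j + b j).
Proof.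
move=> Hf Hg; apply: (@hgrad_C _ _ _ 2) => e e0.
have [r r0 Hr] := Hf e e0; have [r' r'0 Hr'] := Hg e e0.
exists (Num.min r r'); first by rewrite lt_min r0.
move=> h; rewrite le_min => /andP[/Hr h1 /Hr' h2]; rewrite lin3D.
rewrite (_ : _ - _ - _ = (f (q + h) - f q - lin3 a h) + (g (q + h) - g q - lin3 b h)); last by ring.
by rewrite (le_trans (naD _ _))//; lra.
Qed.

Lemma hgrad_cst c q : hgrad (fun=> c) q (fun=> 0).
Proof.
move=> e e0; exists 1 => // h _; rewrite /lin3 big1 ?subrr ?subr0 ?na0 ?mulr_ge0 ?nv_ge0 ?ltW//.
by move=> i _; rewrite mul0r.
Qed.

Lemma hgradM f g q a b : hgrad f q a -> hgrad g q b ->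
  hgrad (fun x => f x * g x) q (fun j => f q * b j + g q * a j).
Proof.
move=> Hf Hg; have [L [L0 [s s0 Hs]]] := hgrad_lip Hf.
have [L' [L'0 [s' s'0 Hs']]] := hgrad_lip Hg.
apply: (@hgrad_C _ _ _ (na (f q) + na (g q) + L)) => e e0.
have [r r0 Hr] := Hf e e0; have [r' r'0 Hr'] := Hg e e0.
exists (Num.min (Num.min r r') (Num.min (Num.min s s') (e / L'))).
  by rewrite !lt_min r0 r'0 s0 s'0 divr_gt0.
move=> h; rewrite !le_min => /andP[/andP[/Hr h1 /Hr' h2] /andP[/andP[/Hs h3 /Hs' h4]]].
rewrite ler_pdivlMr// => h5; rewrite lin3D !lin3Z.
set F := f (q + h) - f q in h1 h3 *; set G := g (q + h) - g q in h2 h4 *.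
have -> : f (q + h) * g (q + h) - f q * g q - (f q * lin3 b h + g q * lin3 a h) =
  f q * (G - lin3 b h) + g q * (F - lin3 a h) + F * G by rewrite /F /G; ring.
have n0 := nv_ge0 h.
have i1 : na (f q) * na (G - lin3 b h) <= na (f q) * (e * nv h) by rewrite ler_wpM2l ?na_ge0.
have i2 : na (g q) * na (F - lin3 a h) <= na (g q) * (e * nv h) by rewrite ler_wpM2l ?na_ge0.
have i3 : na F * na G <= L * (e * nv h).
  have -> : L * (e * nv h) = (L * nv h) * e by ring.
  by rewrite ler_pM ?na_ge0// (le_trans h4)// mulrC.
rewrite (le_trans (naD _ _))// (le_trans (lerD (naD _ _) (lexx _)))//.
by rewrite !naM !mulrDl !lerD.
Qed.

Lemma hgradZ c f q a : hgrad f q a -> hgrad (fun x => c * f x) q (fun j => c * a j).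
Proof.
move=> H; have := hgradM (hgrad_cst c q) H.
by congr hgrad; apply/funext => j; rewrite mulr0 addr0.
Qed.

Lemma hgradB f g q a b : hgrad f q a -> hgrad g q b ->
  hgrad (fun x => f x - g x) q (fun j => a j - b j).
Proof.
move=> Hf /(hgradZ (-1)) Hg; have := hgradD Hf Hg.
have -> : (fun x => f x + -1 * g x) = (fun x => f x - g x).
  by apply/funext => x; rewrite mulN1r.
by have -> : (fun j => a j + -1 * b j) = (fun j => a j - b j) by apply/funext => x; rewrite mulN1r.
Qed.

Lemma hgrad_cderiv (F : K -> K) f q a c : cderiv F (f q) c -> hgrad f q a ->
  hgrad (fun x => F (f x)) q (fun j => c * a j).
Proof.
move=> HF Hf; have [L [L0 [s s0 Hs]]] := hgrad_lip Hf.
apply: (@hgrad_C _ _ _ (L + na c)) => e e0.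
have [r r0 Hr] := HF e e0; have [r' r'0 Hr'] := Hf e e0.
exists (Num.min r' (Num.min s (r / L))); first by rewrite !lt_min r'0 s0 divr_gt0.
move=> h; rewrite !le_min => /andP[/Hr' h1 /andP[/Hs h2]].
rewrite ler_pdivlMr// => h3; rewrite lin3Z.
set D := f (q + h) - f q in h1 h2 *.
have := Hr D; rewrite {1}(_ : f q + D = f (q + h)); last by rewrite /D; ring.
have hD : na D <= r by rewrite (le_trans h2)// mulrC.
move=> /(_ hD) h4.
rewrite (_ : _ - _ - _ = (F (f (q + h)) - F (f q) - c * D) + c * (D - lin3 a h)); last by ring.
rewrite (le_trans (naD _ _))// mulrDl lerD//; last by rewrite naM ler_wpM2l ?na_ge0.
by rewrite (le_trans h4)// mulrCA ler_wpM2l// ltW.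
Qed.

Lemma hgrad_coord j q : hgrad (fun x => x ord0 j) q (fun k => (k == j)%:R).
Proof.
move=> e e0; exists 1 => // h _; rewrite mxE /lin3 (bigD1 j)//= eqxx mul1r big1.
  by rewrite (_ : _ - _ = 0) ?na0 ?mulr_ge0 ?nv_ge0 ?ltW//; ring.
by move=> i /negbTE ->; rewrite mul0r.
Qed.

Definition rowmap (g : 'I_3 -> V -> K) (x : V) : V := \row_j g j x.

Lemma hgrad_comp f (g : 'I_3 -> V -> K) q a (b : 'I_3 -> 'I_3 -> K) :
  hgrad f (rowmap g q) a -> (forall j, hgrad (g j) q (b j)) ->
  hgrad (fun x => f (rowmap g x)) q (fun k => \sum_j a j * b j k).
Proof.
move=> Hf Hg.
have /choice [L HL] : forall j, exists L, 0 < L /\ exists2 r, 0 < r &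
    forall h, nv h <= r -> na (g j (q + h) - g j q) <= L * nv h by move=> j; exact: hgrad_lip (Hg j).
pose LL := \sum_j L j; have LL0 j : L j <= LL.
  rewrite /LL (bigD1 j)//= lerDl sumr_ge0// => i _; apply: ltW; exact: (HL i).1.
have LL1 : 0 < LL by apply: lt_le_trans (LL0 ord0); exact: (HL ord0).1.
have /choice [s Hs] : forall j, exists r, 0 < r /\
    forall h, nv h <= r -> na (g j (q + h) - g j q) <= L j * nv h.
  by move=> j; have [_ [r r0 Hr]] := HL j; exists r.
apply: (@hgrad_C _ _ _ (LL + \sum_j na (a j))) => e e0.
have [r r0 Hr] := Hf e e0.
have /choice [t Ht] : forall j, exists r, 0 < r /\
    forall h, nv h <= r -> na (g j (q + h) - g j q - lin3 (b j) h) <= e * nv h.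
  by move=> j; have [r' r'0 Hr'] := Hg j e e0; exists r'.
(* A minimum over the three indices, so that one radius serves every component; only [mle] and [mgt]
   are kept. *)
pose m (w : 'I_3 -> R) := Num.min (w ord0) (Num.min (w (lift ord0 ord0)) (w (lift ord0 (lift ord0 ord0)))).
have mle w j : m w <= w j.
  rewrite /m !ge_min; case: j => -[|[|[|//]]] lt3; apply/or3P.
  - by apply: Or31; rewrite le_eqVlt; apply/orP; left; apply/eqP; congr w; apply: val_inj.
  - by apply: Or32; rewrite le_eqVlt; apply/orP; left; apply/eqP; congr w; apply: val_inj.
  - by apply: Or33; rewrite le_eqVlt; apply/orP; left; apply/eqP; congr w; apply: val_inj.
have mgt w : (forall j, 0 < w j) -> 0 < m w by move=> w0; rewrite !lt_min !w0.
clearbody m.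
exists (Num.min (m s) (Num.min (m t) (r / LL))).
  by rewrite !lt_min divr_gt0// (mgt s (fun j => (Hs j).1)) (mgt t (fun j => (Ht j).1)).
move=> h; rewrite !le_min ler_pdivlMr// => /and3P[h1 h2 h3].
pose D := rowmap g (q + h) - rowmap g q.
have n0 := nv_ge0 h.
have Dle : nv D <= LL * nv h.
  apply: nv_le => [|j]; first by rewrite mulr_ge0// ltW.
  rewrite !mxE (le_trans ((Hs j).2 h (le_trans h1 (mle s j))))//.
  by rewrite ler_wpM2r.
have Dr : nv D <= r by rewrite (le_trans Dle)// mulrC.
have := Hr D Dr; rewrite {1}(_ : rowmap g q + D = rowmap g (q + h)); last first.
  by rewrite /D addrC subrK.
move=> h4.
have -> : lin3 (fun k => \sum_j a j * b j k) h = \sum_j a j * lin3 (b j) h.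
  rewrite /lin3; under eq_bigr do rewrite mulr_suml.
  rewrite exchange_big; apply: eq_bigr => j _; rewrite mulr_sumr.
  by apply: eq_bigr => k _; rewrite mulrA.
rewrite (_ : _ - _ - _ = (f (rowmap g (q + h)) - f (rowmap g q) - lin3 a D) +
  \sum_j a j * (g j (q + h) - g j q - lin3 (b j) h)); last first.
  have -> : \sum_j a j * (g j (q + h) - g j q - lin3 (b j) h) =
     lin3 a D - \sum_j a j * lin3 (b j) h.
    by rewrite /lin3 -sumrB; apply: eq_bigr => j _; rewrite !mxE mulrBr.
  by ring.
rewrite (le_trans (naD _ _))// mulrDl lerD//.
  by rewrite (le_trans h4)// mulrCA ler_wpM2l// ltW.
rewrite (le_trans (na_sum _))// mulr_suml ler_sum// => j _.
rewrite naM ler_wpM2l ?na_ge0//; apply: (Ht j).2.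
exact: le_trans h2 (mle t j).
Qed.

Lemma dfrD f g q : dfr f q -> dfr g q -> dfr (fun x => f x + g x) q.
Proof. by move=> /diff_hgrad hf /diff_hgrad hg; exact: hgrad_dfr (hgradD hf hg). Qed.
Lemma dfrB f g q : dfr f q -> dfr g q -> dfr (fun x => f x - g x) q.
Proof. by move=> /diff_hgrad hf /diff_hgrad hg; exact: hgrad_dfr (hgradB hf hg). Qed.
Lemma dfrM f g q : dfr f q -> dfr g q -> dfr (fun x => f x * g x) q.
Proof. by move=> /diff_hgrad hf /diff_hgrad hg; exact: hgrad_dfr (hgradM hf hg). Qed.
Lemma dfr_cst c q : dfr (fun=> c) q.
Proof. exact: hgrad_dfr (hgrad_cst c q). Qed.
Lemma dfr_coord j q : dfr (fun x => x ord0 j) q.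
Proof. exact: hgrad_dfr (hgrad_coord j q). Qed.
Lemma dfrV f q : f q != 0 -> dfr f q -> dfr (fun x => (f x)^-1) q.
Proof. by move=> /cderivV[c hc] /diff_hgrad hf; exact: hgrad_dfr (hgrad_cderiv hc hf). Qed.
Lemma dfr_comp f (g : 'I_3 -> V -> K) q : dfr f (rowmap g q) -> (forall j, dfr (g j) q) ->
  dfr (fun x => f (rowmap g x)) q.
Proof.
by move=> /diff_hgrad hf hg; exact: hgrad_dfr (hgrad_comp hf (fun j => diff_hgrad (hg j))).
Qed.

Lemma pdB k f g q : dfr f q -> dfr g q -> pd k (fun x => f x - g x) q = pd k f q - pd k g q.
Proof. by move=> /diff_hgrad hf /diff_hgrad hg; rewrite (hgrad_pd k (hgradB hf hg)). Qed.

End GradientCalculus.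

(** * Cauchy estimates for first derivatives *)

Section CauchyEstimates.
Context {R : realType}.
Local Notation K := R[i].
Local Notation V := (C3 R).
Implicit Types (u v h p q : V) (f g : V -> K) (e r l t M B : R) (j k : 'I_3).

Lemma ccontD (F G : K -> K) z : ccont F z -> ccont G z -> ccont (fun w => F w + G w) z.
Proof.
move=> cF cG e e0; have [|r r0 Hr] := cF (e / 2); first by lra.
have [|r' r'0 Hr'] := cG (e / 2); first by lra.
exists (Num.min r r'); first by rewrite lt_min r0.
move=> h; rewrite le_min => /andP[/Hr h1 /Hr' h2].
rewrite (_ : _ - _ = (F (z + h) - F z) + (G (z + h) - G z)); last by ring.
by rewrite (le_trans (naD _ _))//; lra.
Qed.

Lemma ccontM (F G : K -> K) z : ccont F z -> ccont G z -> ccont (fun w => F w * G w) z.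
Proof.
move=> cF cG e e0; pose c := na (F z) + na (G z) + 1.
have a0 := na_ge0 (F z); have b0 := na_ge0 (G z).
have c0 : 1 <= c by rewrite /c; lra.
have d0 : 0 < Num.min 1 (e / (2 * c)) by rewrite lt_min ltr01 divr_gt0//; lra.
have [r r0 Hr] := cF _ d0; have [r' r'0 Hr'] := cG _ d0.
exists (Num.min r r'); first by rewrite lt_min r0.
move=> h; rewrite le_min => /andP[/Hr + /Hr']; rewrite !le_min => /andP[h1 h2] /andP[h3 h4].
have -> : F (z + h) * G (z + h) - F z * G z = (F (z + h) - F z) * (G (z + h) - G z)
  + (F (z + h) - F z) * G z + F z * (G (z + h) - G z) by ring.
move: h2 h4; rewrite !ler_pdivlMr; [|lra|lra].
set x := F (z + h) - F z in h1 *; set y := G _ - _ in h3 *.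
have x0 := na_ge0 x; have y0 := na_ge0 y => h2 h4.
have := naD (x * y + x * G z) (F z * y); have := naD (x * y) (x * G z); rewrite !naM.
have : na x * na y <= na x by rewrite ler_piMr.
move: h2 h4; rewrite /c; nra.
Qed.

Lemma ccont_cst (c : K) z : ccont (fun=> c) z.
Proof. exact: cderiv_ccont (cderiv_cst c z). Qed.

Lemma ucont_edges_ccont (F : K -> K) l : l != 0 ->
  (forall z, z != 0 -> na z <= 2 * `|l| -> ccont F z) -> ucont_edges F l.
Proof.
move=> l0 H; have l2 : 0 < l ^+ 2 by rewrite exprn_even_gt0//= l0.
have ctz a b z : half_disc a b (l ^+ 2) (2 * `|l|) z -> ccont F z.
  by move=> h; apply: H (half_disc_neq0 l2 h) _; case: h.
by split; apply: ucont_seg => t ht;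
  [apply: ctz (edgeAB l ht)|apply: ctz (edgeBC l ht)|apply: ctz (edgeCA l ht)].
Qed.

(* [cauchy_deriv l F] is F'(0) when F is holomorphic on the disc of radius [2 l]. *)
Definition cauchy_deriv l (F : K -> K) : K := c0^-1 * ctri_int (fun z => F z * (z^-1 * z^-1)) l.

(** Continuity is enough for the integral and its linearity. [pd_dfr] relies on this when it applies
    [cauchy_deriv] to partial derivatives known only to be continuous. *)
Definition ccont_disc l (F : K -> K) := forall z, na z <= 2 * l -> ccont F z.

Lemma ucont_edges_cauchy l F : 0 < l -> ccont_disc l F -> ucont_edges (fun z => F z * (z^-1 * z^-1)) l.
Proof.
move=> l0 cF; apply: ucont_edges_ccont; rewrite ?gt_eqF// gtr0_norm// => z z0 hz.
by apply: ccontM; [exact: cF|case: (cderiv_invsqr z0) => d /cderiv_ccont].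
Qed.

Lemma ccont_discD l F G : ccont_disc l F -> ccont_disc l G -> ccont_disc l (fun z => F z + G z).
Proof. by move=> cF cG z hz; apply: ccontD; [exact: cF|exact: cG]. Qed.

Lemma ccont_discZ l (c : K) F : ccont_disc l F -> ccont_disc l (fun z => c * F z).
Proof. by move=> cF z hz; apply: ccontM (ccont_cst _ _) (cF z hz). Qed.

Lemma cauchy_derivD l F G : 0 < l -> ccont_disc l F -> ccont_disc l G ->
  cauchy_deriv l (fun z => F z + G z) = cauchy_deriv l F + cauchy_deriv l G.
Proof.
move=> l0 cF cG; rewrite /cauchy_deriv.
have -> : (fun z => (F z + G z) * (z^-1 * z^-1)) =
    (fun z => F z * (z^-1 * z^-1) + G z * (z^-1 * z^-1)).
  by apply/funext => z; exact: mulrDl.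
by rewrite ctri_intD ?mulrDr//; exact: ucont_edges_cauchy.
Qed.

Lemma cauchy_derivZ l c F : 0 < l -> ccont_disc l F -> cauchy_deriv l (fun z => c * F z) = c * cauchy_deriv l F.
Proof.
move=> l0 cF; rewrite /cauchy_deriv.
have -> : (fun z => c * F z * (z^-1 * z^-1)) = (fun z => c * (F z * (z^-1 * z^-1))).
  by apply/funext => z; rewrite mulrA.
by rewrite ctri_intZ 1?mulrCA//; exact: ucont_edges_cauchy.
Qed.

Lemma cauchy_derivB l F G : 0 < l -> ccont_disc l F -> ccont_disc l G ->
  cauchy_deriv l (fun z => F z - G z) = cauchy_deriv l F - cauchy_deriv l G.
Proof.
move=> l0 cF cG; rewrite -mulN1r -cauchy_derivZ// -cauchy_derivD//; last exact: ccont_discZ.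
have -> // : (fun z => F z - G z) = (fun z => F z + -1 * G z).
by apply/funext => z; rewrite mulN1r.
Qed.

Lemma ccont_disc_sum l n (c : 'I_n -> K) (F : 'I_n -> K -> K) : (forall i, ccont_disc l (F i)) ->
  ccont_disc l (fun z => \sum_i c i * F i z).
Proof.
elim: n c F => [|n IH] c F cF.
  by move=> z hz; under eq_fun do rewrite big_ord0; exact: ccont_cst.
under eq_fun do rewrite big_ord_recl; apply: ccont_discD; first exact: ccont_discZ.
exact: (IH (fun i => c (lift ord0 i)) (fun i => F (lift ord0 i))).
Qed.

Lemma cauchy_deriv_sum l n (c : 'I_n -> K) (F : 'I_n -> K -> K) : 0 < l -> (forall i, ccont_disc l (F i)) ->
  cauchy_deriv l (fun z => \sum_i c i * F i z) = \sum_i c i * cauchy_deriv l (F i).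
Proof.
move=> l0; elim: n c F => [|n IH] c F cF.
  rewrite big_ord0; under eq_fun do rewrite big_ord0.
  have -> : (fun=> 0) = (fun z : K => 0 * (0 : K)) by apply/funext => z; rewrite mul0r.
  by rewrite (@cauchy_derivZ l 0 (fun=> 0))// ?mul0r// => z _; exact: ccont_cst.
under eq_fun do rewrite big_ord_recl.
rewrite cauchy_derivD//; [|exact: ccont_discZ|exact: ccont_disc_sum].
by rewrite cauchy_derivZ// big_ord_recl IH.
Qed.

(** 72 = 8 * 9: on the contour |z| >= l / 3, so 1 / |z|^2 <= 9 / l^2, and [ctri_int_bound]
    contributes 8 l. *)
Definition cauchy_const : R := 72 / na (@c0 R).

Lemma cauchy_const_gt0 : 0 < cauchy_const.
Proof. by rewrite divr_gt0// lt_def na_eq0 c0_neq0 na_ge0. Qed.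

Lemma cauchy_deriv_bound l F M : 0 < l -> ccont_disc l F -> (forall z, na z <= 2 * l -> na (F z) <= M) ->
  na (cauchy_deriv l F) <= cauchy_const * M / l.
Proof.
move=> l0 cF H; rewrite /cauchy_deriv naM naV /cauchy_const.
have cp : 0 < na (@c0 R) by rewrite lt_def na_eq0 c0_neq0 na_ge0.
have M0 : 0 <= M by apply: le_trans (H 0 _); rewrite ?na_ge0// na0; lra.
have := ctri_int_bound (M := M * (9 / l ^+ 2)) _ (ucont_edges_cauchy l0 cF); rewrite gtr0_norm// => h.
have -> : 72 / na (@c0 R) * M / l = (na (@c0 R))^-1 * (8 * l * (M * (9 / l ^+ 2))).
  by field; rewrite !gt_eqF.
rewrite ler_pM2l ?invr_gt0//; apply: h; first by rewrite gt_eqF.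
move=> z h1 h2; rewrite !naM !naV ler_pM//.
- exact: na_ge0.
- by rewrite mulr_ge0// invr_ge0 na_ge0.
- exact: H.
have z0 : 0 < na z by lra.
have -> : 9 / l ^+ 2 = (l / 3)^-1 * (l / 3)^-1 by field; rewrite gt_eqF.
by rewrite ler_pM ?invr_ge0 ?na_ge0// lef_pV2 ?posrE//; lra.
Qed.

Lemma line_dist q p l (z : K) j r : nv (p - q) <= r -> na z <= l -> nv (p + z *: ej j - q) <= r + l.
Proof.
move=> pq zl; rewrite addrAC (le_trans (nvD _ _))// lerD// nvZ.
by rewrite (le_trans _ zl)// ler_piMr ?na_ge0 ?nv_ej.
Qed.

Lemma ccont_disc_line f q l j : (forall p, nv (p - q) <= 2 * l -> dfr f p) ->
  ccont_disc l (fun z => f (q + z *: ej j)).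
Proof.
move=> H z hz; apply: hgrad_ccont (diff_hgrad (H _ _)).
by have := @line_dist q q (2 * l) z j 0; rewrite subrr nv0 add0r; apply.
Qed.

Lemma pd_cauchy f q l j : 0 < l -> (forall p, nv (p - q) <= 2 * l -> dfr f p) ->
  pd j f q = cauchy_deriv l (fun z => f (q + z *: ej j)).
Proof.
move=> l0 H; rewrite /cauchy_deriv (@derivative_formula _ _ _ (pd j f q)).
- by rewrite mulrC mulfK// c0_neq0.
- by rewrite gt_eqF.
- rewrite gtr0_norm// => z hz; eexists; apply: hgrad_line; apply: diff_hgrad; apply: H.
  by have := @line_dist q q (2 * l) z j 0; rewrite subrr nv0 add0r; apply.
have := @hgrad_line _ f q (ej j) 0 (fun j => pd j f q); rewrite scale0r addr0 lin3_ej; apply.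
by apply: diff_hgrad; apply: H; rewrite subrr nv0; lra.
Qed.

Lemma pd_bound f q l M j : 0 < l ->
  (forall p, nv (p - q) <= 2 * l -> dfr f p) ->
  (forall p, nv (p - q) <= 2 * l -> na (f p) <= M) ->
  na (pd j f q) <= cauchy_const * M / l.
Proof.
move=> l0 H HM; rewrite (pd_cauchy j l0 H); apply: cauchy_deriv_bound => //; first exact: ccont_disc_line.
move=> z hz; apply: HM.
by have := @line_dist q q (2 * l) z j 0; rewrite subrr nv0 add0r; apply.
Qed.

(** The real mean value theorem is applied to the real and the imaginary part ([w] below is either
    of them); adding the two costs the factor 2. *)
Lemma mean_value (g : R -> K) B :
  (forall t, 0 <= t <= 1 -> exists2 d, na d <= B &
    forall e, 0 < e -> exists2 r, 0 < r & forall h : R, `|h| <= r ->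
      na (g (t + h) - g t - h%:C%C * d) <= e * `|h|) ->
  na (g 1 - g 0) <= 2 * B.
Proof.
move=> H.
have key (w : K -> R) : (forall x y, w (x - y) = w x - w y) -> (forall x, `|w x| <= na x) ->
    (forall (h : R) x, w (h%:C%C * x) = h * w x) -> `|w (g 1) - w (g 0)| <= B.
  move=> wB wle wZ.
  have D t : 0 <= t <= 1 -> exists2 d, `|d| <= B & is_derive t 1 (w \o g) d.
    move=> /H[d dB Hd]; exists (w d); first by rewrite (le_trans (wle _)).
    suff h : (fun h : R => h^-1 *: ((w \o g) (h *: 1 + t) - (w \o g) t)) @ 0^' --> w d.
      by split; [exact: cvgP h|exact: cvg_lim h].
    apply/cvgrPdist_le => e e0; have [r r0 Hr] := Hd e e0.
    exists r => //= h /=; rewrite sub0r normrN => /ltW hr h0.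
    rewrite -(ler_pM2r (_ : 0 < `|h|)) ?normr_gt0// (le_trans _ (Hr h hr))//.
    rewrite (le_trans _ (wle _))// !wB wZ -normrM distrC.
    rewrite /GRing.scale /= mulr1 mulrBl mulrAC mulVf// mul1r addrC (addrC h t).
    by rewrite (mulrC h) addrC.
  pose df t := 'D_1 (w \o g) t.
  have Dd t : 0 <= t <= 1 -> is_derive t 1 (w \o g) (df t) /\ `|df t| <= B.
    by move=> /D[d dB [? cderiv]]; rewrite /df cderiv; split => //; split.
  have [||c] := @MVT_segment _ (w \o g) df 0 1 ler01.
  - move=> t; rewrite in_itv /= => /andP[t0 t1].
    by have [|//] := Dd t; rewrite (ltW t0) (ltW t1).
  - apply: derivable_within_continuous => t; rewrite in_itv /= => ht.
    by have [[]] := Dd t ht.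
  by rewrite in_itv /= => /Dd[_ cB] -> ; rewrite subr0 mulr1.
have h1 : `|complex.Re (g 1) - complex.Re (g 0)| <= B.
  apply: key; [by move=> x y; rewrite reD reN|exact: na_Re|exact: reZ].
have h2 : `|complex.Im (g 1) - complex.Im (g 0)| <= B.
  apply: key; [by move=> x y; rewrite imD imN|exact: na_Im|exact: imZ].
rewrite (le_trans (na_le_ReIm _))// reD reN imD imN; lra.
Qed.

End CauchyEstimates.

(** * Uniform estimates, derivatives and limits of holomorphic functions *)

Section HolomorphicCalculus.
Context {R : realType}.
Local Notation K := R[i].
Local Notation V := (C3 R).
Implicit Types (u v h p q : V) (f g : V -> K) (e r l t M B : R) (j k : 'I_3).

Lemma nv_seg p p' q r t : 0 <= t <= 1 -> nv (p - q) <= r -> nv (p' - q) <= r ->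
  nv (p + t%:C%C *: (p' - p) - q) <= r.
Proof.
move=> /andP[t0 t1] hp hp'.
have -> : p + t%:C%C *: (p' - p) - q = (1 - t)%:C%C *: (p - q) + t%:C%C *: (p' - q).
  rewrite rmorphB rmorph1 scalerBl scale1r -[RHS]addrA -scalerN -scalerDr opprB.
  by rewrite (addrC (q - p)) addrA subrK addrAC.
rewrite (le_trans (nvD _ _))// !nvZ !naC !ger0_norm ?subr_ge0//; nra.
Qed.

Lemma hgrad_real f p v a t : hgrad f (p + t%:C%C *: v) a ->
  forall e, 0 < e -> exists2 r, 0 < r & forall h : R, `|h| <= r ->
    na (f (p + (t + h)%:C%C *: v) - f (p + t%:C%C *: v) - h%:C%C * lin3 a v) <= e * `|h|.
Proof.
move=> /hgrad_line H e /H[r r0 Hr]; exists r => // h hr.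
by have := Hr h%:C%C; rewrite naC rmorphD mulrC; apply.
Qed.

Lemma hgrad_mean f p p' (a : V -> 'I_3 -> K) B :
  (forall t, 0 <= t <= 1 -> let x := p + t%:C%C *: (p' - p) in
    hgrad f x (a x) /\ na (lin3 (a x) (p' - p)) <= B) ->
  na (f p' - f p) <= 2 * B.
Proof.
move=> H; have := @mean_value _ (fun t => f (p + t%:C%C *: (p' - p))) B.
rewrite rmorph0 rmorph1 scale0r scale1r addr0 [p + (p' - p)]addrC subrK; apply.
move=> t /H[Hx xB]; exists (lin3 (a (p + t%:C%C *: (p' - p))) (p' - p)) => //.
exact: hgrad_real.
Qed.

Lemma lin3_le a v B : (forall j, na (a j) <= B) -> na (lin3 a v) <= 3 * B * nv v.
Proof.
move=> H; rewrite (le_trans (lin3_bound _ _))// ler_wpM2r ?nv_ge0//.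
by have := H ord0; have := H (lift ord0 ord0); have := H (lift ord0 (lift ord0 ord0));
  rewrite !big_ord_recl big_ord0; lra.
Qed.

Lemma lip_ccont (F : K -> K) r D z : 0 < r ->
  (forall w, na w <= r -> na (F (z + w) - F z) <= D * na w) -> ccont F z.
Proof.
move=> r0 H e e0; have D0 : 0 < `|D| + 1 by rewrite ltr_wpDl.
exists (Num.min r (e / (`|D| + 1))); first by rewrite lt_min r0 divr_gt0.
move=> w; rewrite le_min (ler_pdivlMr _ _ D0) => /andP[/H h1 h2].
rewrite (le_trans h1)// (le_trans _ h2)// mulrC ler_wpM2l ?na_ge0//.
by have := ler_norm D; lra.
Qed.

Section Estimates.
Variables (f : V -> K) (q : V) (l M : R).
Hypotheses (l0 : 0 < l) (df : forall p, nv (p - q) <= 4 * l -> dfr f p)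
  (fM : forall p, nv (p - q) <= 4 * l -> na (f p) <= M).

Lemma sub_ball p r r' x : nv (p - q) <= r -> r + r' <= 4 * l -> nv (x - p) <= r' ->
  nv (x - q) <= 4 * l.
Proof. by move=> h1 h2 h3; have := nv_tri x p q; lra. Qed.

Lemma bound_ge0 : 0 <= M.
Proof.
apply: le_trans (na_ge0 _) (fM (_ : nv (q - q) <= 4 * l)).
by rewrite subrr nv0 mulr_ge0// ltW.
Qed.

(** Cauchy estimates on balls of radius 2 l about points of the inner ball, which stay inside the
    ball of radius 4 l. The factor 6 = 2 * 3 comes from [hgrad_mean] and the three coordinates. *)
Lemma holo_lip p p' : nv (p - q) <= 2 * l -> nv (p' - q) <= 2 * l ->
  na (f p' - f p) <= 6 * cauchy_const * M / l * nv (p' - p).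
Proof.
move=> hp hp'.
have := @hgrad_mean f p p' (fun x j => pd j f x) (3 * (cauchy_const * M / l) * nv (p' - p)).
have -> : 6 * cauchy_const * M / l * nv (p' - p) = 2 * (3 * (cauchy_const * M / l) * nv (p' - p)) by ring.
have lp := l0; have h24 : 2 * l <= 4 * l by lra.
have h24' : 2 * l + 2 * l <= 4 * l by lra.
apply => t ht x; have hx : nv (x - q) <= 2 * l by exact: nv_seg.
split; first by apply: diff_hgrad; apply: df; apply: (le_trans hx).
apply: lin3_le => j; apply: pd_bound => // y hy; [apply: df|apply: fM];
  exact: sub_ball hx h24' hy.
Qed.

(** No second derivative is involved: [cauchy_deriv] is applied to the difference of [f] along two
    parallel lines, which [holo_lip] bounds by a multiple of [nv (p' - p)]. *)
Lemma pd_lip p p' j : nv (p - q) <= l -> nv (p' - q) <= l ->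
  na (pd j f p' - pd j f p) <= 12 * cauchy_const ^+ 2 * M / l ^+ 2 * nv (p' - p).
Proof.
move=> hp hp'; have lp := l0; have l2 : 0 < l / 2 by lra.
have dp x : nv (x - q) <= l -> forall y, nv (y - x) <= 2 * (l / 2) -> dfr f y.
  by move=> hx y hy; apply: df; apply: sub_ball hx _ hy; lra.
rewrite (pd_cauchy j l2 (dp p hp)) (pd_cauchy j l2 (dp p' hp')) -cauchy_derivB//;
  [|exact: ccont_disc_line (dp _ _)..].
have -> : 12 * cauchy_const ^+ 2 * M / l ^+ 2 * nv (p' - p) =
    cauchy_const * (6 * cauchy_const * M / l * nv (p' - p)) / (l / 2) by field; rewrite gt_eqF.
apply: cauchy_deriv_bound => //.
  move=> z hz; apply: ccontD; first exact: ccont_disc_line (dp _ hp') _ hz.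
  have -> : (fun z => - f (p + z *: ej j)) = (fun z => -1 * f (p + z *: ej j)).
    by apply/funext => w; rewrite mulN1r.
  by apply: ccontM (ccont_cst _ _) _; exact: ccont_disc_line (dp _ hp) _ hz.
move=> z hz.
have -> : nv (p' - p) = nv (p' + z *: ej j - (p + z *: ej j)).
  by rewrite opprD addrACA subrr addr0.
by apply: holo_lip; [have := line_dist j hp hz; lra|have := line_dist j hp' hz; lra].
Qed.

(** Once the linear term is subtracted, the derivative along the segment is a difference of
    gradients, controlled by [pd_lip]. *)
Lemma holo_quad p h : nv (p - q) <= l -> nv (p + h - q) <= l ->
  na (f (p + h) - f p - lin3 (fun j => pd j f p) h) <=
    72 * cauchy_const ^+ 2 * M / l ^+ 2 * nv h ^+ 2.
Proof.
have lp := l0; have h14 : l <= 4 * l by lra.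
move=> hp hp'; pose C := 12 * cauchy_const ^+ 2 * M / l ^+ 2.
have -> : 72 * cauchy_const ^+ 2 * M / l ^+ 2 * nv h ^+ 2 = 2 * (3 * (C * nv h) * nv h).
  by rewrite /C; field; rewrite gt_eqF.
pose d0 := lin3 (fun j => pd j f p) h.
pose g t := f (p + t%:C%C *: h) - t%:C%C * d0.
have -> : f (p + h) - f p - d0 = g 1 - g 0.
  by rewrite /g rmorph0 rmorph1 scale0r scale1r addr0 mul1r mul0r subr0; ring.
apply: mean_value => t ht; pose x := p + t%:C%C *: h.
have hx : nv (x - q) <= l.
  by have := nv_seg ht hp hp'; rewrite [in X in _ *: X]addrAC subrr add0r.
have hgx : hgrad f x (fun j => pd j f x).
  by apply: diff_hgrad; apply: df; apply: (le_trans hx).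
exists (lin3 (fun j => pd j f x) h - d0).
  rewrite /d0; have -> : lin3 (fun j => pd j f x) h - lin3 (fun j => pd j f p) h =
     lin3 (fun j => pd j f x - pd j f p) h.
    by rewrite /lin3 -sumrB; apply: eq_bigr => j _; rewrite mulrBl.
  apply: lin3_le => j; rewrite (le_trans (pd_lip j hp hx))// -/C.
  have C0 : 0 <= C.
    by rewrite /C divr_ge0 ?sqr_ge0// mulr_ge0 ?bound_ge0// mulr_ge0// sqr_ge0.
  rewrite ler_wpM2l// /x addrAC subrr add0r nvZ naC ler_piMl ?nv_ge0//.
  by rewrite ger0_norm; lra.
move=> e e0; have [r r0 Hr] := hgrad_real hgx e0; exists r => // s /Hr.
rewrite /g rmorphD.
have aux (A B' S D T : K) : A - (T + S) * d0 - (B' - T * d0) - S * (D - d0) = A - B' - S * D.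
  by ring.
by rewrite aux.
Qed.

Lemma pd_line_ccont (z : K) j k : nv (q + z *: ej j - q) <= l / 2 ->
  ccont (fun z => pd k f (q + z *: ej j)) z.
Proof.
have lp := l0; move=> hz; apply: (@lip_ccont _ (l / 2) (12 * cauchy_const ^+ 2 * M / l ^+ 2)); first by lra.
move=> w wl.
have h1 : nv (q + z *: ej j - q) <= l by lra.
have h2 : nv (q + (z + w) *: ej j - q) <= l.
  by rewrite scalerDl addrA [leRHS]splitr; exact: line_dist.
have C0 : 0 <= 12 * cauchy_const ^+ 2 * M / l ^+ 2.
  by rewrite divr_ge0 ?sqr_ge0// mulr_ge0 ?bound_ge0// mulr_ge0// sqr_ge0.
rewrite (le_trans (pd_lip k h1 h2))// ler_wpM2l//.
have -> : q + (z + w) *: ej j - (q + z *: ej j) = w *: ej j.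
  by rewrite scalerDl addrA [X in X - _]addrC addrK.
by rewrite nvZ ler_piMr ?na_ge0 ?nv_ej.
Qed.

End Estimates.

Definition hol q r f := forall p, nv (p - q) < r -> dfr f p.

Lemma hol_locally_bounded f q : dfr f q -> exists2 r, 0 < r &
  forall p, nv (p - q) <= r -> na (f p) <= na (f q) + 1.
Proof.
move=> /dfr_ctn/(_ 1 ltr01)[r r0 Hr]; exists r => // p /Hr.
by have := naD (f p - f q) (f q); rewrite subrK; lra.
Qed.

Lemma hgrad_of_quad f q a C r : 0 < r ->
  (forall h, nv h <= r -> na (f (q + h) - f q - lin3 a h) <= C * nv h ^+ 2) -> hgrad f q a.
Proof.
move=> r0 H e e0; have C0 : 0 < `|C| + 1 by rewrite ltr_wpDl.
exists (Num.min r (e / (`|C| + 1))); first by rewrite lt_min r0 divr_gt0.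
move=> h; rewrite le_min ler_pdivlMr// => /andP[/H h1 h2].
rewrite (le_trans h1)// expr2 mulrA ler_wpM2r ?nv_ge0//.
rewrite (le_trans _ h2)// mulrC ler_wpM2l ?nv_ge0// (le_trans (ler_norm _))//; lra.
Qed.

(** The remainder of [pd j f] is the [cauchy_deriv] of the remainder of [f] along the line of
    direction [ej j], and the latter is quadratic by [holo_quad]. The gradient is the [cauchy_deriv]
    of each [pd k f] along that line. *)
Lemma pd_dfr f q r j : 0 < r -> hol q r f -> dfr (pd j f) q.
Proof.
move=> r0 hf; have dq : dfr f q by apply: hf; rewrite subrr nv0.
have [r1 r10 fM] := hol_locally_bounded dq; set M := na _ + 1 in fM.
(* The divisor 5 makes 4 l strictly smaller than both radii. *)
pose l := Num.min r r1 / 5.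
have [lr lr1 l0] : [/\ 4 * l < r, 4 * l < r1 & 0 < l].
  have m0 : 0 < Num.min r r1 by rewrite lt_min r0.
  have [m1 m2] : Num.min r r1 <= r /\ Num.min r r1 <= r1 by rewrite !ge_min !lexx orbT.
  by rewrite /l; split; lra.
clearbody l.
have {hf}df p : nv (p - q) <= 4 * l -> dfr f p by move=> h; apply: hf; lra.
have {}fM p : nv (p - q) <= 4 * l -> na (f p) <= M by move=> h; apply: fM; lra.
pose Q := 72 * cauchy_const ^+ 2 * M / l ^+ 2.
pose m := l / 4; have m0 : 0 < m by rewrite /m; lra.
have lines (z : K) : na z <= 2 * m -> nv (q + z *: ej j - q) <= l / 2.
  move=> hz; have := @line_dist _ q q (2 * m) z j 0; rewrite subrr nv0 add0r.
  by move=> /(_ (lexx _) hz); rewrite /m; lra.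
suff H : hgrad (pd j f) q (fun k => cauchy_deriv m (fun z => pd k f (q + z *: ej j))).
  exact: (hgrad_dfr H).
apply: (@hgrad_of_quad _ _ _ (cauchy_const * Q / m) (l / 2)) => [|h hl]; first by lra.
have c1 : ccont_disc m (fun z => f (q + h + z *: ej j)).
  apply: ccont_disc_line => p hp; apply: df; have := nv_tri p (q + h) q.
  by rewrite addrAC subrr add0r; move: hp; rewrite /m; lra.
have c2 : ccont_disc m (fun z => f (q + z *: ej j)).
  by apply: ccont_disc_line => p; rewrite /m => hp; apply: df; lra.
have c3 k : ccont_disc m (fun z => pd k f (q + z *: ej j)).
  by move=> z hz; apply: (pd_line_ccont l0 df fM); exact: lines.
rewrite (@pd_cauchy _ f (q + h) m j m0); last first.
  move=> p hp; apply: df; have := nv_tri p (q + h) q.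
  by rewrite addrAC subrr add0r; move: hp; rewrite /m; lra.
rewrite (@pd_cauchy _ f q m j m0); last by move=> p; rewrite /m => hp; apply: df; lra.
rewrite /lin3; under eq_bigr do rewrite mulrC.
have cs := @ccont_disc_sum _ m 3 (fun k => h ord0 k) (fun k z => pd k f (q + z *: ej j)) c3.
rewrite -(@cauchy_deriv_sum _ m 3 (fun k => h ord0 k) (fun k z => pd k f (q + z *: ej j)))//.
rewrite -cauchy_derivB// -cauchy_derivB//; last first.
  move=> z hz; apply: ccontD; first exact: c1.
  have -> : (fun z => - f (q + z *: ej j)) = (fun z => -1 * f (q + z *: ej j)).
    by apply/funext => w; rewrite mulN1r.
  by apply: ccontM (ccont_cst _ _) _; exact: c2.
have -> : cauchy_const * Q / m * nv h ^+ 2 = cauchy_const * (Q * nv h ^+ 2) / m by ring.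
apply: cauchy_deriv_bound => //.
  move=> z hz; apply: ccontD; first apply: ccontD; first exact: c1.
    have -> : (fun z => - f (q + z *: ej j)) = (fun z => -1 * f (q + z *: ej j)).
      by apply/funext => w; rewrite mulN1r.
    by apply: ccontM (ccont_cst _ _) _; exact: c2.
  set S := (fun z : K => \sum_(i < 3) _) in cs *.
  have -> : (fun z => - S z) = (fun z => -1 * S z).
    by apply/funext => w; rewrite mulN1r.
  by apply: ccontM (ccont_cst _ _) _; exact: cs.
move=> z hz.
have := @holo_quad f q l M l0 df fM (q + z *: ej j) h.
rewrite (addrAC q h) /lin3 -/Q; under eq_bigr do rewrite mulrC.
apply; first by have := lines z hz; lra.
by rewrite addrAC (le_trans (nvD _ _))//; have := lines z hz; lra.
Qed.

Lemma pd_hol f q r j : hol q r f -> hol q r (pd j f).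
Proof.
move=> hf p hp; apply: (@pd_dfr f p (r - nv (p - q))); first by lra.
by move=> x hx; apply: hf; have := nv_tri x p q; lra.
Qed.

(** Cauchy estimates on differences make the partial derivatives of [fn n] Cauchy sequences, and the
    quadratic remainder, whose constant does not depend on [n], survives in the limit. *)
Lemma uniform_limit_hol (fn : nat -> V -> K) f q r M :
  (forall n, hol q r (fn n)) -> (forall n p, nv (p - q) < r -> na (fn n p) <= M) ->
  (forall e, 0 < e -> exists N, forall n, (N <= n)%N -> forall p, nv (p - q) < r ->
     na (fn n p - f p) <= e) ->
  hol q r f.
Proof.
move=> hfn fM cv p hp; pose l := (r - nv (p - q)) / 5.
have l0 : 0 < l by rewrite /l; lra.
have sub x : nv (x - p) <= 4 * l -> nv (x - q) < r.
  by move=> h; have := nv_tri x p q; move: h l0; rewrite /l; lra.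
clearbody l.
have dfn n x : nv (x - p) <= 4 * l -> dfr (fn n) x by move=> /sub; exact: hfn.
have {}fM n x : nv (x - p) <= 4 * l -> na (fn n x) <= M by move=> /sub; exact: fM.
have cau k e : 0 < e -> exists N, forall n m, (N <= n)%N -> (N <= m)%N ->
    na (pd k (fn n) p - pd k (fn m) p) <= e.
  move=> e0; have C0 := @cauchy_const_gt0 R.
  have [|N HN] := cv (e * l / cauchy_const / 2); first by rewrite divr_gt0// divr_gt0// mulr_gt0.
  exists N => n m hn hm.
  have dp i : dfr (fn i) p by apply: dfn; rewrite subrr nv0; lra.
  rewrite -pdB//.
  have e1 : cauchy_const * (e * l / cauchy_const) / l = e by field; rewrite !gt_eqF.
  rewrite -[leRHS]e1.
  apply: (@pd_bound _ (fun x => fn n x - fn m x) p l (e * l / cauchy_const) k l0).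
  - by move=> x hx; apply: dfrB; apply: dfn; lra.
  - move=> x hx; have hx' : nv (x - q) < r by apply: sub; lra.
    have := na_tri (fn n x) (f x) (fn m x); rewrite (naBC (f x) (fn m x)).
    by have := HN n hn x hx'; have := HN m hm x hx'; lra.
pose a k := Complex (limn (fun n => complex.Re (pd k (fn n) p)))
                    (limn (fun n => complex.Im (pd k (fn n) p))).
have lim k := complex_cauchy_approx (cau k).
suff H : hgrad f p a by exact: (hgrad_dfr H).
apply: (@hgrad_of_quad _ _ _ (72 * cauchy_const ^+ 2 * M / l ^+ 2) l) => // h hl.
(* Replacing the limit by [fn n] costs e' at [p], e' at [p + h] and 3 e' |h| in the linear term, in
   total e. *)
apply/ler_addgt0Pr => e e0; pose e' := e / (3 * nv h + 2).
have e'0 : 0 < e' by rewrite divr_gt0//; have := nv_ge0 h; lra.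
have [N1 H1] := cv e' e'0.
have /choice [N2 H2] := fun k => lim k e' e'0.
pose n := maxn N1 (\max_k N2 k).
have n1 : (N1 <= n)%N by rewrite leq_maxl.
have n2 k : (N2 k <= n)%N by rewrite /n leq_max (leq_bigmax k) orbT.
have pp : nv (p - p) <= l by rewrite subrr nv0 ltW.
have php : nv (p + h - p) <= l by rewrite addrAC subrr add0r.
have h1 : na (fn n p - f p) <= e' by apply: H1.
have h2 : na (fn n (p + h) - f (p + h)) <= e' by apply: H1 => //; apply: sub; lra.
have h3 : na (lin3 (fun k => pd k (fn n) p - a k) h) <= 3 * e' * nv h.
  by apply: lin3_le => k; exact: H2.
have h4 := @holo_quad (fn n) p l M l0 (dfn n) (fM n) p h pp php.
have e'E : e' * (3 * nv h + 2) = e by rewrite /e' mulfVK// gt_eqF//; have := nv_ge0 h; lra.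
set Q := 72 * cauchy_const ^+ 2 * M / l ^+ 2 * nv h ^+ 2 in h4 *.
have linB : lin3 (fun k => pd k (fn n) p - a k) h = lin3 (fun k => pd k (fn n) p) h - lin3 a h.
  by rewrite /lin3 -sumrB; apply: eq_bigr => j _; rewrite mulrBl.
rewrite linB in h3.
set A := lin3 a h in h3 *; set B := lin3 _ h in h3 h4.
have -> : f (p + h) - f p - A = (fn n (p + h) - fn n p - B)
  - (fn n (p + h) - f (p + h)) + (fn n p - f p) + (B - A) by ring.
rewrite (le_trans (naD _ _))// (le_trans (lerD (naD _ _) (lexx _)))//.
rewrite (le_trans (lerD (lerD (naB _ _) (lexx _)) (lexx _)))//.
by rewrite -e'E; clear -h1 h2 h3 h4; lra.
Qed.

End HolomorphicCalculus.

(** * Points of [C3] in coordinates *)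

Section Coordinates.
Context {R : realType}.
Local Notation K := R[i].
Local Notation V := (C3 R).
Implicit Types (u v h p q : V) (f g : V -> K) (e r t M : R) (a b : 'I_3 -> K) (x y z c : K).

Definition o0 : 'I_3 := @Ordinal 3 0 isT.
Definition o1 : 'I_3 := @Ordinal 3 1 isT.
Definition o2 : 'I_3 := @Ordinal 3 2 isT.

Lemma ord3P (P : 'I_3 -> Prop) : P o0 -> P o1 -> P o2 -> forall j, P j.
Proof.
move=> h0 h1 h2 [[|[|[|//]]] lt3].
- by rewrite (_ : Ordinal lt3 = o0)//; apply: val_inj.
- by rewrite (_ : Ordinal lt3 = o1)//; apply: val_inj.
- by rewrite (_ : Ordinal lt3 = o2)//; apply: val_inj.
Qed.

Lemma sum3 (F : 'I_3 -> K) : \sum_j F j = F o0 + F o1 + F o2.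
Proof.
rewrite !big_ord_recl big_ord0 addr0 addrA; congr (F _ + F _ + F _); exact: val_inj.
Qed.

Lemma lin3E a v : lin3 a v = a o0 * v ord0 o0 + a o1 * v ord0 o1 + a o2 * v ord0 o2.
Proof. by rewrite -(sum3 (fun j => a j * v ord0 j)). Qed.

Definition pt x y z : V := \row_j nth 0 [:: x; y; z] j.

Lemma pt0 x y z : pt x y z ord0 o0 = x. Proof. by rewrite mxE. Qed.
Lemma pt1 x y z : pt x y z ord0 o1 = y. Proof. by rewrite mxE. Qed.
Lemma pt2 x y z : pt x y z ord0 o2 = z. Proof. by rewrite mxE. Qed.
Definition ptE := (pt0, pt1, pt2).

Lemma V_ext u v : u ord0 o0 = v ord0 o0 -> u ord0 o1 = v ord0 o1 -> u ord0 o2 = v ord0 o2 -> u = v.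
Proof. by move=> h0 h1 h2; apply/rowP; apply: ord3P. Qed.

Lemma pt_eta v : pt (v ord0 o0) (v ord0 o1) (v ord0 o2) = v.
Proof. by apply: V_ext; rewrite ptE. Qed.

Lemma vD u v j : (u + v) ord0 j = u ord0 j + v ord0 j. Proof. by rewrite mxE. Qed.
Lemma vN u j : (- u) ord0 j = - u ord0 j. Proof. by rewrite mxE. Qed.
Lemma vB u v j : (u - v) ord0 j = u ord0 j - v ord0 j. Proof. by rewrite vD vN. Qed.
Lemma vZ c u j : (c *: u) ord0 j = c * u ord0 j. Proof. by rewrite mxE. Qed.

Lemma nv_lt3 v e : na (v ord0 o0) < e -> na (v ord0 o1) < e -> na (v ord0 o2) < e -> nv v < e.
Proof.
move=> h0 h1 h2; have e0 : 0 < e by apply: le_lt_trans h0; exact: na_ge0.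
by apply: (proj2 (@nv_lt _ v e e0)); apply: ord3P.
Qed.

Lemma nv_le3 v e : na (v ord0 o0) <= e -> na (v ord0 o1) <= e -> na (v ord0 o2) <= e -> nv v <= e.
Proof.
move=> h0 h1 h2; apply: nv_le; last exact: ord3P.
by apply: le_trans h0; exact: na_ge0.
Qed.

Lemma hgrad_ext f q a b : (forall j, a j = b j) -> hgrad f q a -> hgrad f q b.
Proof. by move=> /funext ->. Qed.

Lemma hgrad_comp3 f g0 g1 g2 q a b0 b1 b2 : hgrad f (pt (g0 q) (g1 q) (g2 q)) a ->
  hgrad g0 q b0 -> hgrad g1 q b1 -> hgrad g2 q b2 ->
  hgrad (fun v => f (pt (g0 v) (g1 v) (g2 v))) q
    (fun k => a o0 * b0 k + a o1 * b1 k + a o2 * b2 k).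
Proof.
move=> Hf H0 H1 H2; pose g (j : 'I_3) := nth g0 [:: g0; g1; g2] j.
have gE v : pt (g0 v) (g1 v) (g2 v) = rowmap g v by apply: V_ext; rewrite !mxE.
pose b (j : 'I_3) := nth b0 [:: b0; b1; b2] j.
rewrite gE in Hf; under eq_fun do rewrite gE.
apply: hgrad_ext (@hgrad_comp _ f g q a b Hf _); first by move=> j; rewrite sum3.
exact: ord3P.
Qed.

Lemma dfr_comp3 f g0 g1 g2 q : dfr f (pt (g0 q) (g1 q) (g2 q)) ->
  dfr g0 q -> dfr g1 q -> dfr g2 q -> dfr (fun v => f (pt (g0 v) (g1 v) (g2 v))) q.
Proof.
by move=> /diff_hgrad hf /diff_hgrad h0 /diff_hgrad h1 /diff_hgrad h2;
   exact: hgrad_dfr (hgrad_comp3 hf h0 h1 h2).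
Qed.

Lemma hgrad_near f g q a r : 0 < r -> (forall p, nv (p - q) < r -> f p = g p) ->
  hgrad f q a -> hgrad g q a.
Proof.
move=> r0 fg H e e0; have [s s0 Hs] := H e e0.
exists (Num.min s (r / 2)); first by rewrite lt_min s0 divr_gt0.
move=> h; rewrite le_min => /andP[h1 h2]; rewrite -!fg ?Hs//.
  by rewrite subrr nv0.
by rewrite addrAC subrr add0r; lra.
Qed.

Lemma cderiv_unique (F : K -> K) z c c' : cderiv F z c -> cderiv F z c' -> c = c'.
Proof.
move=> h h'; apply/eqP; rewrite -subr_eq0; apply/eqP/na_small => e e0.
have [|r r0 Hr] := h (e / 2); first by rewrite divr_gt0.
have [|r' r'0 Hr'] := h' (e / 2); first by rewrite divr_gt0.
pose s := Num.min r r'; have s0 : 0 < s by rewrite lt_min r0.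
have sr : s <= r by rewrite ge_min lexx.
have sr' : s <= r' by rewrite ge_min lexx orbT.
have ns : na s%:C%C = s by rewrite naC gtr0_norm.
have := Hr s%:C%C; have := Hr' s%:C%C; rewrite ns => /(_ sr') h1 /(_ sr) h2.
rewrite -(ler_pM2r s0) -{1}ns -naM.
rewrite (_ : (c - c') * _ = (F (z + s%:C%C) - F z - c' * s%:C%C) - (F (z + s%:C%C) - F z - c * s%:C%C)); last by ring.
by rewrite (le_trans (naB _ _))//; lra.
Qed.

End Coordinates.

(** * Primitives with respect to the first coordinate *)

Section Primitive.
Context {R : realType}.
Local Notation K := R[i].
Local Notation V := (C3 R).
Implicit Types (u v h p q : V) (f g B : V -> K) (e r t M : R) (x y z c : K).

Definition xscale (z : K) q : V := pt (z * q ord0 o0) (q ord0 o1) (q ord0 o2).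

Lemma xscaleE z q : xscale z q = pt 0 (q ord0 o1) (q ord0 o2) + z *: pt (q ord0 o0) 0 0.
Proof. by apply: V_ext; rewrite !(vD, vZ, ptE) ?mulr0 ?addr0 ?add0r. Qed.

Lemma xscaleD z q h : xscale z (q + h) = xscale z q + xscale z h.
Proof. by apply: V_ext; rewrite !(vD, ptE) ?mulrDr. Qed.

Lemma nv_xscale t q : 0 <= t <= 1 -> nv (xscale t%:C%C q) <= nv q.
Proof.
move=> /andP[t0 t1]; apply: nv_le3; rewrite !ptE; [|exact: nv_coord|exact: nv_coord].
rewrite naM naC ger0_norm// (le_trans _ (nv_coord q o0))// ler_piMl ?na_ge0//.
Qed.

Lemma ucont_xscale (F : K -> V -> K) q :
  (forall t, 0 <= t <= 1 -> ccont (fun z => F z (xscale z q)) t%:C%C) ->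
  ucont (fun t => F t%:C%C (xscale t%:C%C q)).
Proof.
move=> H; have s01 t : seg 0 1 t = t%:C%C :> K by rewrite /seg; ring.
apply: (@eq_ucont _ (fun t => F (seg 0 1 t) (xscale (seg 0 1 t) q))) => [t _|]; first by rewrite s01.
by apply: (@ucont_seg _ (fun z => F z (xscale z q)) 0 1) => t ht; rewrite s01; exact: H.
Qed.

Lemma ccont_xscale f q z : dfr f (xscale z q) -> ccont (fun z => f (xscale z q)) z.
Proof.
move=> /diff_hgrad; rewrite {1}xscaleE => /hgrad_ccont; under eq_fun do rewrite -xscaleE.
by [].
Qed.

(** The integral of B(s, y, z) ds from 0 to x. Rescaling to [0, 1] removes the moving endpoint. *)
Definition prim B q : K := q ord0 o0 * int01 (fun t => B (xscale t%:C%C q)).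

Lemma ucont_xscale_hol B q r : hol 0 r B -> nv q < r -> ucont (fun t => B (xscale t%:C%C q)).
Proof.
move=> hB hq; apply: (@ucont_xscale (fun _ => B)) => t ht; apply: ccont_xscale; apply: hB.
by rewrite subr0 (le_lt_trans (nv_xscale _ _)).
Qed.

(** Differentiation under the integral sign: [holo_quad] bounds the remainder of the integrand by a
    constant independent of [t]. *)
Lemma int_xscale_dfr B q r M : hol 0 r B -> (forall p, nv p < r -> na (B p) <= M) -> nv q < r ->
  dfr (fun q => int01 (fun t => B (xscale t%:C%C q))) q.
Proof.
move=> hB BM hq; pose l := (r - nv q) / 5.
have l0 : 0 < l by rewrite /l; lra.
have lr : nv q + 4 * l < r by rewrite /l; lra.
clearbody l.
(* By the chain rule, [xscale z] multiplies the first partial derivative by [z] and leaves the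
   others unchanged. *)
pose w (k : 'I_3) (z : K) p := (if k == o0 then z else 1) * pd k B p.
have uw k : ucont (fun t => w k t%:C%C (xscale t%:C%C q)).
  apply: (@ucont_xscale (w k)) => t ht; apply: ccontM.
    by case: (k == o0); [exact: cderiv_ccont (cderiv_id _)|exact: ccont_cst].
  apply: ccont_xscale; apply: (pd_hol k hB).
  by rewrite subr0 (le_lt_trans (nv_xscale _ _)).
suff : hgrad (fun q => int01 (fun t => B (xscale t%:C%C q))) q
    (fun k => int01 (fun t => w k t%:C%C (xscale t%:C%C q))) by move/hgrad_dfr.
apply: (@hgrad_of_quad _ _ _ _ (72 * cauchy_const ^+ 2 * M / l ^+ 2) l) => // h hl.
have hqh : nv (q + h) < r by have := nvD q h; lra.
have u1 := ucont_xscale_hol hB hqh; have u0 := ucont_xscale_hol hB hq.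
pose D t := B (xscale t%:C%C (q + h)) + ((-1) * B (xscale t%:C%C q) +
  ((- h ord0 o0) * w o0 t%:C%C (xscale t%:C%C q) + ((- h ord0 o1) * w o1 t%:C%C (xscale t%:C%C q) +
    (- h ord0 o2) * w o2 t%:C%C (xscale t%:C%C q)))).
have v2 : ucont (fun t => (- h ord0 o2) * w o2 t%:C%C (xscale t%:C%C q)) by apply: ucontZ.
have v1 : ucont (fun t => (- h ord0 o1) * w o1 t%:C%C (xscale t%:C%C q)) by apply: ucontZ.
have v0 : ucont (fun t => (- h ord0 o0) * w o0 t%:C%C (xscale t%:C%C q)) by apply: ucontZ.
have u0' : ucont (fun t => (-1) * B (xscale t%:C%C q)) by apply: ucontZ.
have v12 := ucontD v1 v2; have v012 := ucontD v0 v12; have v := ucontD u0' v012.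
have uD : ucont D by exact: ucontD.
have -> : int01 (fun t => B (xscale t%:C%C (q + h))) - int01 (fun t => B (xscale t%:C%C q)) -
    lin3 (fun k => int01 (fun t => w k t%:C%C (xscale t%:C%C q))) h = int01 D - 0.
  rewrite /D (int01D u1 v) (int01D u0' v012) (int01D v0 v12) (int01D v1 v2).
  by rewrite (int01Z _ u0) (int01Z _ (uw o0)) (int01Z _ (uw o1)) (int01Z _ (uw o2)) lin3E; ring.
apply: int01_bound => // t ht; rewrite subr0.
have hs : nv (xscale t%:C%C q) <= nv q by exact: nv_xscale.
have hs' : nv (xscale t%:C%C h) <= nv h by exact: nv_xscale.
have -> : D t = B (xscale t%:C%C q + xscale t%:C%C h) - B (xscale t%:C%C q) -
    lin3 (fun k => pd k B (xscale t%:C%C q)) (xscale t%:C%C h).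
  by rewrite /D xscaleD lin3E /w /= {3}/xscale !ptE; ring.
have dB p : nv (p - xscale t%:C%C q) <= 4 * l -> dfr B p.
  move=> hp; apply: hB; rewrite subr0; have := nvD (p - xscale t%:C%C q) (xscale t%:C%C q).
  by rewrite subrK; lra.
have {}BM p : nv (p - xscale t%:C%C q) <= 4 * l -> na (B p) <= M.
  move=> hp; apply: BM; have := nvD (p - xscale t%:C%C q) (xscale t%:C%C q).
  by rewrite subrK; lra.
have k1 : nv (xscale t%:C%C q - xscale t%:C%C q) <= l by rewrite subrr nv0 ltW.
have k2 : nv (xscale t%:C%C q + xscale t%:C%C h - xscale t%:C%C q) <= l.
  by rewrite addrAC subrr add0r; lra.
rewrite (le_trans (holo_quad l0 dB BM k1 k2))// ler_wpM2l//; last first.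
  by rewrite lerXn2r// ?nnegrE ?nv_ge0.
have M0 := bound_ge0 l0 BM.
by rewrite divr_ge0 ?sqr_ge0// mulr_ge0// mulr_ge0// sqr_ge0.
Qed.

Lemma prim_hol B r M : hol 0 r B -> (forall p, nv p < r -> na (B p) <= M) -> hol 0 r (prim B).
Proof.
move=> hB BM q; rewrite subr0 => hq; apply: dfrM; first exact: dfr_coord.
exact: int_xscale_dfr hB BM hq.
Qed.

(** Goursat's lemma on the triangle a, b, b + h turns the increment into the integral over the short
    side from b to b + h. *)
Lemma seg_int_cderiv (S : K -> Prop) (phi : K -> K) (a b : K) r : cclosed S -> cconvex S ->
  (forall z, S z -> exists d, cderiv phi z d) -> S a -> 0 < r ->
  (forall w, na w <= r -> S (b + w)) -> cderiv (fun z => seg_int phi a z) b (phi b).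
Proof.
move=> cS vS H Sa r0 Sb e e0.
have Sb0 : S b by rewrite -[b]addr0; apply: Sb; rewrite na0 ltW.
have [d /cderiv_ccont cb] := H b Sb0; have [r' r'0 Hr'] := cb e e0.
exists (Num.min r r'); first by rewrite lt_min r0.
move=> h; rewrite le_min => /andP[h1 h2].
have := goursat cS vS H Sa Sb0 (Sb h h1); rewrite /tri_int => HT.
have -> : seg_int phi a (b + h) - seg_int phi a b - phi b * h = seg_int phi b (b + h) - h * phi b.
  have -> : seg_int phi a (b + h) = seg_int phi a b + seg_int phi b (b + h).
    by have /eqP := HT; rewrite (seg_int_rev phi a (b + h)) subr_eq0 => /eqP ->.
  by ring.
rewrite /seg_int (_ : b + h - b = h); last by ring.
rewrite -mulrBr naM mulrC ler_wpM2r ?na_ge0//; apply: int01_bound.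
  by apply: ucont_seg => t ht; have [|d' /cderiv_ccont//] := H (seg b (b + h) t); apply: vS => //; exact: Sb.
move=> t /andP[t0 t1]; rewrite /seg; apply: Hr'; rewrite naM naC ger0_norm//.
rewrite (_ : b + h - b = h); last by ring.
by rewrite (le_trans _ h2)// ler_piMl ?na_ge0.
Qed.

Lemma disc_closed r : @cclosed R (fun z => na z <= r).
Proof.
move=> z H; apply/ler_addgt0Pr => e e0; have [w h wz] := H e e0.
by have := na_tri z w 0; rewrite !subr0 naBC; lra.
Qed.

Lemma disc_convex r : @cconvex R (fun z => na z <= r).
Proof.
by move=> a b t ha hb ht; have := @na_seg_dist _ a b t 0 r ht; rewrite !subr0; apply.
Qed.

Lemma pd_prim B r M q : hol 0 r B -> (forall p, nv p < r -> na (B p) <= M) -> nv q < r ->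
  pd o0 (prim B) q = B q.
Proof.
move=> hB BM hq.
pose y := q ord0 o1; pose z := q ord0 o2; pose phi x := B (pt x y z).
(* Strictly between [nv q] and [r]: the disc of radius [rho] leaves room for increments up to (r -
   nv q) / 2. *)
pose rho := (nv q + r) / 2.
have hphi x : na x <= rho -> exists d, cderiv phi x d.
  move=> hx; pose p := pt 0 y z.
  have -> : phi = (fun x => B (p + x *: pt 1 0 0)).
    by apply/funext => w; congr B; apply: V_ext; rewrite !(vD, vZ, ptE); ring.
  eexists; apply: hgrad_line; apply: diff_hgrad; apply: hB; rewrite subr0.
  apply: (@le_lt_trans _ _ rho); last by rewrite /rho; lra.
  have yz j : na (q ord0 j) <= rho by have := nv_coord q j; rewrite /rho; lra.
  apply: nv_le3; rewrite !(vD, vZ, ptE) ?mulr1 ?mulr0 ?add0r ?addr0; [exact: hx|exact: yz..].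
have H1 : cderiv (fun w => seg_int phi 0 w) (q ord0 o0) (phi (q ord0 o0)).
  apply: (@seg_int_cderiv (fun z => na z <= rho) _ _ _ ((r - nv q) / 2)); rewrite ?na0.
  - exact: disc_closed.
  - exact: disc_convex.
  - exact: hphi.
  - by have := nv_ge0 q; rewrite /rho; lra.
  - lra.
  - move=> h hh; have := naD (q ord0 o0) h; have := nv_coord q o0; rewrite /rho; lra.
have dP : dfr (prim B) q by apply: (prim_hol hB BM); rewrite subr0.
have := @hgrad_line _ (prim B) q (ej o0) 0 (fun j => pd j (prim B) q).
rewrite scale0r addr0 lin3_ej => /(_ (diff_hgrad dP)) H3.
have -> : B q = phi (q ord0 o0) by rewrite /phi /y /z pt_eta.
apply: cderiv_unique H3 _.
have e00 : ej o0 ord0 o0 = 1 :> K by rewrite mxE.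
have e01 : ej o0 ord0 o1 = 0 :> K by rewrite mxE.
have e02 : ej o0 ord0 o2 = 0 :> K by rewrite mxE.
have PE w : prim B (q + w *: ej o0) = seg_int phi 0 (q ord0 o0 + w).
  rewrite /prim /seg_int vD vZ e00 mulr1 subr0; congr (_ * int01 _); apply/funext => t.
  rewrite /phi /seg /y /z; congr B; apply: V_ext; rewrite !(ptE, vD, vZ) ?e00 ?e01 ?e02; ring.
move=> e e0; have [s s0 Hs] := H1 e e0; exists s => // h /Hs.
by rewrite !PE add0r addr0.
Qed.

End Primitive.

(** * Fixed points: holomorphic flows and implicit functions *)

Section Contraction.
Context {R : realType}.
Local Notation K := R[i].
Local Notation V := (C3 R).
Implicit Types (u v h p q c : V) (f g A H Psi Phi : V -> K) (e r t M d : R) (s : K).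

Definition near_cst c r s d Psi := hol c r Psi /\ forall q, nv (q - c) < r -> na (Psi q - s) <= d.

(** The iterates of the constant [s] converge at each point at a geometric rate uniform on the ball,
    and [uniform_limit_hol] makes the limit holomorphic. *)
Lemma contraction_fixpoint c r s d (T : (V -> K) -> V -> K) : 0 <= d ->
  (forall Psi, near_cst c r s d Psi -> near_cst c r s d (T Psi)) ->
  (forall Psi Phi e, near_cst c r s d Psi -> near_cst c r s d Phi ->
     (forall q, nv (q - c) < r -> na (Psi q - Phi q) <= e) ->
     forall q, nv (q - c) < r -> na (T Psi q - T Phi q) <= e / 2) ->
  exists2 Psi, near_cst c r s d Psi & forall q, nv (q - c) < r -> T Psi q = Psi q.
Proof.
move=> d0 HX HT.
pose P n := iter n T (fun=> s).
have XP n : near_cst c r s d (P n).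
  elim: n => [|n IH]; last exact: HX.
  by split=> [q _|q _]; [exact: dfr_cst|rewrite subrr na0].
have step n q : nv (q - c) < r -> na (P n.+1 q - P n q) <= 2 * d * 2^-1 ^+ n.
  elim: n q => [|n IH] q hq.
    rewrite expr0 mulr1 (le_trans (na_tri _ s _))//.
    have := (XP 1%N).2 q hq; have := (XP 0%N).2 q hq; rewrite (naBC s (P 0%N q)); lra.
  have := HT _ _ _ (XP n.+1) (XP n) IH q hq.
  by rewrite exprSr -!mulrA.
(* Outside the ball the limit function takes the default value 0. *)
have lim q : exists z, nv (q - c) < r -> forall n, na (P n q - z) <= 2 * (2 * d) * 2^-1 ^+ n.
  have [hq|hq] := ltP (nv (q - c)) r; last by exists 0.
  by have [z Hz] := geometric_limit (fun n => step n q hq); exists z.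
have [Psi HPsi] := choice lim.
have small e : 0 < e -> exists N, forall n, (N <= n)%N -> 2 * (2 * d) * 2^-1 ^+ n <= e.
  move=> e0; have c0 : 0 < 4 * d + 1 by lra.
  have [|N hN] := @half_pow_lt R (e / (4 * d + 1)); first by rewrite divr_gt0.
  exists N => n Nn; have : (2^-1 : R) ^+ n <= 2^-1 ^+ N.
    by apply: ler_wiXn2l => //; lra.
  move: hN; rewrite ltr_pdivlMr// => hN hn.
  have : 0 <= (2^-1 : R) ^+ n by rewrite exprn_ge0// invr_ge0.
  nra.
have hPsi : hol c r Psi.
  apply: (@uniform_limit_hol _ P _ _ _ (na s + d)); first by move=> n; exact: (XP n).1.
    move=> n p hp; have := (XP n).2 p hp; have := naD (P n p - s) s; rewrite subrK; lra.
  move=> e /small[N HN]; exists N => n /HN hn p hp.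
  by rewrite (le_trans (HPsi p hp n)).
have XPsi : near_cst c r s d Psi.
  split => // q hq; apply/ler_addgt0Pr => e /small[N HN].
  have := HPsi q hq N; have := (XP N).2 q hq; have := HN N (leqnn N).
  by have := na_tri (Psi q) (P N q) s; rewrite (naBC (Psi q) (P N q)); lra.
exists Psi => // q hq; apply/eqP; rewrite -subr_eq0; apply/eqP/na_small => e e0.
have [|N HN] := small (e / 2); first by rewrite divr_gt0.
have h1 : na (T Psi q - P N.+1 q) <= e / 2 / 2.
  apply: (HT _ _ _ XPsi (XP N)) => // x hx.
  by rewrite naBC (le_trans (HPsi x hx N))// HN.
have h2 : na (P N.+1 q - Psi q) <= e / 2 by rewrite (le_trans (HPsi q hq N.+1))// HN.
by have := na_tri (T Psi q) (P N.+1 q) (Psi q); lra.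
Qed.

Lemma hol_sub q r r' f : r' <= r -> hol q r f -> hol q r' f.
Proof. by move=> rr hf p hp; apply: hf; lra. Qed.

Lemma nv_pt_le (x y z : K) e : na x <= e -> na y <= e -> na z <= e -> nv (pt x y z) <= e.
Proof. by move=> h0 h1 h2; apply: nv_le3; rewrite ptE. Qed.

Lemma nv_pt_lt (x y z : K) e : na x < e -> na y < e -> na z < e -> nv (pt x y z) < e.
Proof. by move=> h0 h1 h2; apply: nv_lt3; rewrite ptE. Qed.

Lemma coord_lt v e j : nv v < e -> na (v ord0 j) < e.
Proof. exact: le_lt_trans (nv_coord v j). Qed.

Lemma ptB (x y z x' y' z' : K) : pt x y z - pt x' y' z' = pt (x - x') (y - y') (z - z').
Proof. by apply: V_ext; rewrite !(vB, ptE). Qed.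

(** Picard's integral equation: Z = z + U where U is the primitive in x of A(x, y, z + U). The
    parameters y and z are coordinates of the same function, so holomorphic dependence on them needs
    no separate argument. *)
Lemma ode_flow A r : 0 < r -> hol 0 r A -> exists r' Z, [/\ 0 < r' <= r, hol 0 r' Z &
  forall q, nv q < r' -> [/\ nv (pt (q ord0 o0) (q ord0 o1) (Z q)) < r,
    pd o0 Z q = A (pt (q ord0 o0) (q ord0 o1) (Z q)) &
    (q ord0 o0 = 0 -> Z q = q ord0 o2)]].
Proof.
move=> r0 hA.
have [|r1 r10 AM] := @hol_locally_bounded _ A 0; first by apply: hA; rewrite subrr nv0.
set M := na (A 0) + 1 in AM; have M0 : 0 < M by rewrite ltr_wpDl ?na_ge0.
have [l [l0 lr lr1]] : exists l, [/\ 0 < l, 4 * l < r & 4 * l < r1].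
  exists (Num.min r r1 / 5).
  have m0 : 0 < Num.min r r1 by rewrite lt_min r0.
  have [m1 m2] : Num.min r r1 <= r /\ Num.min r r1 <= r1 by rewrite !ge_min !lexx orbT.
  by split; lra.
have dA p : nv (p - 0) <= 4 * l -> dfr A p by move=> hp; apply: hA; lra.
have {}AM p : nv (p - 0) <= 4 * l -> na (A p) <= M by move=> hp; apply: AM; lra.
pose L := 6 * cauchy_const * M / l; have L0 : 0 < L by rewrite divr_gt0// mulr_gt0// mulr_gt0// cauchy_const_gt0.
(* [r' * M <= l] keeps the iterates bounded by [l], and [r' * L <= 2^-1] makes the map a
   contraction. *)
have [r' [r'0 r'l r'M r'L]] : exists r', [/\ 0 < r', r' <= l, r' * M <= l & r' * L <= 2^-1].
  exists (Num.min l (Num.min (l / M) (2^-1 / L))); split.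
  - have h2 : 0 < 2^-1 :> R by rewrite invr_gt0.
    by rewrite !lt_min l0 (divr_gt0 l0 M0) (divr_gt0 h2 L0).
  - by rewrite ge_min lexx.
  - by rewrite -ler_pdivlMr// !ge_min lexx orbT.
  - by rewrite -ler_pdivlMr// !ge_min lexx !orbT.
have LE : 6 * cauchy_const * M / l = L by [].
clearbody L.
pose G U q := A (pt (q ord0 o0) (q ord0 o1) (q ord0 o2 + U q)).
have ptl U q : nv q < r' -> na (U q - 0) <= l ->
    nv (pt (q ord0 o0) (q ord0 o1) (q ord0 o2 + U q) - 0) <= 2 * l.
  move=> hq hU; rewrite subr0; have hj j := coord_lt j hq; rewrite subr0 in hU.
  apply: nv_pt_le; [have := hj o0; lra|have := hj o1; lra|].
  by have := naD (q ord0 o2) (U q); have := hj o2; lra.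
have hG U : near_cst 0 r' 0 l U -> hol 0 r' (G U).
  move=> [hU Ul] q hq; apply: dfr_comp3; [|exact: dfr_coord|exact: dfr_coord|].
    apply: dA; have := Ul q hq; rewrite subr0 in hq => hUq.
    by have := ptl U q hq hUq; lra.
  by apply: dfrD; [exact: dfr_coord|exact: hU].
have GM U : near_cst 0 r' 0 l U -> forall q, nv q < r' -> na (G U q) <= M.
  move=> [hU Ul] q hq; apply: AM; have := Ul q; rewrite subr0 => /(_ hq) hUq.
  by have := ptl U q hq hUq; lra.
have uG U q : near_cst 0 r' 0 l U -> nv q < r' -> ucont (fun t => G U (xscale t%:C%C q)).
  by move=> /hG hg hq; exact: (ucont_xscale_hol hg hq).
have [U XU TU] : exists2 U, near_cst 0 r' 0 l U &
    forall q, nv (q - 0) < r' -> prim (G U) q = U q.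
  apply: contraction_fixpoint; first exact: ltW.
    move=> U XU; split; first exact: prim_hol (hG U XU) (GM U XU).
    move=> q; rewrite !subr0 => hq; rewrite /prim naM -[int01 _]subr0.
    apply: le_trans r'M; apply: ler_pM; rewrite ?na_ge0//.
      by rewrite ltW// coord_lt.
    apply: int01_bound; first exact: uG.
    by move=> t ht; rewrite subr0 (GM U XU)// (le_lt_trans (nv_xscale _ _)).
  move=> U W e XU XW UW q; rewrite subr0 => hq.
  have e0 : 0 <= e by apply: le_trans (UW q _); rewrite ?na_ge0 ?subr0.
  rewrite /prim -mulrBr naM; apply: (@le_trans _ _ (r' * (L * e))); last by nra.
  apply: ler_pM; rewrite ?na_ge0//; first by rewrite ltW// coord_lt.
  rewrite -mulN1r -(int01Z (-1) (uG W q XW hq)) -(int01D (uG U q XU hq) (ucontZ (-1) (uG W q XW hq))).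
  rewrite -[int01 _]subr0; apply: int01_bound.
    exact: ucontD (uG U q XU hq) (ucontZ (-1) (uG W q XW hq)).
  move=> t ht; rewrite subr0 mulN1r; set x := xscale _ q.
  have hx : nv x < r' by rewrite (le_lt_trans (nv_xscale _ _)).
  have := XU.2 x; have := XW.2 x; rewrite subr0 => /(_ hx) h1 /(_ hx) h2.
  apply: (le_trans (holo_lip l0 dA AM (ptl W x hx h1) (ptl U x hx h2))).
  rewrite LE ptB !subrr ler_wpM2l ?(ltW L0)//.
  apply: nv_pt_le; rewrite ?na0//.
  by rewrite (_ : _ - _ = U x - W x); [apply: UW; rewrite subr0|ring].
pose Z q := q ord0 o2 + U q.
have hZ : hol 0 r' Z by move=> q hq; apply: dfrD; [exact: dfr_coord|exact: XU.1].
exists r', Z; split => //; first by rewrite r'0 /=; lra.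
move=> q hq; have hq' : nv (q - 0) < r' by rewrite subr0.
split.
- by have := ptl U q hq (XU.2 q hq'); rewrite subr0 /Z; lra.
- have dP : dfr (prim (G U)) q by apply: (prim_hol (hG U XU) (GM U XU)).
  have hU : hgrad U q (fun j => pd j (prim (G U)) q).
    apply: (@hgrad_near _ (prim (G U)) U q _ (r' - nv q)); first by lra.
      by move=> p hp; apply: TU; rewrite subr0; have := nvD (p - q) q; rewrite subrK; lra.
    exact: diff_hgrad.
  rewrite (hgrad_pd o0 (hgradD (hgrad_coord o2 q) hU)) /= add0r.
  by rewrite (pd_prim (hG U XU) (GM U XU)).
- by move=> q0; rewrite /Z -TU// /prim q0 mul0r addr0.
Qed.

(* Newton iteration with the derivative frozen at the base point. *)
Lemma implicit_function H c r : 0 < r -> hol c r H -> pd o2 H c != 0 ->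
  let c' := pt (c ord0 o0) (c ord0 o1) (H c) in
  exists r' S, [/\ 0 < r', hol c' r' S,
    forall q, nv (q - c') < r' -> nv (pt (q ord0 o0) (q ord0 o1) (S q) - c) < r /\
      H (pt (q ord0 o0) (q ord0 o1) (S q)) = q ord0 o2 &
    exists2 r2, 0 < r2 & forall p, nv (p - c) < r2 ->
      nv (pt (p ord0 o0) (p ord0 o1) (H p) - c') < r' /\
      S (pt (p ord0 o0) (p ord0 o1) (H p)) = p ord0 o2].
Proof.
move=> r0 hH D0 c'; set D := pd o2 H c in D0.
have nD : 0 < na D by rewrite lt_def na_eq0 D0 na_ge0.
(* The last partial derivative of [g] vanishes at [c], so [g] contracts in the last coordinate near
   [c]. *)
pose g p := p ord0 o2 - D^-1 * H p.
have hg : hol c r g.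
  by move=> p hp; apply: dfrB; [exact: dfr_coord|apply: dfrM; [exact: dfr_cst|exact: hH]].
have cc : nv (c - c) < r by rewrite subrr nv0.
have gc : pd o2 g c = 0.
  rewrite (hgrad_pd o2 (hgradB (hgrad_coord o2 c) (hgradZ D^-1 (diff_hgrad (hH c cc))))) /=.
  by rewrite -/D mulVf// subrr.
(* 1/4 because [hgrad_mean] loses a factor 2 and the contraction requires 1/2. *)
have [|r1 r10 g1] := dfr_ctn (pd_dfr o2 r0 hg) (e := 4^-1); first by lra.
have [d [d0 dr dr1]] : exists d, [/\ 0 < d, d < r & d < r1].
  exists (Num.min r r1 / 2).
  have m0 : 0 < Num.min r r1 by rewrite lt_min r0.
  have [m1 m2] : Num.min r r1 <= r /\ Num.min r r1 <= r1 by rewrite !ge_min !lexx orbT.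
  by split; lra.
have gctr (x y z z' : K) : na (x - c ord0 o0) <= d -> na (y - c ord0 o1) <= d ->
    na (z - c ord0 o2) <= d -> na (z' - c ord0 o2) <= d ->
    na (g (pt x y z) - g (pt x y z')) <= na (z - z') / 2.
  move=> hx hy hz hz'.
  have -> : na (z - z') / 2 = 2 * (4^-1 * na (z - z')) by field.
  have pc w : na (w - c ord0 o2) <= d -> nv (pt x y w - c) <= d.
    by move=> hw; rewrite -(pt_eta c) ptB; apply: nv_pt_le.
  apply: (@hgrad_mean _ g (pt x y z') (pt x y z) (fun x j => pd j g x)) => t ht p.
  have hp : nv (p - c) <= d by apply: nv_seg; rewrite ?pc.
  split; first by apply: diff_hgrad; apply: hg; exact: le_lt_trans hp dr.
  rewrite ptB !subrr lin3E !ptE !mulr0 !add0r naM ler_wpM2r ?na_ge0//.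
  by have := g1 p (le_trans hp (ltW dr1)); rewrite gc subr0.
(* Two errors of size |D| d / 4, one from [H] and one from its prescribed value, displace the
   iterate by at most d / 2; the contraction adds at most d / 2 more. *)
have [|r3 r30 H3] := dfr_ctn (hH c cc) (e := na D * d / 4).
  by rewrite divr_gt0// mulr_gt0.
have [r' [r'0 r'd r'3 r'D]] : exists r', [/\ 0 < r', r' <= d, r' <= r3 & r' <= na D * d / 4].
  exists (Num.min d (Num.min r3 (na D * d / 4))); split.
  - by rewrite !lt_min d0 r30 divr_gt0// mulr_gt0.
  - by rewrite ge_min lexx.
  - by rewrite !ge_min lexx orbT.
  - by rewrite !ge_min lexx !orbT.
pose T (S : V -> K) q := g (pt (q ord0 o0) (q ord0 o1) (S q)) + D^-1 * q ord0 o2.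
have qc q : nv (q - c') < r' -> [/\ na (q ord0 o0 - c ord0 o0) < r',
    na (q ord0 o1 - c ord0 o1) < r' & na (q ord0 o2 - H c) < r'].
  move=> hq; have hj j := coord_lt j hq; have := hj o0; have := hj o1; have := hj o2.
  by rewrite !vB !ptE; split.
have ptc q (s : K) : nv (q - c') < r' -> na (s - c ord0 o2) <= d ->
    nv (pt (q ord0 o0) (q ord0 o1) s - c) <= d.
  by move=> /qc[h0 h1 _] hs; rewrite -(pt_eta c) ptB; apply: nv_pt_le; lra.
have [S XS TS] : exists2 S, near_cst c' r' (c ord0 o2) d S &
    forall q, nv (q - c') < r' -> T S q = S q.
  apply: contraction_fixpoint; first exact: ltW.
    move=> S [hS Sd]; split=> q hq.
      apply: dfrD; last by apply: dfrM; [exact: dfr_cst|exact: dfr_coord].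
      apply: dfr_comp3; [|exact: dfr_coord|exact: dfr_coord|exact: hS].
      by apply: hg; exact: le_lt_trans (ptc q (S q) hq (Sd q hq)) dr.
    have [h0 h1 h2] := qc q hq.
    have i1 : na (g (pt (q ord0 o0) (q ord0 o1) (S q)) -
        g (pt (q ord0 o0) (q ord0 o1) (c ord0 o2))) <= na (S q - c ord0 o2) / 2.
      by apply: gctr; rewrite ?subrr ?na0 ?Sd//; lra.
    set x := pt (q ord0 o0) (q ord0 o1) (c ord0 o2) in i1.
    have i2 : na (H x - H c) <= na D * d / 4.
      apply: H3; rewrite -(pt_eta c) ptB subrr; apply: nv_pt_le; rewrite ?na0; lra.
    have i3 : na (D^-1 * (q ord0 o2 - H x)) <= d / 2.
      rewrite naM naV mulrC ler_pdivrMr//.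
      by have := na_tri (q ord0 o2) (H c) (H x); rewrite (naBC (H c) (H x)); lra.
    have -> : T S q - c ord0 o2 = (g (pt (q ord0 o0) (q ord0 o1) (S q)) - g x) +
        D^-1 * (q ord0 o2 - H x) by rewrite /T {3}/g /x ptE; ring.
    by rewrite (le_trans (naD _ _))//; have := Sd q hq; lra.
  move=> S S' e [_ Sd] [_ Sd'] SS q hq; have [h0 h1 h2] := qc q hq.
  rewrite /T (_ : _ - _ = g (pt (q ord0 o0) (q ord0 o1) (S q)) -
     g (pt (q ord0 o0) (q ord0 o1) (S' q))); last by ring.
  apply: le_trans (gctr _ _ _ _ _ _ (Sd q hq) (Sd' q hq)) _; try lra.
  by have := SS q hq; lra.
exists r', S; split => //; first exact: XS.1.
  move=> q hq; split; first exact: le_lt_trans (ptc q (S q) hq (XS.2 q hq)) dr.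
  have := TS q hq; rewrite /T /g ptE => /eqP; rewrite -subr_eq0.
  set s := S q; set x := H _; rewrite (_ : _ - s = D^-1 * (q ord0 o2 - x)); last by ring.
  by rewrite mulf_eq0 invr_eq0 (negbTE D0) /= subr_eq0 => /eqP.
have [|r4 r40 H4] := dfr_ctn (hH c cc) (e := r' / 2); first by rewrite divr_gt0.
exists (Num.min r' r4); first by rewrite lt_min r'0.
move=> p; rewrite lt_min => /andP[p1 p2].
have hj j := coord_lt j p1.
have hp' : nv (pt (p ord0 o0) (p ord0 o1) (H p) - c') < r'.
  rewrite ptB; apply: nv_pt_lt; rewrite -?vB//.
  by have := H4 p (ltW p2); lra.
split => //; set q := pt _ _ (H p) in hp' *.
have [q0 q1 q2] : [/\ q ord0 o0 = p ord0 o0, q ord0 o1 = p ord0 o1 & q ord0 o2 = H p].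
  by rewrite /q !ptE.
have e1 := TS q hp'; have e2 : g p + D^-1 * H p = p ord0 o2 by rewrite /g subrK.
have [h0 h1 h2] := qc q hp'.
(* Local uniqueness: [S q] and [p ord0 o2] are fixed points of the same contraction, so their
   distance is at most half of itself. *)
have h : na (S q - p ord0 o2) <= na (S q - p ord0 o2) / 2.
  rewrite -{1}e1 -{1}e2 /T q2 (_ : _ - _ = g (pt (q ord0 o0) (q ord0 o1) (S q)) - g p);
    last by ring.
  have -> : p = pt (q ord0 o0) (q ord0 o1) (p ord0 o2) by rewrite q0 q1 pt_eta.
  rewrite ptE; apply: gctr; [lra|lra|exact: XS.2|].
  by have := hj o2; rewrite vB; lra.
apply/eqP; rewrite -subr_eq0 -na_eq0; apply/eqP.
by have := na_ge0 (S q - p ord0 o2); lra.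
Qed.

End Contraction.

(** * Polynomial Legendrian curves of [dw = u dy] *)

Section LegendrianPolynomials.
Context {R : realType}.
Local Notation K := R[i].
Implicit Types (x y z t d : K) (e r : R).

Lemma cderiv_val (F : K -> K) z d d' : cderiv F z d -> d = d' -> cderiv F z d'.
Proof. by move=> ? <-. Qed.

Lemma cderivX n z : cderiv (fun w : K => w ^+ n.+1) z (n.+1%:R * z ^+ n).
Proof.
elim: n => [|n IH].
  by rewrite expr0 mulr1; under eq_fun do rewrite expr1; exact: cderiv_id.
under eq_fun do rewrite exprS; apply: cderiv_val (cderivM (cderiv_id z) IH) _.
by rewrite mul1r mulrCA -exprS -[X in X + _]mul1r -mulrDl -(natrD _ 1).
Qed.

Definition quintic (c0 c1 c2 c3 c4 c5 t : K) : K :=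
  c0 + c1 * t + c2 * t ^+ 2 + c3 * t ^+ 3 + c4 * t ^+ 4 + c5 * t ^+ 5.

Lemma quintic_cderiv c0 c1 c2 c3 c4 c5 t : cderiv (quintic c0 c1 c2 c3 c4 c5) t
  (c1 + 2 * c2 * t + 3 * c3 * t ^+ 2 + 4 * c4 * t ^+ 3 + 5 * c5 * t ^+ 4).
Proof.
have m c n := cderivM (cderiv_cst c t) (cderivX n t).
have m1 := cderivM (cderiv_cst c1 t) (cderiv_id t).
apply: cderiv_val (cderivD (cderivD (cderivD (cderivD (cderivD (cderiv_cst c0 t) m1) (m c2 1%N)) (m c3 2%N)) (m c4 3%N)) (m c5 4%N)) _.
by ring.
Qed.

(** Five terms, with powers of t bounded by 2^5 = 32. *)
Lemma quintic_bound c0 c1 c2 c3 c4 c5 t e : na t < 2 -> na c1 <= e -> na c2 <= e ->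
  na c3 <= e -> na c4 <= e -> na c5 <= e -> na (quintic c0 c1 c2 c3 c4 c5 t - c0) <= 160 * e.
Proof.
move=> t2 h1 h2 h3 h4 h5; have e0 : 0 <= e by apply: le_trans (na_ge0 _) h1.
have t0 := na_ge0 t.
have m c n : na c <= e -> (n <= 5)%N -> na (c * t ^+ n) <= 32 * e.
  move=> hc n5; rewrite naM mulrC ler_pM ?na_ge0//.
  have naX k : na (t ^+ k) = na t ^+ k.
    by elim: k => [|k IH]; rewrite ?expr0 ?na1// !exprS naM IH.
  rewrite naX; apply: (@le_trans _ _ (2 ^+ n)); first by rewrite lerXn2r// ?nnegrE// ltW.
  by rewrite (_ : 32 = 2 ^+ 5); [rewrite ler_weXn2l//; lra|ring].
have -> : quintic c0 c1 c2 c3 c4 c5 t - c0 =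
  c1 * t ^+ 1 + c2 * t ^+ 2 + c3 * t ^+ 3 + c4 * t ^+ 4 + c5 * t ^+ 5 by rewrite /quintic; ring.
have := m c1 1%N h1 isT; have := m c2 2%N h2 isT; have := m c3 3%N h3 isT.
have := m c4 4%N h4 isT; have := m c5 5%N h5 isT.
set x1 := c1 * _; set x2 := c2 * _; set x3 := c3 * _; set x4 := c4 * _; set x5 := c5 * _.
have := naD (x1 + x2 + x3 + x4) x5; have := naD (x1 + x2 + x3) x4.
have := naD (x1 + x2) x3; have := naD x1 x2.
clear; lra.
Qed.

(* The endpoint is reached by y = y0 + a t + s t (1 - t), u = u0 + b t + k t (1 - t) (1 - 2 t)
   and w = w0 + \int_0^t u dy: as \int_0^1 u dy = u0 a + a b / 2 - b s / 6 + k s / 30,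
   a fixed small s > 0 leaves k to adjust the value of w at t = 1. *)
Lemma legendrian_connection (y0 u0 w0 : K) (eta : R) : 0 < eta -> exists2 rho, 0 < rho &
  forall y1 u1 w1 : K, na (y1 - y0) <= rho -> na (u1 - u0) <= rho -> na (w1 - w0) <= rho ->
  exists y u w dy du : K -> K, [/\ [/\ y 0 = y0, u 0 = u0 & w 0 = w0],
    [/\ y 1 = y1, u 1 = u1 & w 1 = w1],
    forall t, [/\ cderiv y t (dy t), cderiv u t (du t) & cderiv w t (u t * dy t)] &
    forall t, na t < 2 -> [/\ na (y t - y0) < eta, na (u t - u0) < eta & na (w t - w0) < eta]].
Proof.
move=> eta0; pose U := na u0; have U0 : 0 <= U by exact: na_ge0.
(* [(2 * U + 5) * s] will bound every non-constant coefficient of the three polynomials; 160 comes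
   from [quintic_bound]. *)
have [s [s0 s1 sU]] : exists s, [/\ 0 < s, s <= 1 & 160 * ((2 * U + 5) * s) < eta].
  have c0 : 0 < 160 * (2 * U + 5) + 1 by lra.
  exists (Num.min 1 (eta / (160 * (2 * U + 5) + 1))); split.
  - by rewrite lt_min ltr01 divr_gt0.
  - by rewrite ge_min lexx.
  have : Num.min 1 (eta / (160 * (2 * U + 5) + 1)) <= eta / (160 * (2 * U + 5) + 1).
    by rewrite ge_min lexx orbT.
  have : 0 < Num.min 1 (eta / (160 * (2 * U + 5) + 1)) by rewrite lt_min ltr01 divr_gt0.
  by set x := Num.min _ _; rewrite ler_pdivlMr//; lra.
have c30 : 0 < 30 * (U + 2) by lra.
(* Of order s^2, because [k] is 30 / s times a quantity of order [rho] and has to be at most s. *)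
pose rho := s ^+ 2 / (30 * (U + 2)).
have rho0 : 0 < rho by rewrite divr_gt0// exprn_gt0.
have rhoE : rho * (30 * (U + 2)) = s ^+ 2 by rewrite /rho divfK// gt_eqF.
have rhos : rho <= s.
  rewrite /rho ler_pdivrMr// expr2 ler_pM2l//; lra.
clearbody rho.
exists rho => // y1 u1 w1.
set a := y1 - y0; set b := u1 - u0; set D := w1 - w0 => ha hb hD.
have sC : s%:C%C != 0 :> K by rewrite realC_neq0// gt_eqF.
have nsC : na s%:C%C = s by rewrite naC gtr0_norm.
set sc := s%:C%C in sC nsC.
pose k := 30 / sc * (D - u0 * a - a * b / 2 + b * sc / 6).
have hk : na k <= s.
  rewrite /k naM naM naV nsC na_nat.
  rewrite [leLHS](_ : _ = (30 * na (D - u0 * a - a * b / 2 + b * sc / 6)) / s); last by ring.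
  rewrite ler_pdivrMr// -expr2 -rhoE.
  have n1 : na (u0 * a) <= U * rho by rewrite naM ler_wpM2l.
  have n2 : na (a * b / 2) <= rho / 2.
    rewrite naM naV na_nat naM ler_wpM2r// -[leRHS]mulr1 ler_pM ?na_ge0//; lra.
  have n3 : na (b * sc / 6) <= rho / 6.
    rewrite naM naV na_nat naM ler_wpM2r// -[leRHS]mulr1 ler_pM ?na_ge0// nsC; lra.
  have := naD (D - u0 * a - a * b / 2) (b * sc / 6); have := naB (D - u0 * a) (a * b / 2).
  have := naB D (u0 * a); lra.
have {}ha : na a <= s by lra.
have {}hb : na b <= s by lra.
have prod x y : na x <= s -> na y <= s -> na (x * y) <= s.
  by move=> hx hy; rewrite naM -[leRHS]mulr1 ler_pM ?na_ge0//; lra.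
have scs : na sc <= s by rewrite nsC.
have Us : 0 <= U * s by rewrite mulr_ge0// ltW.
have nh x (m n : nat) : na (m%:R / n%:R * x) = m%:R / n%:R * na x.
  by rewrite naM naM naV !na_nat.
pose C := (2 * U + 5) * s.
have CE : C = 2 * (U * s) + 5 * s by rewrite /C; ring.
pose y := quintic y0 (a + sc) (- sc) 0 0 0.
pose u := quintic u0 (b + k) (- (3 * k)) (2 * k) 0 0.
(* The expansion of [w0] plus the integral of u dy. Rational factors are written [m%:R / n%:R] so
   that [nh] computes their moduli. *)
pose w := quintic w0 (u0 * (a + sc))
  (- (u0 * sc) + (1%:R / 2%:R * (b * a) + 1%:R / 2%:R * (b * sc) + (1%:R / 2%:R * (k * a) + 1%:R / 2%:R * (k * sc))))
  (- (2%:R / 3%:R * (b * sc)) - k * a - 5%:R / 3%:R * (k * sc))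
  (1%:R / 2%:R * (k * a) + 2%:R / 1%:R * (k * sc)) (- (4%:R / 5%:R * (k * sc))).
exists y, u, w, (fun t => (a + sc) + 2 * (- sc) * t),
  (fun t => (b + k) + 2 * (- (3 * k)) * t + 3 * (2 * k) * t ^+ 2).
split.
- by split; rewrite /y /u /w /quintic; ring.
- split.
  + by rewrite /y /quintic /a; ring.
  + by rewrite /u /quintic /b; ring.
  + rewrite (_ : w 1 = w0 + (u0 * a + a * b / 2 - b * sc / 6 + k * sc / 30)); last first.
      by rewrite /w /quintic; field.
    have -> : k * sc / 30 = D - u0 * a - a * b / 2 + b * sc / 6 by rewrite /k; field.
    by rewrite /D; ring.
- move=> t; split.
  + by apply: cderiv_val (quintic_cderiv _ _ _ _ _ _ _) _; ring.
  + by apply: cderiv_val (quintic_cderiv _ _ _ _ _ _ _) _; ring.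
  + by apply: cderiv_val (quintic_cderiv _ _ _ _ _ _ _) _; rewrite /u /quintic; field.
have C0 : 0 <= C by rewrite CE; lra.
have z0 : na (0 : K) <= C by rewrite na0.
have b2 x x' : na (x + x') <= na x + na x' by exact: naD.
have u_s x : na x <= s -> na (u0 * x) <= U * s by move=> hx; rewrite naM ler_wpM2l.
move=> t ht; split; apply: le_lt_trans sU; apply: quintic_bound => //; rewrite -/C CE.
- by have := naD a sc; lra.
- by rewrite naN; lra.
- by have := naD b k; lra.
- by rewrite naN naM na_nat; lra.
- by rewrite naM na_nat; lra.
- by rewrite mulrDr; have := naD (u0 * a) (u0 * sc); have := u_s _ ha; have := u_s _ scs; lra.
- set p1 := _ * (b * a); set p2 := _ * (b * sc); set p3 := _ * (k * a); set p4 := _ * (k * sc).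
  have := naD (- (u0 * sc)) (p1 + p2 + (p3 + p4)); have := naD (p1 + p2) (p3 + p4).
  have := naD p1 p2; have := naD p3 p4; rewrite naN.
  have := u_s _ scs; have := prod _ _ hb ha; have := prod _ _ hb scs.
  have := prod _ _ hk ha; have := prod _ _ hk scs; rewrite /p1 /p2 /p3 /p4 !nh; lra.
- set p1 := _ * (b * sc); set p4 := _ * (k * sc).
  have := naB (- p1 - k * a) p4; have := naB (- p1) (k * a); rewrite naN.
  have := prod _ _ hb scs.
  have := prod _ _ hk ha; have := prod _ _ hk scs; rewrite /p1 /p4 !nh; lra.
- set p1 := _ * (k * a); set p4 := _ * (k * sc).
  have := naD p1 p4.
  have := prod _ _ hk ha; have := prod _ _ hk scs; rewrite /p1 /p4 !nh; lra.
- by rewrite naN nh; have := prod _ _ hk scs; lra.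
Qed.

End LegendrianPolynomials.

(** * Plane fields [dz = A dx + B dy]: first integrals or connecting curves *)

Section PlaneFields.
Context {R : realType}.
Local Notation K := R[i].
Local Notation V := (C3 R).
Implicit Types (u v h p q c : V) (f g A B F : V -> K) (e r : R) (x y z : K).

Lemma pd_o2_id f r : 0 < r -> dfr f 0 -> (forall z, na z < r -> f (pt 0 0 z) = z) ->
  pd o2 f 0 = 1.
Proof.
move=> r0 df H.
have := @hgrad_line _ f 0 (ej o2) 0 (fun j => pd j f 0).
rewrite scale0r addr0 lin3_ej => /(_ (diff_hgrad df)) H1.
apply: cderiv_unique H1 _; apply: (cderiv_eq (cderiv_id 0)) => //.
exists (r / 2) => [|w hw]; first by lra.
have -> : 0 + (0 + w) *: ej o2 = pt 0 0 w :> V.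
  by apply: V_ext; rewrite !(vD, vZ, ptE) !mxE /=; ring.
by rewrite add0r H//; lra.
Qed.

Lemma neq0_near f c : dfr f c -> f c != 0 -> exists2 r, 0 < r &
  forall q, nv (q - c) < r -> f q != 0.
Proof.
move=> df f0; have n0 : 0 < na (f c) by rewrite lt_def na_eq0 f0 na_ge0.
have [|r r0 Hr] := dfr_ctn df (e := na (f c) / 2); first by lra.
exists r => // q /ltW/Hr; apply: contraTneq => ->.
by rewrite sub0r naN -ltNge; lra.
Qed.

(** Functions of [t] are read as functions on [C3] of the first coordinate alone, so that
    [hgrad_comp3] applies. *)
Lemma cderiv_comp3 f (X Y Z : K -> K) t a dx dy dz : hgrad f (pt (X t) (Y t) (Z t)) a ->
  cderiv X t dx -> cderiv Y t dy -> cderiv Z t dz ->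
  cderiv (fun s => f (pt (X s) (Y s) (Z s))) t (a o0 * dx + a o1 * dy + a o2 * dz).
Proof.
move=> Hf HX HY HZ; pose q : V := 0 + t *: ej o0.
have e00 (s : K) : (0 + s *: ej o0 : V) ord0 o0 = s.
  by rewrite vD vZ !mxE /= add0r mulr1.
have lift (W : K -> K) d : cderiv W t d ->
    hgrad (fun v : V => W (v ord0 o0)) q (fun k => d * (k == o0)%:R).
  by move=> HW; apply: hgrad_cderiv (hgrad_coord o0 q); rewrite e00.
have := @hgrad_comp3 _ f _ _ _ q a _ _ _ _ (lift X dx HX) (lift Y dy HY) (lift Z dz HZ).
rewrite !e00 => /(_ Hf)/hgrad_line; rewrite lin3_ej eqxx !mulr1.
by under eq_fun do rewrite !e00.
Qed.

(** On x = 0 the flow is the identity in w, so dZ/dw = 1 at the origin and remains nonzero on a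
    smaller ball, where (x, y, w) are local coordinates. *)
Lemma flow_box A r : 0 < r -> hol 0 r A -> exists r' Z, [/\ 0 < r', hol 0 r' Z &
  forall q, nv q < r' -> [/\ nv (pt (q ord0 o0) (q ord0 o1) (Z q)) < r,
    pd o0 Z q = A (pt (q ord0 o0) (q ord0 o1) (Z q)), pd o2 Z q != 0 &
    (q ord0 o0 = 0 -> Z q = q ord0 o2)]].
Proof.
move=> r0 hA; have [r1 [Z [/andP[r10 r1r] hZ HZ]]] := ode_flow r0 hA.
have dZ0 : dfr Z 0 by apply: hZ; rewrite subrr nv0.
have Z1 : pd o2 Z 0 = 1.
  apply: (pd_o2_id r10 dZ0) => z hz; have [|_ _] := HZ (pt 0 0 z).
    by apply: nv_pt_lt; rewrite ?na0.
  by rewrite !ptE; apply.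
have [|r2 r20 H2] := neq0_near (pd_dfr o2 r10 hZ); first by rewrite Z1 oner_eq0.
exists (Num.min r1 r2), Z; split; first by rewrite lt_min r10.
  by apply: hol_sub hZ; rewrite ge_min lexx.
move=> q; rewrite lt_min => /andP[q1 q2]; have [h1 h2 h3] := HZ q q1.
by split => //; apply: H2; rewrite subr0.
Qed.

(** The equations say that dF is a nonzero multiple of dz - A dx - B dy. *)
Definition first_integral A B r F := hol 0 r F /\ forall q, nv q < r ->
  [/\ pd o2 F q != 0, pd o0 F q = - A q * pd o2 F q & pd o1 F q = - B q * pd o2 F q].

(** The disc of radius 2 is a domain containing both times 0 and 1. *)
Definition tangent_connected A B r p q := exists X Y Z dX dY dZ : K -> K,
  [/\ pt (X 0) (Y 0) (Z 0) = p, pt (X 1) (Y 1) (Z 1) = q & forall t, na t < 2 ->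
    let s := pt (X t) (Y t) (Z t) in
    [/\ nv s < r, cderiv X t (dX t), cderiv Y t (dY t), cderiv Z t (dZ t) &
      dZ t = A s * dX t + B s * dY t]].

(** Psi(x, y, F) = z differentiated in the three directions and solved for the gradient of F. The
    booleans are the Kronecker deltas of [hgrad_coord]. *)
Lemma gradient_inverse (a b m f0 f1 f2 : K) :
  a * true%:R + b * false%:R + m * f0 = false%:R ->
  a * false%:R + b * true%:R + m * f1 = false%:R ->
  a * false%:R + b * false%:R + m * f2 = true%:R ->
  [/\ f2 != 0, f0 = - a * f2 & f1 = - b * f2].
Proof.
rewrite /= !mulr0 !mulr1 !addr0 !add0r => h0 h1 h2.
have E (f c : K) : c + m * f = 0 -> f = - c * f2.
  move=> /eqP; rewrite addrC addr_eq0 => /eqP h.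
  by rewrite -h mulrAC h2 mul1r.
split; [|exact: E|exact: E].
by apply/eqP => f20; move/eqP: h2; rewrite f20 mulr0 eq_sym oner_eq0.
Qed.

(** The leaves are the graphs z = Psi(x, y, c). The first integral is the label c of the leaf
    through a point, found by solving Psi(x, y, F) = z. *)
Lemma first_integral_of_leaves A B r Psi : 0 < r -> hol 0 r Psi ->
  (forall q, nv q < r -> pd o0 Psi q = A (pt (q ord0 o0) (q ord0 o1) (Psi q))) ->
  (forall q, nv q < r -> pd o1 Psi q = B (pt (q ord0 o0) (q ord0 o1) (Psi q))) ->
  pd o2 Psi 0 != 0 -> Psi 0 = 0 ->
  exists2 rho, 0 < rho & exists F, first_integral A B rho F.
Proof.
move=> r0 hPsi Psi0 Psi1 Psi2 Psi00.
have [r6 [F [r60 hF HF _]]] := implicit_function r0 hPsi Psi2.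
have c0 : pt ((0 : V) ord0 o0) ((0 : V) ord0 o1) (Psi 0) = 0.
  by rewrite Psi00; apply: V_ext; rewrite !ptE !mxE.
rewrite c0 in hF HF.
exists r6; first exact: r60.
exists F; split; first exact: hF.
move=> q hq; have hq' : nv (q - 0) < r6 by rewrite subr0.
have [] := HF q hq'; rewrite subr0; set x := pt _ _ (F q) => x3 Ex.
have dx : dfr Psi x by apply: hPsi; rewrite subr0.
have g1 := @hgrad_comp3 _ Psi (fun v => v ord0 o0) (fun v => v ord0 o1) F
    q (fun j => pd j Psi x) (fun k => (k == o0)%:R) (fun k => (k == o1)%:R) (fun j => pd j F q)
    (diff_hgrad dx) (hgrad_coord o0 q) (hgrad_coord o1 q) (diff_hgrad (hF q hq')).
have g2 : hgrad (fun v => v ord0 o2) q (fun k => pd o0 Psi x * (k == o0)%:R +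
    pd o1 Psi x * (k == o1)%:R + pd o2 Psi x * pd k F q).
  apply: (@hgrad_near _ _ (fun v => v ord0 o2) q _ (r6 - nv q) _ _ g1); first by lra.
  move=> p hp; have [|_ ->//] := HF p.
  by rewrite subr0; have := nvD (p - q) q; rewrite subrK; lra.
have eqs k : pd o0 Psi x * (k == o0)%:R + pd o1 Psi x * (k == o1)%:R + pd o2 Psi x * pd k F q
    = (k == o2)%:R by rewrite -(hgrad_pd k g2) (hgrad_pd k (hgrad_coord o2 q)).
have xq : pt (x ord0 o0) (x ord0 o1) (Psi x) = q by rewrite Ex /x !ptE pt_eta.
have -> : A q = pd o0 Psi x by rewrite Psi0// xq.
have -> : B q = pd o1 Psi x by rewrite Psi1// xq.
exact: gradient_inverse (eqs o0) (eqs o1) (eqs o2).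
Qed.

Section FlowBox.
Variables (A B Z : V -> K) (r r' : R).
Hypotheses (r'0 : 0 < r') (hA : hol 0 r A) (hB : hol 0 r B) (hZ : hol 0 r' Z).
Hypothesis HZ : forall q, nv q < r' -> [/\ nv (pt (q ord0 o0) (q ord0 o1) (Z q)) < r,
    pd o0 Z q = A (pt (q ord0 o0) (q ord0 o1) (Z q)), pd o2 Z q != 0 &
    (q ord0 o0 = 0 -> Z q = q ord0 o2)].

(* In the coordinates (x, y, w), with z = Z(x, y, w), the plane field is dw = G dy. *)
Definition slope q := (B (pt (q ord0 o0) (q ord0 o1) (Z q)) - pd o1 Z q) * (pd o2 Z q)^-1.

Lemma slopeE q : nv q < r' ->
  pd o1 Z q + pd o2 Z q * slope q = B (pt (q ord0 o0) (q ord0 o1) (Z q)).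
Proof.
by move=> /HZ[_ _ h _]; rewrite /slope mulrC mulfVK// addrC subrK.
Qed.

Lemma slope_hol : hol 0 r' slope.
Proof.
move=> q hq; have := hq; rewrite subr0 => hq'; have [h1 h2 h3 h4] := HZ hq'.
apply: dfrM; last by apply: dfrV => //; exact: pd_hol hq.
apply: dfrB; last exact: pd_hol hq.
apply: dfr_comp3; [|exact: dfr_coord|exact: dfr_coord|exact: hZ].
by apply: hB; rewrite subr0.
Qed.

(** Mean value inequality with bound 0 along a segment on which only the first coordinate varies. *)
Lemma slope_indep : (forall q, nv q < r' -> pd o0 slope q = 0) ->
  forall q, nv q < r' -> slope q = slope (pt 0 (q ord0 o1) (q ord0 o2)).
Proof.
move=> H0 q hq; set q' := pt 0 _ _.
have hq' : nv q' < r' by apply: nv_pt_lt; rewrite ?na0 ?coord_lt.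
apply/eqP; rewrite -subr_eq0 -na_eq0; apply/eqP; apply/le_anti; rewrite na_ge0 andbT.
have -> : 0 = 2 * 0 :> R by rewrite mulr0.
have := @hgrad_mean _ slope q' q (fun (x : V) j => pd j slope x) 0; apply => t ht p.
have hp : nv p < r'.
  have := @nv_seg _ q' q 0 (Num.max (nv q') (nv q)) t ht.
  rewrite !subr0 -/p !le_max !lexx orbT => /(_ isT isT)/orP[] h.
    exact: le_lt_trans h hq'.
  exact: le_lt_trans h hq.
split; first by apply: diff_hgrad; apply: slope_hol; rewrite subr0.
by rewrite lin3E !vB /q' !ptE !subrr !mulr0 !addr0 H0// mul0r na0.
Qed.

(** Solving dW/dy = slope(0, y, W) with W = w at y = 0 gives the leaves z = Psi(x, y, w) = Z(x, y,
    W(y, w)). *)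
Lemma integrable_of_slope_indep : (forall q, nv q < r' -> pd o0 slope q = 0) ->
  exists2 rho, 0 < rho & exists F, first_integral A B rho F.
Proof.
move=> /slope_indep H0.
(* [ode_flow] integrates along the first coordinate, so y is moved there; [sw] makes the same move
   on points. *)
pose A' q := slope (pt 0 (q ord0 o0) (q ord0 o2)).
have hA' : hol 0 r' A'.
  move=> q; rewrite subr0 => hq; apply: dfr_comp3; [|exact: dfr_cst|exact: dfr_coord|exact: dfr_coord].
  by apply: slope_hol; rewrite subr0; apply: nv_pt_lt; rewrite ?na0 ?coord_lt.
have [r3 [W [/andP[r30 r3r] hW HW]]] := ode_flow r'0 hA'.
pose sw q := pt (q ord0 o1) 0 (q ord0 o2).
have nsw q : nv q < r3 -> nv (sw q) < r3.
  by move=> hq; apply: nv_pt_lt; rewrite ?na0 ?coord_lt.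
pose Wc q := W (sw q).
have gWc q : nv q < r3 -> hgrad Wc q (fun k => pd o0 W (sw q) * (k == o1)%:R + pd o1 W (sw q) * 0
    + pd o2 W (sw q) * (k == o2)%:R).
  move=> hq; apply: (@hgrad_comp3 _ W (fun v => v ord0 o1) (fun=> 0) (fun v => v ord0 o2)
    q (fun j => pd j W (sw q)) (fun k => (k == o1)%:R) (fun=> 0) (fun k => (k == o2)%:R)).
  - by apply: diff_hgrad; apply: hW; rewrite subr0 nsw.
  - exact: hgrad_coord.
  - exact: hgrad_cst.
  - exact: hgrad_coord.
pose Z' q := pt (q ord0 o0) (q ord0 o1) (Wc q).
have nZ' q : nv q < r3 -> nv (Z' q) < r'.
  move=> hq; have [h _ _] := HW (sw q) (nsw q hq).
  apply: nv_pt_lt; [have := coord_lt o0 hq; lra|have := coord_lt o1 hq; lra|].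
  by have := coord_lt o2 h; rewrite ptE.
pose Psi q := Z (Z' q).
have gPsi q : nv q < r3 -> hgrad Psi q (fun k => pd o0 Z (Z' q) * (k == o0)%:R +
    pd o1 Z (Z' q) * (k == o1)%:R + pd o2 Z (Z' q) * (pd o0 W (sw q) * (k == o1)%:R
    + pd o1 W (sw q) * 0 + pd o2 W (sw q) * (k == o2)%:R)).
  move=> hq; apply: (@hgrad_comp3 _ Z (fun v => v ord0 o0) (fun v => v ord0 o1) Wc
    q (fun j => pd j Z (Z' q)) (fun k => (k == o0)%:R) (fun k => (k == o1)%:R)).
  - by apply: diff_hgrad; apply: hZ; rewrite subr0 nZ'.
  - exact: hgrad_coord.
  - exact: hgrad_coord.
  - exact: gWc.
have hPsi : hol 0 r3 Psi by move=> q; rewrite subr0 => /gPsi/hgrad_dfr.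
have Psi0 q : nv q < r3 -> pd o0 Psi q = A (pt (q ord0 o0) (q ord0 o1) (Psi q)).
  move=> hq; have aux (a b c d e f : K) : a * true%:R + b * false%:R +
      c * (d * false%:R + e * 0 + f * false%:R) = a by rewrite /=; ring.
  rewrite (etrans (hgrad_pd o0 (gPsi q hq)) (aux _ _ _ _ _ _)).
  by have [_ -> _ _] := HZ (nZ' q hq); rewrite !ptE.
have Psi1 q : nv q < r3 -> pd o1 Psi q = B (pt (q ord0 o0) (q ord0 o1) (Psi q)).
  move=> hq; have aux (a b c d e f : K) : a * false%:R + b * true%:R +
      c * (d * true%:R + e * 0 + f * false%:R) = b + c * d by rewrite /=; ring.
  rewrite (etrans (hgrad_pd o1 (gPsi q hq)) (aux _ _ _ _ _ _)).
  have [_ -> _] := HW (sw q) (nsw q hq).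
  have := slopeE (nZ' q hq); rewrite H0 ?nZ'//.
  by rewrite /A' !ptE.
have Psi2 : pd o2 Psi 0 = 1.
  apply: (pd_o2_id r30); first by apply: hPsi; rewrite subrr nv0.
  move=> z hz; have hpz : nv (pt 0 0 z) < r3 by apply: nv_pt_lt; rewrite ?na0.
  have [_ _ _ ZE] := HZ (nZ' _ hpz).
  have [_ _ WE] := HW _ (nsw _ hpz).
  by rewrite /Psi ZE !ptE// /Wc WE !ptE.
have Psi00 : Psi 0 = 0.
  have h0 : nv (0 : V) < r3 by rewrite nv0.
  have [_ _ _ ZE] := HZ (nZ' _ h0); have [_ _ WE] := HW _ (nsw _ h0).
  by rewrite /Psi ZE !ptE ?mxE// /Wc WE !ptE ?mxE.
by apply: first_integral_of_leaves r30 hPsi Psi0 Psi1 _ Psi00; rewrite Psi2 oner_eq0.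
Qed.

(** Two inversions: [T] recovers w from (x, y, z), and [S] recovers x from (w, y, u) because dG/dx
    is nonzero at [qs]. A Legendrian curve in (y, u, w) then lifts through x = S(w, y, u) and z =
    Z(x, y, w). *)
Lemma connected_of_slope_dep qs : nv qs < r' -> pd o0 slope qs != 0 ->
  exists2 ps, nv ps < r & exists2 rho, 0 < rho & forall q, nv (q - ps) < rho ->
    tangent_connected A B r ps q.
Proof.
move=> hqs; have rr' := r'0.
(* From here on [G] is opaque: its holomorphy, [slopeE] and [G0] suffice. *)
move: slope slope_hol slopeE => G hG GE G0.
(* [implicit_function] solves for the last coordinate; exchanging x and w makes it solve for x. *)
pose sw3 v := pt (v ord0 o2) (v ord0 o1) (v ord0 o0).
have sw3B u v : sw3 u - sw3 v = sw3 (u - v) by rewrite /sw3 ptB !vB.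
have sw3_lt v e : nv v < e -> nv (sw3 v) < e by move=> hv; apply: nv_pt_lt; exact: coord_lt.
have sw3K v : sw3 (sw3 v) = v by rewrite /sw3 !ptE pt_eta.
pose c := sw3 qs; pose s0 := r' - nv qs; have s00 : 0 < s0 by rewrite subr_gt0.
have near_qs v : nv (v - qs) < s0 -> nv v < r'.
  by move=> hv; have := nvD (v - qs) qs; rewrite subrK; move: hv; rewrite /s0; lra.
have near_c v : nv (v - c) < s0 -> nv (sw3 v) < r'.
  by move=> hv; apply: near_qs; rewrite -[qs]sw3K sw3B; exact: sw3_lt.
pose H v := G (sw3 v).
have gH v : nv (sw3 v) < r' -> hgrad H v (fun k => pd o0 G (sw3 v) * (k == o2)%:R +
    pd o1 G (sw3 v) * (k == o1)%:R + pd o2 G (sw3 v) * (k == o0)%:R).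
  move=> hv; apply: (@hgrad_comp3 _ G (fun v => v ord0 o2) (fun v => v ord0 o1)
    (fun v => v ord0 o0) v (fun j => pd j G (sw3 v))).
  - by apply: diff_hgrad; apply: hG; rewrite subr0.
  - exact: hgrad_coord.
  - exact: hgrad_coord.
  - exact: hgrad_coord.
have hH : hol c s0 H by move=> v /near_c/gH/hgrad_dfr.
have Hc : H c = G qs by rewrite /H /c sw3K.
have pdH : pd o2 H c != 0.
  have hc : nv (sw3 c) < r' by rewrite sw3K.
  have aux (a b d : K) : a * true%:R + b * false%:R + d * false%:R = a by rewrite /=; ring.
  by rewrite (etrans (hgrad_pd o2 (gH c hc)) (aux _ _ _)) /c sw3K.
have [c0 c1 c2] : [/\ c ord0 o0 = qs ord0 o2, c ord0 o1 = qs ord0 o1 & c ord0 o2 = qs ord0 o0].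
  by split; [exact: pt0|exact: pt1|exact: pt2].
have [rS [S [rS0 hS HS [r2 r20 uS]]]] := implicit_function s00 hH pdH.
rewrite c0 c1 Hc in hS HS uS; set c' := pt _ _ (G qs) in hS HS uS.
have hZs : hol qs s0 Z by move=> v hv; apply: hZ; rewrite subr0 near_qs.
have [_ _ pdZ _] := HZ hqs.
have [rT [T [rT0 hT HT [r3 r30 uT]]]] := implicit_function s00 hZs pdZ.
set ps := pt _ _ (Z qs) in hT HT uT.
have psr : nv ps < r by have [] := HZ hqs.
have qq : nv (qs - qs) < r3 by rewrite subrr nv0.
have [_ Tps] := uT qs qq; rewrite -/ps in Tps.
have [p0 p1] : ps ord0 o0 = qs ord0 o0 /\ ps ord0 o1 = qs ord0 o1.
  by split; [exact: pt0|exact: pt1].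
have [rho1 rho10 leg] := legendrian_connection (qs ord0 o1) (G qs) (qs ord0 o2) rS0.
(* The coordinate u as a function of (x, y, z). *)
pose U q := G (pt (q ord0 o0) (q ord0 o1) (T q)).
have dT : dfr T ps by apply: hT; rewrite subrr nv0.
have psqs : pt (ps ord0 o0) (ps ord0 o1) (T ps) = qs by rewrite p0 p1 Tps pt_eta.
have dU : dfr U ps.
  apply: dfr_comp3; [|exact: dfr_coord|exact: dfr_coord|exact: dT].
  by rewrite psqs; apply: hG; rewrite subr0.
have Ups : U ps = G qs by rewrite /U psqs.
(* [e] must respect the connection radius [rho1] and the radius [r2] on which [S] undoes the change
   of coordinates. *)
have [e [e0 e1 e2]] : exists e, [/\ 0 < e, e <= rho1 & e < r2].
  exists (Num.min rho1 (r2 / 2)).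
  have h2 : 0 < r2 / 2 by lra.
  have m1 : Num.min rho1 (r2 / 2) <= r2 / 2 by rewrite ge_min lexx orbT.
  by rewrite lt_min rho10 h2 ge_min lexx; split => //; lra.
have [r4 r40 cT] := dfr_ctn dT e0; have [r5 r50 cU] := dfr_ctn dU rho10.
exists ps; first exact: psr.
exists (Num.min (Num.min e rT) (Num.min r4 r5)); first by rewrite !lt_min e0 rT0 r40 r50.
move=> q; rewrite !lt_min => /andP[/andP[q1 q2] /andP[/ltW/cT q3 /ltW/cU q4]].
rewrite Tps in q3; rewrite Ups in q4.
have hj j : na (q ord0 j - ps ord0 j) < e by rewrite -vB coord_lt.
have hq0 : na (q ord0 o0 - qs ord0 o0) < e by rewrite -p0.
have hq1 : na (q ord0 o1 - qs ord0 o1) < e by rewrite -p1.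
have hq1' : na (q ord0 o1 - qs ord0 o1) <= rho1 by exact: ltW (lt_le_trans hq1 e1).
have hq3 : na (T q - qs ord0 o2) <= rho1 by exact: le_trans q3 e1.
have [y [u [w [dy [du [[y0 u0 w0] [y1 u1 w1] hyuw byuw]]]]]] :=
  leg (q ord0 o1) (U q) (T q) hq1' q4 hq3.
have [_ Zq] := HT q q2.
pose v t := pt (w t) (y t) (u t).
pose X t := S (v t).
pose m t := pt (X t) (y t) (w t).
pose dX t := pd o0 S (v t) * (u t * dy t) + pd o1 S (v t) * dy t + pd o2 S (v t) * du t.
pose dZ t := pd o0 Z (m t) * dX t + pd o1 Z (m t) * dy t + pd o2 Z (m t) * (u t * dy t).
exists X, y, (fun t => Z (m t)), dX, dy, dZ; split.
- have X0 : X 0 = qs ord0 o0.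
    have cc : nv (c - c) < r2 by rewrite subrr nv0.
    by have [_] := uS c cc; rewrite c0 c1 c2 Hc /X /v w0 y0 u0.
  by rewrite /m X0 y0 w0 pt_eta.
- have X1 : X 1 = q ord0 o0.
    have hp : nv (pt (T q) (q ord0 o1) (q ord0 o0) - c) < r2.
      rewrite /c /sw3 ptB; apply: nv_pt_lt; [exact: le_lt_trans q3 e2|exact: lt_trans hq1 e2|].
      exact: lt_trans hq0 e2.
    by have [_] := uS _ hp; rewrite !ptE /H /sw3 !ptE /X /v w1 y1 u1.
  by rewrite /m X1 y1 w1 Zq pt_eta.
move=> t /byuw[by' bu bw] s.
have hv : nv (v t - c') < rS by rewrite ptB; exact: nv_pt_lt.
have [HS1 HS2] := HS _ hv.
have hm : nv (m t) < r'.
  by have := near_c _ HS1; rewrite /sw3 !ptE.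
have sm : G (m t) = u t by move: HS2; rewrite /H /sw3 !ptE.
have [Z1 Z2 _ _] := HZ hm; have Z3 := GE _ hm.
have [hy hu hw] := hyuw t.
have mE : pt (m t ord0 o0) (m t ord0 o1) (Z (m t)) = s by rewrite /s /m !ptE.
rewrite mE in Z1 Z2 Z3; rewrite sm in Z3.
have dS : dfr S (v t) by exact: hS.
have hX : cderiv X t (dX t) by exact: (cderiv_comp3 (diff_hgrad dS) hw hy hu).
have dZm : dfr Z (m t) by apply: hZ; rewrite subr0.
split.
- exact: Z1.
- exact: hX.
- exact: hy.
- exact: (cderiv_comp3 (diff_hgrad dZm) hX hy hw).
(* dZ = Z_x dX + (Z_y + u Z_w) dy. Here Z_x = A by the flow equation, and Z_y + u Z_w = B by
   [slopeE], the slope being u along the curve. *)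
- by rewrite /dZ Z2 -Z3; ring.
Qed.

End FlowBox.

(** In the second case [ps] need not be the centre, since dG/dx may vanish there. *)
Lemma integrable_or_connected A B r : 0 < r -> hol 0 r A -> hol 0 r B ->
  (exists2 rho, 0 < rho & exists F, first_integral A B rho F) \/
  (exists2 ps, nv ps < r & exists2 rho, 0 < rho & forall q, nv (q - ps) < rho ->
    tangent_connected A B r ps q).
Proof.
move=> r0 hA hB; have [r' [Z [r'0 hZ HZ]]] := flow_box r0 hA.
have [H|/existsNP[qs /not_implyP[hqs /eqP H]]] :=
  pselect (forall q, nv q < r' -> pd o0 (slope B Z) q = 0).
  by left; exact: (integrable_of_slope_indep r'0 hB hZ HZ H).
by right; exact: (connected_of_slope_dep r'0 hB hZ HZ hqs H).
Qed.

End PlaneFields.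

(** * Reduction of a distribution to a graph; admissible curves *)

Section Transport.
Context {R : realType}.
Local Notation K := R[i].
Local Notation V := (C3 R).
Implicit Types (u v h p q c x : V) (f g A B F : V -> K) (e r : R).

Lemma nv_open p r : open [set q : V | nv (q - p) < r].
Proof.
rewrite openE => q /= hq; apply/nbhs_nvP; exists ((r - nv (q - p)) / 2); first by lra.
by move=> x hx /=; have := nv_tri x q p; lra.
Qed.

(** Connectedness: the disc is the union of the segments from 0 to its points. *)
Lemma disc_domain (r : R) : 0 < r -> cdomain [set t : Cl R | na t < r].
Proof.
move=> r0; split.
  rewrite openE => t /= ht; apply/nbhs_naP; exists ((r - na t) / 2); first by lra.
  by move=> w hw /=; have := na_tri w t 0; rewrite !subr0; lra.
split; last by exists 0; rewrite /= na0.
have -> : [set t : Cl R | na t < r] =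
    \bigcup_(t in [set t : Cl R | na t < r]) ((fun s : R => (s%:C%C * t : K) : Cl R) @` `[0, 1]%classic).
  apply/seteqP; split=> [t /= ht|t [w /= hw [s]]].
    exists t => //=; exists 1; last by rewrite rmorph1 mul1r.
    by rewrite in_itv /= ler01 lexx.
  rewrite in_itv /= => /andP[s0 s1] <-; rewrite naM naC ger0_norm//.
  by rewrite (le_lt_trans _ hw)// ler_piMl ?na_ge0.
apply: bigcup_connected.
  exists 0 => w /= hw; exists 0; last by rewrite rmorph0 mul0r.
  by rewrite in_itv /= ler01 lexx.
move=> w hw; apply: connected_continuous_connected; first exact: segment_connected.
apply: continuous_subspaceT => s; apply/cvgrPdist_le => _ /pos_complex[e e0 ->].
have c0 : 0 < na w + 1 by rewrite ltr_wpDl ?na_ge0.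
exists (e / (na w + 1)); first by rewrite /= divr_gt0.
move=> s' /= /ltW; rewrite ler_pdivlMr// => h; rewrite leC.
rewrite (_ : _ - _ = (s - s')%:C%C * w); last by rewrite rmorphB mulrBl.
by rewrite naM naC (le_trans _ h)// ler_wpM2l//; lra.
Qed.

Lemma curve_derive (g : Cl R -> V) (t : K) (d : V) :
  (forall j, cderiv (fun s => g s ord0 j) t (d ord0 j)) ->
  derivable g (t : Cl R) (1 : Cl R) /\ derive1 (g : K -> V) t = d.
Proof.
move=> H.
suff h : (fun h : (K : numFieldType) => h^-1 *: (g (h *: (1 : Cl R) + t) - g t)) @ 0^' --> d.
  split; first exact: cvgP h.
  by rewrite derive1E; exact: cvg_lim h.
apply/cvgrPdist_le => _ /pos_complex[e e0 ->].
have {}H j : exists r, 0 < r /\ forall h : K, na h <= r ->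
    na (g (t + h) ord0 j - g t ord0 j - d ord0 j * h) <= e * na h.
  by have [r r0 Hr] := H j e e0; exists r.
have [r Hr] := choice H.
apply/dnbhs_naP; exists (Num.min (r o0) (Num.min (r o1) (r o2))).
  by rewrite !lt_min (Hr o0).1 (Hr o1).1 (Hr o2).1.
move=> h; rewrite !le_min => /and3P[h0 h1 h2] hn0.
have hr j : na h <= r j by move: j; apply: ord3P.
rewrite nvE lecR; apply: nv_le => [|j]; first exact: ltW.
rewrite vB vZ vB.
rewrite -(ler_pM2r (_ : 0 < na h)); last by rewrite lt_def na_ge0 na_eq0 hn0.
rewrite -naM mulrBl mulrAC mulVf// mul1r naBC.
have -> : h *: (1 : Cl R) + t = t + h by rewrite /GRing.scale /= mulr1 addrC.
exact: (Hr j).2 h (hr j).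
Qed.

(** The transposition of [k] and [o2], which brings a coordinate with nonzero coefficient to the
    last place. *)
Definition sw (k j : 'I_3) : 'I_3 := if j == o2 then k else if j == k then o2 else j.

Lemma swK k : involutive (sw k).
Proof. by move: k; apply: ord3P; apply: ord3P; apply: val_inj. Qed.

Definition swap k x : V := \row_j x ord0 (sw k j).

Lemma swapE k x j : swap k x ord0 j = x ord0 (sw k j). Proof. by rewrite mxE. Qed.

Lemma swapK k : involutive (swap k).
Proof. by move=> x; apply/rowP => j; rewrite !swapE swK. Qed.

Lemma nv_swap k x r : nv x < r -> nv (swap k x) < r.
Proof. by move=> hx; apply: nv_lt3; rewrite swapE coord_lt. Qed.

Lemma swapB k u v : swap k (u - v) = swap k u - swap k v.
Proof. by apply/rowP => j; rewrite vB !swapE vB. Qed.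

Lemma lin3_swap k a v : lin3 (fun j => a (sw k j)) v = lin3 a (swap k v).
Proof.
rewrite /lin3 [RHS](reindex_inj (inv_inj (swK k))).
by apply: eq_bigr => j _; rewrite swapE swK.
Qed.

Lemma hgrad_swap f k p q a : hgrad f (swap k (q - p)) a ->
  hgrad (fun q => f (swap k (q - p))) q (fun j => a (sw k j)).
Proof.
move=> Hf e e0; have [r r0 Hr] := Hf e e0; exists (r / 2); first by lra.
move=> h hr.
have n1 : nv (swap k h) <= nv h by apply: nv_le3; rewrite swapE nv_coord.
have -> : swap k (q + h - p) = swap k (q - p) + swap k h.
  by apply/rowP => j; rewrite !(vD, vN, swapE); ring.
rewrite lin3_swap (le_trans (Hr _ _))//; first by lra.
by rewrite ler_wpM2l// ltW.
Qed.

(** Some coefficient [a k] is nonzero near [p]; dividing by its negative solves the equation of the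
    plane for the component along [k]. *)
Lemma distribution_graph (D : V -> set V) p : hol_hyperplane_distribution D ->
  exists k A B r, [/\ 0 < r, hol 0 r A, hol 0 r B & forall x, nv x < r -> forall u,
    D (p + swap k x) (swap k u) <-> u ord0 o2 = A x * u ord0 o0 + B x * u ord0 o1].
Proof.
move=> /(_ p)[W [Wp [a [ha HD]]]].
have [[k ak] _] := HD p Wp.
have [oW dW] := ha k.
have [r1 r10 H1] : exists2 r, 0 < r & forall q, nv (q - p) <= r -> W q.
  by apply/nbhs_nvP; exact: open_nbhs_nbhs.
have [r2 r20 H2] := neq0_near (dW p Wp : dfr (a k) p) ak.
pose r := Num.min r1 r2; have r0 : 0 < r by rewrite lt_min r10.
have near x : nv x < r -> W (p + swap k x) /\ a k (p + swap k x) != 0.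
  move=> /(nv_swap k); rewrite lt_min => /andP[h1 h2].
  have e1 : p + swap k x - p = swap k x by rewrite addrAC subrr add0r.
  by split; [apply: H1; rewrite e1 ltW|apply: H2; rewrite e1].
have da i x : nv x < r -> dfr (fun x => a i (p + swap k x) : K) x.
  move=> /near[Wx _].
  pose g (j : 'I_3) x : K := p ord0 j + x ord0 (sw k j).
  have gE x' : p + swap k x' = rowmap g x' by apply/rowP => j; rewrite vD swapE mxE.
  under eq_fun do rewrite gE; apply: dfr_comp; first by rewrite -gE; exact: (ha i).2.
  by move=> j; apply: dfrD; [exact: dfr_cst|exact: dfr_coord].
pose Q i x : K := (a i (p + swap k x) : K) * (- (a k (p + swap k x) : K))^-1.
have hQ i : hol 0 r (Q i).
  move=> x; rewrite subr0 => hx; apply: dfrM; first exact: da.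
  have [_ hk] := near x hx; apply: dfrV; first by rewrite oppr_eq0.
  have -> : (fun x => - (a k (p + swap k x) : K)) = (fun x => -1 * (a k (p + swap k x) : K)).
    by apply/funext => y; rewrite mulN1r.
  by apply: dfrM; [exact: dfr_cst|exact: da].
exists k, (Q (sw k o0)), (Q (sw k o1)), r; split => // x hx u.
have [Wx nk] := near x hx; have [_ ->] := HD _ Wx; rewrite /=.
have -> : \sum_(i < 3) (a i (p + swap k x) : K) * swap k u ord0 i =
    a (sw k o0) (p + swap k x) * u ord0 o0 + a (sw k o1) (p + swap k x) * u ord0 o1 +
    a k (p + swap k x) * u ord0 o2.
  apply: etrans (esym (lin3_swap k (fun i => a i (p + swap k x)) u)) _.
  by rewrite lin3E.
rewrite /Q; set a0 : K := a (sw k o0) _; set a1 : K := a (sw k o1) _; set ak' : K := a k _ in nk *.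
split=> [h|->]; last by field; exact: nk.
apply: (mulfI nk); rewrite [RHS](_ : _ = - (a0 * u ord0 o0 + a1 * u ord0 o1)).
  by apply/eqP; rewrite -addr_eq0 addrC; apply/eqP.
by field; exact: nk.
Qed.

End Transport.

Theorem mainTheorem1 (R : realType) (D : C3 R -> set (C3 R)) :
  hol_hyperplane_distribution D ->
  (forall (p : C3 R) (U : set (C3 R)), nbhs p U ->
     exists q, U q /\ ~ reachable_in D U p q) ->
  integrable_distribution D.
Proof.
move=> hD unreach p.
have [k [A [B [r [r0 hA hB DE]]]]] := distribution_graph p hD.
have [[rho rho0 [F [hF HF]]]|[ps hps [rho rho0 conn]]] := integrable_or_connected r0 hA hB.
  pose s := Num.min r rho; have s0 : 0 < s by rewrite lt_min r0.
  exists [set q | nv (q - p) < s]; split; first by rewrite /= subrr nv0.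
  have near q : nv (q - p) < s -> nv (swap k (q - p)) < r /\ nv (swap k (q - p)) < rho.
    by move=> /(nv_swap k); rewrite lt_min => /andP[].
  have gF q : nv (q - p) < s -> hgrad (fun q => F (swap k (q - p))) q
      (fun j => pd (sw k j) F (swap k (q - p))).
    move=> /near[_ h]; apply: (hgrad_swap (a := fun j => pd j F (swap k (q - p)))).
    by apply: diff_hgrad; apply: hF; rewrite subr0.
  exists (fun q => F (swap k (q - p)) : R[i]); split.
    by split; [exact: nv_open|move=> q /gF/hgrad_dfr].
  move=> q hq; have [xr xrho] := near q hq; set x := swap k (q - p) in xr xrho.
  have [F2 F0 F1] := HF x xrho.
  (* By [first_integral] the differential is [pd o2 F x], which is nonzero, times a form defining
     [D]; so the kernels agree. *)
  have dE v : 'd (fun q => F (swap k (q - p)) : Cl R) q v =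
      pd o2 F x * (swap k v ord0 o2 - (A x * swap k v ord0 o0 + B x * swap k v ord0 o1)) :> R[i].
    have dq : dfr (fun q => F (swap k (q - p))) q := hgrad_dfr (gF q hq).
    rewrite (diff_lin3 v dq).
    have -> : (fun j => pd j (fun q => F (swap k (q - p))) q) = (fun j => pd (sw k j) F x).
      by apply/funext => j; rewrite (hgrad_pd j (gF q hq)).
    by rewrite (lin3_swap k (fun j => pd j F x)) lin3E F0 F1; ring.
  have qE : p + swap k x = q by rewrite /x swapK addrC subrK.
  split.
    exists (swap k (pt 0 0 1)); apply/eqP; rewrite dE swapK !ptE !mulr0 addr0 subr0 mulr1.
    by apply/eqP.
  apply/seteqP; split=> v /=.
    rewrite -{1}qE -{1}[v](swapK k) => /(DE x xr) h; rewrite dE h subrr mulr0//.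
  rewrite dE => /eqP; rewrite mulf_eq0 (negbTE F2) /= subr_eq0 => /eqP h.
  by rewrite -{1}qE -{1}[v](swapK k); apply/(DE x xr).
exfalso.
(* The hypothesis will be applied at [P], which may differ from [p]. *)
pose P := p + swap k ps.
pose O := [set t : Cl R | na t < 2].
pose Bd := [set q : C3 R | nv (swap k (q - p)) < r].
have reach q : nv (q - P) < rho -> reachable_in D Bd P q.
  move=> hq; have [|X [Y [Z [dX [dY [dZ [c0 c1 cv]]]]]]] := conn (swap k (q - p)).
    have -> : swap k (q - p) - ps = swap k (q - P).
      by rewrite -{1}[ps](swapK k) -swapB /P opprD addrA.
    exact: nv_swap.
  pose c t := pt (X t) (Y t) (Z t).
  pose g (t : Cl R) : C3 R := p + swap k (c t).
  have gp t : swap k (g t - p) = c t by rewrite /g addrAC subrr add0r swapK.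
  have dg t : O t -> derivable g t (1 : Cl R) /\
      derive1 (g : R[i] -> C3 R) t = swap k (pt (dX t) (dY t) (dZ t)).
    move=> /cv[_ hX hY hZ _]; apply: curve_derive => j; rewrite swapE.
    have -> : (fun s => g s ord0 j) = (fun s => p ord0 j + c s ord0 (sw k j)).
      by apply/funext => s; rewrite /g vD swapE.
    rewrite -[X in cderiv _ _ X]add0r; apply: cderivD; first exact: cderiv_cst.
    move: (sw k j); apply: ord3P; rewrite ?ptE.
    - by have -> : (fun s => c s ord0 o0) = X by apply/funext => s; rewrite ptE.
    - by have -> : (fun s => c s ord0 o1) = Y by apply/funext => s; rewrite ptE.
    - by have -> : (fun s => c s ord0 o2) = Z by apply/funext => s; rewrite ptE.
  exists O, g; split; first split; last split.
  - by apply: disc_domain.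
  - split=> t Ot; first by have [] := dg t Ot.
    have [_ ->] := dg t Ot; have [hr _ _ _ eqZ] := cv t Ot.
    by apply/(DE (c t) hr); rewrite !ptE.
  - by move=> t /cv[hr _ _ _ _]; rewrite /Bd /= gp.
  exists 0, 1; split; first by rewrite /O /= na0.
  split; first by rewrite /O /= na1; lra.
  by rewrite /g /c c0 c1 swapK (addrC p (q - p)) subrK.
have [q [Uq]] : exists q, [set q | reachable_in D Bd P q] q /\
    ~ reachable_in D [set q | reachable_in D Bd P q] P q.
  apply: unreach; apply/nbhs_nvP; exists (rho / 2); first by lra.
  by move=> q hq; apply: reach; lra.
have [Q [g [adm [gU [t1 [t2 [Ot1 [Ot2 [g1 g2]]]]]]]]] := Uq.
(* Every [g t] lies with [P] on this same curve, so the curve never leaves the reachable set. *)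
case; exists Q, g; split => //; split; last by exists t1, t2.
by move=> t Ot /=; exists Q, g; split => //; split => //; exists t1, t.
Qed.
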